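(* Let $C$ be a longest cycle in a $(\delta-\lambda+1)$-connected graph $G$ of order $n$, where $\lambda$ is an integer with $1\le\lambda\le\delta$. If $\delta\geq \frac{n+2}{\lambda+1}+\lambda-2$, then $\overline{c}\leq \delta-\lambda$.
   Context: All graphs are finite, undirected, without loops or multiple edges. For a graph $G$ on $n$ vertices, $\delta$ denotes its minimum degree and $\kappa$ its connectivity. A cycle of order $t$ is a sequence $v_1\dots v_tv_1$ of distinct vertices with consecutive vertices adjacent; a single vertex is a cycle of order 1 and an edge a cycle of order 2. $C$ is a longest cycle of $G$, $c=|C|$ is the circumference, and $\overline{c}$ denotes the order of a longest cycle in $G-C$ (the subgraph obtained by deleting the vertices of $C$); $\overline{c}\le 0$ if $G-C$ is empty. *)

(* Defs.v *)
From mathcomp Require Import all_boot all_order all_algebra.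

Set Implicit Arguments.
Unset Strict Implicit.
Unset Printing Implicit Defensive.

Record sgraph := SGraph {
  vertex :> finType;
  adj : rel vertex;
  adj_sym : symmetric adj;
  adj_irrefl : irreflexive adj
}.

Section Induced.
Variables (G : sgraph) (A : {set G}).

Definition induced_adj : rel {x : G | x \in A} :=
  fun x y => adj (val x) (val y).

Lemma induced_adj_sym : symmetric induced_adj.
Proof. by move=> x y; apply: adj_sym. Qed.

Lemma induced_adj_irrefl : irreflexive induced_adj.
Proof. by move=> x; apply: adj_irrefl. Qed.

Definition induced : sgraph := SGraph induced_adj_sym induced_adj_irrefl.
End Induced.

Definition del_vertices (G : sgraph) (S : {set G}) : sgraph := induced (~: S).

Definition degree (G : sgraph) (v : G) : nat := #|[set w | adj v w]|.

(* Degrees are < #|G|, so the default value #|G| only matters, harmlessly,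
   for the graph without vertices. *)
Definition min_degree (G : sgraph) : nat :=
  \big[minn/#|G|]_(v : G) degree v.

Definition connected (G : sgraph) : Prop :=
  forall x y : G, connect (@adj G) x y.

Definition k_connected (k : nat) (G : sgraph) : Prop :=
  k < #|G| /\
  forall S : {set G}, #|S| < k -> connected (del_vertices S).

(* The sequence v_1 ... v_t stands for the cycle v_1 ... v_t v_1. A single
   vertex counts as a cycle of order 1, which [path.cycle] rejects since adj is
   irreflexive; on two vertices [path.cycle] amounts to adjacency, so an edge is
   a cycle of order 2. *)
Definition is_cycle (G : sgraph) (c : seq G) : bool :=
  [&& 0 < size c, uniq c & (size c == 1) || cycle (@adj G) c].

Definition longest_cycle (G : sgraph) (c : seq G) : Prop :=
  is_cycle c /\ forall d : seq G, is_cycle d -> size d <= size c.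

(* Order of a longest cycle; it is 0 for the graph without vertices. *)
Definition circumference (G : sgraph) : nat :=
  \max_(k < #|G|.+1 | [exists t : k.-tuple G, is_cycle t]) k.

(* The order of a longest cycle in G - C. *)
Definition c_bar (G : sgraph) (C : seq G) : nat :=
  circumference (del_vertices [set x in C]).

(* Main.v *)
Require Import Defs.
From mathcomp Require Import all_boot all_order all_algebra.
From mathcomp Require Import zify ring.

Set Implicit Arguments.
Unset Strict Implicit.
Unset Printing Implicit Defensive.

(* Put mu = delta - lambda + 1 and B = V \ C, and suppose that a longest cycle H of B has order
   h >= mu; we show n >= (mu + 1)(lambda + 1) - 1, against the hypothesis on delta.

   Call a vertex of B low if it has fewer than min(h, lambda) neighbours in B; it then has many
   neighbours on C. If more than half of min(h, lambda) disjoint paths of B join H to low vertices, the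
   paths extended to C form branches of a connected subgraph rooted at H, and comparing consecutive
   attachments on the longest cycle C with long arcs of H bounds |C| from below. (When h > lambda, B is
   first replaced by the block D containing H, and the vertices of D with neighbours in B \ D also count
   as ends: by connectivity, the part of B \ D behind such a vertex has many neighbours on C.)
   Otherwise Menger's theorem confines H to a set W whose boundary has at most half of min(h, lambda)
   vertices. Either any two vertices of W are joined inside W by a path on lambda vertices, and mu
   disjoint paths from W to C give |C| >= mu (lambda + 1), or there is a longest path P of W, between two
   fixed ends, that is too short (P = H with one edge removed when h <= lambda). This is impossible:
   after shrinking W, every vertex of W off P lies on its boundary, because a non-boundary vertex off P
   would yield a long path rooted in a detour of P by an Erdos-Gallai argument; and then the vertices of
   P have so many neighbours in so few places that P can be rerouted to a longer path. *)

(** * Paths and Menger's theorem *)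

(** The degree of a vertex is shared between B and C, so only vertices with few neighbours in B
    force anything on C, and H need not contain one; hence the alternative between reaching many low
    vertices and being cut off by a small boundary. One half is the threshold that serves both
    sides. On the first, each attachment gets weight h + 1 per branch it sees and each unit of C is
    charged R >= max(h + 1, 2|I|), where I indexes the branches, so for h <= lambda nothing is lost
    once 2|I| > h. On the second, each boundary vertex on P spoils at most two consecutive pairs of
    P, and 2|S| <= min(h, lambda), with S the boundary, is what that count tolerates. For h <=
    lambda the branches give n + 1 >= (h + 1)(lambda + mu - h + 1), a product of factors with
    constant sum; as mu <= h <= lambda it is least at the ends of the range, where it equals (mu +
    1)(lambda + 1). *)

Section Connectivity.
Variable T : finType.
Implicit Types (e : rel T) (A B X Y S : {set T}) (x y z : T) (p q : seq T).

Definition ein e A : rel T := fun x y => [&& x \in A, y \in A & e x y].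
Arguments ein e A x y /.

Definition conn e A := [forall x in A, forall y in A, connect (ein e A) x y].

Definition upath e A x p y :=
  [&& path e x p, uniq (x :: p), all [in A] (x :: p) & last x p == y].

Definition lp e A x y n := exists2 p, upath e A x p y & n <= (size p).+1.

Lemma ein_sym e A : symmetric e -> symmetric (ein e A).
Proof. by move=> es x y; rewrite /ein /= es; case: (x \in A); case: (y \in A). Qed.

Lemma connect_ein_sym e A : symmetric e -> connect_sym (ein e A).
Proof. by move=> es; apply: sym_connect_sym; apply: ein_sym. Qed.

Lemma path_ein e A x p : path e x p -> all [in A] (x :: p) -> path (ein e A) x p.
Proof.
elim: p x => //= z p IH x /andP[exz pp] /and3P[xA zA pA].
by rewrite xA zA exz /= IH //= zA.
Qed.

Lemma path_ein_connect e A x p :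
  path e x p -> all [in A] (x :: p) -> connect (ein e A) x (last x p).
Proof. by move=> pp pA; apply/connectP; exists p => //; apply: path_ein. Qed.

Lemma ein_path e A x p : x \in A -> path (ein e A) x p -> path e x p /\ all [in A] (x :: p).
Proof.
elim: p x => [|z p IH] x xA //=; first by rewrite xA.
by case/andP=> /and3P[_ zA ->] /(IH _ zA)[-> /=]; rewrite xA.
Qed.

Lemma connect_upath e A x y : x \in A -> connect (ein e A) x y ->
  exists p, upath e A x p y.
Proof.
move=> xA /connectP[p pp ->]; case/shortenP: pp => q pq uq _.
have [pe qA] := ein_path xA pq.
by exists q; rewrite /upath pe uq qA eqxx.
Qed.

Lemma upath_connect e A x p y : upath e A x p y -> connect (ein e A) x y.
Proof. by case/and4P=> pp _ pA /eqP<-; apply: path_ein_connect. Qed.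

Lemma connect_einW e A B x y : A \subset B -> connect (ein e A) x y -> connect (ein e B) x y.
Proof.
move=> /subsetP sAB; apply: connect_sub => u v /and3P[uA vA euv].
by apply: connect1; rewrite /= euv !sAB.
Qed.

Lemma connect_einB e A x y : connect (ein e A) x y -> x \in A -> y \in A.
Proof. by move=> c xA; have [p /and4P[_ _ /allP pA /eqP<-]] := connect_upath xA c; apply: pA; apply: mem_last. Qed.

Lemma connP e A : reflect {in A &, forall x y, connect (ein e A) x y} (conn e A).
Proof.
apply: (iffP forall_inP) => [h x y xA yA|h x xA]; first exact: (forall_inP (h x xA)).
by apply/forall_inP => y yA; apply: h.
Qed.

Lemma lp_conn e A x y : conn e A -> x \in A -> y \in A -> lp e A x y 1.
Proof.
by move=> /connP cA xA yA; have [p] := connect_upath xA (cA _ _ xA yA); exists p.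
Qed.

Lemma lpW e A B x y m n : A \subset B -> n <= m -> lp e A x y m -> lp e B x y n.
Proof.
move=> /subsetP sAB nm [p /and4P[pp up pA lpy] mp]; exists p; last exact: leq_trans mp.
by rewrite /upath pp up lpy andbT /=; apply: sub_all pA => z; apply: sAB.
Qed.

Lemma lp_in e A x y n : lp e A x y n -> x \in A /\ y \in A.
Proof.
case=> p /and4P[_ _ /allP pA /eqP<-] _; split; apply: pA; first exact: mem_head.
exact: mem_last.
Qed.

Lemma upath_rev e A x p y : symmetric e -> upath e A x p y ->
  upath e A y (rev (belast x p)) x.
Proof.
move=> es /and4P[pp up pA /eqP<-].
have E : last x p :: rev (belast x p) = rev (x :: p) by rewrite [x :: p]lastI rev_rcons.
rewrite /upath E rev_uniq up all_rev pA rev_path.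
have -> : path (fun z => e^~ z) x p by rewrite (eq_path (e' := e)) // => a b; rewrite es.
by case: p {pp up pA E} => [|z p] /=; rewrite ?rev_cons ?last_rcons eqxx.
Qed.

Lemma lp_sym e A x y n : symmetric e -> lp e A x y n -> lp e A y x n.
Proof.
move=> es [p up np]; exists (rev (belast x p)); first exact: upath_rev.
by rewrite size_rev size_belast.
Qed.

Lemma lp_cat e A B x y y' z m n : lp e A x y m -> lp e B y' z n -> e y y' ->
  [disjoint A & B] -> lp e (A :|: B) x z (m + n).
Proof.
move=> [p /and4P[pp up pA /eqP lpy] mp] [q /and4P[pq uq qB /eqP lqz] nq] eyy dAB.
exists (p ++ y' :: q); last by rewrite size_cat /=; lia.
apply/and4P; split.
- by rewrite cat_path pp lpy /= eyy.
- rewrite -cat_cons cat_uniq up uq andbT.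
  apply/hasPn => w /(allP qB) wB; apply/negP => /(allP pA) wA.
  by move: dAB; rewrite disjoints_subset => /subsetP/(_ _ wA); rewrite inE wB.
- rewrite -cat_cons all_cat; apply/andP; split; apply/allP => w wp; rewrite inE.
    by rewrite (allP pA).
  by rewrite (allP qB) // orbT.
- by rewrite last_cat /= lqz.
Qed.

Lemma lp_join e A B x y z m n : lp e A x y m -> lp e B y z n ->
  A :&: B \subset [set y] -> 0 < m -> lp e (A :|: B) x z (m + n).-1.
Proof.
move=> [p /and4P[pp up pA /eqP lpy] mp] [q /and4P[pq uq qB /eqP lqz] nq] sAB m0.
exists (p ++ q); last by rewrite size_cat /=; lia.
move: (uq) => /= /andP[yq uq'].
apply/and4P; split.
- by rewrite cat_path pp lpy.
- rewrite -cat_cons cat_uniq up uq' andbT.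
  apply/hasPn => w wq; apply/negP => /(allP pA) wA.
  have wB : w \in B by apply: (allP qB); rewrite inE wq orbT.
  have : w \in [set y] by apply: (subsetP sAB); rewrite inE; apply/andP.
  by rewrite inE => /eqP wy; rewrite -wy wq in yq.
- rewrite -cat_cons all_cat; apply/andP; split; apply/allP => w wp; rewrite inE.
    by rewrite (allP pA).
  by rewrite (allP qB) ?orbT // inE wp orbT.
- by rewrite last_cat lpy lqz.
Qed.

Lemma lp1 e A x : x \in A -> lp e A x x 1.
Proof. by move=> xA; exists [::]; rewrite // /upath /= xA eqxx. Qed.

End Connectivity.
Arguments ein {T} e A x y /.

(** * Separators, linkages and Menger's theorem for directed relations *)

Section Menger.
Variable T : finType.
Implicit Types (e : rel T) (A B X Y S Z : {set T}) (x y z : T) (p q : seq T).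

Definition separates e X Y S :=
  [forall x in X, forall y in Y, ~~ [&& x \notin S, y \notin S & connect (ein e (~: S)) x y]].

Lemma separatesP e X Y S :
  reflect (forall x p, x \in X -> path e x p -> last x p \in Y -> has [in S] (x :: p))
          (separates e X Y S).
Proof.
apply: (iffP forall_inP) => [h x p xX pp lY|h x xX].
  move: (forall_inP (h x xX) _ lY); apply: contraNT => np.
  have pS : all [in ~: S] (x :: p).
    by rewrite -all_predC in np; apply: sub_all np => z /=; rewrite inE.
  rewrite path_ein_connect // andbT; apply/andP; split.
    by move: pS => /= /andP[]; rewrite inE.
  by have := allP pS _ (mem_last x p); rewrite inE.
apply/forall_inP => y yY; apply/negP => /and3P[xS yS c].
have [|p /and4P[pp _ pA /eqP lpy]] := connect_upath _ c; first by rewrite inE.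
have /hasP[z zp zS] : has [in S] (x :: p) by apply: h; rewrite ?lpy.
by have := allP pA _ zp; rewrite inE zS.
Qed.

Definition lnk e X Y p :=
  if p is x :: q then [&& x \in X, last x q \in Y, path e x q & uniq p] else false.

(* I only labels the paths: g i need not contain i. *)
Definition linkage e X Y k := exists (I : {set T}) (g : T -> seq T),
  [/\ #|I| = k, {in I, forall i, lnk e X Y (g i)} &
      {in I &, forall i j, i != j -> [disjoint g i & g j]}].

Lemma lnkWe e e' X Y p : subrel e e' -> lnk e X Y p -> lnk e' X Y p.
Proof.
by case: p => // x q se /and4P[xX lY pq uq]; rewrite /= xX lY (sub_path se) //=.
Qed.

Lemma disjointP (s t : seq T) : reflect (forall z, z \in s -> z \in t -> False) [disjoint s & t].
Proof.
apply: (iffP pred0P) => [h z zs zt|h z]; first by move: (h z); rewrite /= zs zt.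
by apply/negbTE/negP => /andP[zs zt]; apply: (h z).
Qed.

(** Disjoint paths choose distinct points, so by counting every point of [Z] is chosen and [r]
    inverts the choice. This allows a linkage to be indexed by its starts or its ends. *)
Lemma linkage_onto (I Z : {set T}) (g : T -> seq T) (l : T -> T) :
  #|I| = #|Z| -> {in I, forall i, l i \in Z} -> {in I, forall i, l i \in g i} ->
  {in I &, forall i j, i != j -> [disjoint g i & g j]} ->
  exists r : T -> T, {in Z, forall z, r z \in I /\ l (r z) = z}.
Proof.
move=> cI lZ lg dI.
have li : {in I &, injective l}.
  move=> i j iI jI lij; apply/eqP; apply/negPn/negP => nij.
  by move/disjointP: (dI i j iI jI nij) => /(_ (l i)); rewrite lg // {1}lij lg //; apply.
have lIZ : l @: I = Z.
  apply/eqP; rewrite eqEcard card_in_imset // cI leqnn andbT.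
  by apply/subsetP => _ /imsetP[i iI ->]; apply: lZ.
exists (fun z => odflt z [pick i in I | l i == z]) => z.
rewrite -lIZ => /imsetP[i iI ->]; case: pickP => [j /andP[jI /eqP]|] //=.
by move=> /(_ i); rewrite iI eqxx.
Qed.

Lemma linkage_ends e X Z k : #|Z| = k -> linkage e X Z k ->
  exists g : T -> seq T, {in Z, forall z, lnk e X [set z] (g z)} /\
      {in Z &, forall i j, i != j -> [disjoint g i & g j]}.
Proof.
move=> cZ [I [g [cI gI dI]]].
have [|i iI|i iI|//|r rP] := @linkage_onto I Z g (fun i => last i (g i)); first by rewrite cI.
- by have := gI i iI; case: (g i) => // x q /and4P[].
- by have := gI i iI; case: (g i) => // x q _; rewrite /= mem_last.
exists (g \o r); split => [z zZ|y z yZ zZ nyz] /=.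
  have [rI] := rP z zZ; have := gI _ rI; case: (g (r z)) => // x q /=.
  by move=> /and4P[-> _ -> ->] ->; rewrite inE eqxx.
have [rI ly] := rP y yZ; have [rJ lz] := rP z zZ.
by apply: dI => //; apply: contra nyz => /eqP E; rewrite -ly -lz E.
Qed.

Lemma linkage_starts e Z Y k : #|Z| = k -> linkage e Z Y k ->
  exists g : T -> seq T, {in Z, forall z, lnk e [set z] Y (g z)} /\
      {in Z &, forall i j, i != j -> [disjoint g i & g j]}.
Proof.
move=> cZ [I [g [cI gI dI]]].
have [|i iI|i iI|//|r rP] := @linkage_onto I Z g (fun i => head i (g i)); first by rewrite cI.
- by have := gI i iI; case: (g i) => // x q /and4P[].
- by have := gI i iI; case: (g i) => // x q _; apply: mem_head.
exists (g \o r); split => [z zZ|y z yZ zZ nyz] /=.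
  have [rI] := rP z zZ; have := gI _ rI; case: (g (r z)) => // x q /=.
  by move=> /and4P[_ -> -> ->] ->; rewrite inE eqxx.
have [rI ly] := rP y yZ; have [rJ lz] := rP z zZ.
by apply: dI => //; apply: contra nyz => /eqP E; rewrite -ly -lz E.
Qed.

(* Goering's induction: delete one edge ab, and glue linkages at S + a and at S + b,
   where S separates X from Y once ab is deleted. *)
Theorem menger e X Y k : (forall S, separates e X Y S -> k <= #|S|) -> linkage e X Y k.
Proof.
have [n] := ubnP #|[set q : T * T | e q.1 q.2]|.
elim: n e X Y => // n IH e X Y; rewrite ltnS => le_n hk.
have [/eqP e0|] := boolP ([set q : T * T | e q.1 q.2] == set0).
  have /hk/card_geqP[s [us ss sXY]] : separates e X Y (X :&: Y).
    apply/separatesP => x [|z p] xX /=; first by rewrite inE xX => _ ->.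
    by case/andP=> exz; move/setP/(_ (x, z)): e0; rewrite !inE /= exz.
  exists [set x in s], (fun x => [:: x]); split=> [|i|i j].
  - by rewrite cardsE (card_uniqP us).
  - by rewrite inE => /sXY; rewrite inE /= => /andP[-> ->].
  - by move=> _ _ nij; apply/disjointP => z; rewrite !inE => /eqP-> /eqP ij; rewrite ij eqxx in nij.
case/set0Pn=> -[a b]; rewrite inE /= => eab.
pose e' : rel T := fun x y => e x y && ((x, y) != (a, b)).
have e'E x y : e' x y = e x y && ((x, y) != (a, b)) by [].
have se : subrel e' e by move=> x y /andP[].
have le' : #|[set q : T * T | e' q.1 q.2]| < n.
  apply: leq_trans le_n; apply: proper_card; apply/properP; split.
    by apply/subsetP => q; rewrite !inE => /se.
  by exists (a, b); rewrite inE ?eab //= e'E eqxx andbF.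
have IH' X' Y' : (forall S, separates e' X' Y' S -> k <= #|S|) -> linkage e' X' Y' k by apply: IH.
have [/forallP h|] := boolP [forall S, separates e' X Y S ==> (k <= #|S|)].
  have [|I [g [cI gI dI]]] := IH' X Y; first by move=> S; apply/implyP.
  by exists I, g; split=> // i /gI; apply: lnkWe.
case/forallPn=> S; rewrite negb_imply -ltnNge => /andP[sS cS].
(* Only the arc from [a] to [b] is deleted, as [e] need not be symmetric: a path that never leaves
   [a], or never enters [b], survives in [e']. *)
have noa x p : path e x p -> a \notin belast x p -> path e' x p.
  elim: p x => //= z p IHp x /andP[exz pp]; rewrite inE negb_or => /andP[xa ap].
  by rewrite IHp // e'E exz xpair_eqE eq_sym (negbTE xa).
have nob x p : path e x p -> b \notin p -> path e' x p.
  elim: p x => //= z p IHp x /andP[exz pp]; rewrite inE negb_or => /andP[xa ap].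
  by rewrite IHp // e'E exz xpair_eqE [z == _]eq_sym (negbTE xa) andbF.
have useab x p : x \in X -> path e x p -> last x p \in Y -> ~~ has [in S] (x :: p) ->
    (a \in x :: p) && (b \in x :: p).
  move=> xX pp lY nS; apply/andP; split; apply: contraNT nS => nab.
    move/separatesP: sS; apply=> //; apply: noa => //.
    by apply: contra nab; apply: mem_belast.
  move/separatesP: sS; apply=> //; apply: nob => //.
  by apply: contra nab; rewrite inE orbC => ->.
have sep1 c : c = a \/ c = b -> separates e X Y (c |: S).
  move=> cab; apply/separatesP => x p xX pp lY.
  have [h|h] := boolP (has [in S] (x :: p)).
    by apply: sub_has h => z /=; rewrite !inE => ->; rewrite orbT.
  have /andP[ha hb] := useab x p xX pp lY h.
  by apply/hasP; exists c; [case: cab => -> | rewrite !inE eqxx].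
(* Since |S| < k while [S] with either end added separates in [e], the enlarged sets have exactly
   [k] points. *)
have cS1 c : c = a \/ c = b -> #|c |: S| = k /\ c \notin S.
  by move=> cab; have := hk _ (sep1 c cab); rewrite cardsU1; case: (c \in S) => /=; lia.
have [[cSa aS] [cSb bS]] := (cS1 a (or_introl erefl), cS1 b (or_intror erefl)).
have prefix x p : path e x p -> has [in a |: S] (x :: p) ->
    exists p1 p2, [/\ p = p1 ++ p2, path e' x p1 & last x p1 \in a |: S].
  elim: p x => [|z p IHp] x /=; first by rewrite orbF => _ xS; exists [::], [::].
  case/andP=> exz pp; have [xS _|xS] /= := boolP (x \in a |: S); first by exists [::], (z :: p).
  move=> hc; have [p1 [p2 [-> p1e l1]]] := IHp z pp hc.
  exists (z :: p1), p2; split=> //=; rewrite p1e andbT e'E exz xpair_eqE.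
  by apply: contra xS => /andP[/eqP-> _]; rewrite !inE eqxx.
have suffix x p : path e x p -> has [in b |: S] (x :: p) ->
    exists p1 p2, [/\ p = p1 ++ p2, path e' (last x p1) p2 & last x p1 \in b |: S].
  elim: p x => [|z p IHp] x; first by rewrite /= orbF => _ xS; exists [::], [::].
  move=> pzp; have [hc _|hc] := boolP (has [in b |: S] (z :: p)).
    move: pzp => /= /andP[_ pp]; have [p1 [p2 [-> p1e l1]]] := IHp z pp hc.
    by exists (z :: p1), p2; split.
  rewrite -[x :: _]cat1s has_cat (negbTE hc) orbF has_seq1 => xS; exists [::], (z :: p); split=> //.
  apply: nob => //; apply: contra hc => bz; apply/hasP; exists b => //=.
  by rewrite !inE eqxx.
(* Every path of [e] from [X] to [Y] has a prefix in [e'] that reaches [a |: S], so a separator for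
   this smaller problem separates [X] from [Y] in [e]. *)
have [||P [PX dP]] := @linkage_ends e' X (a |: S) k; first by [].
  apply: IH' => Z /separatesP sZ; apply: hk; apply/separatesP => x p xX pp lY.
  have hc : has [in a |: S] (x :: p) by move/separatesP: (sep1 a (or_introl erefl)); apply.
  have [p1 [p2 [-> p1e l1]]] := prefix x p pp hc.
  by rewrite -cat_cons has_cat sZ.
have [||Q [QY dQ]] := @linkage_starts e' (b |: S) Y k; first by [].
  apply: IH' => Z /separatesP sZ; apply: hk; apply/separatesP => x p xX pp lY.
  have hc : has [in b |: S] (x :: p) by move/separatesP: (sep1 b (or_intror erefl)); apply.
  have [p1 [p2 [E p2e l1]]] := suffix x p pp hc.
  have /hasP[w wp wZ] : has [in Z] (last x p1 :: p2).
    by apply: sZ => //; rewrite E last_cat in lY.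
  apply/hasP; exists w => //; rewrite E -cat_cons mem_cat.
  by move: wp; rewrite inE => /orP[/eqP->|->]; rewrite ?mem_last ?orbT.
have Pend s : s \in a |: S -> exists x p, [/\ P s = x :: p, x \in X, last x p = s, path e' x p & uniq (x :: p)].
  move=> /PX; case: (P s) => // x p /and4P[xX]; rewrite inE => /eqP ls pp up.
  by exists x, p.
have Qend s : s \in b |: S -> exists q, [/\ Q s = s :: q, last s q \in Y, path e' s q & uniq (s :: q)].
  move=> /QY; case: (Q s) => // x q /and4P[]; rewrite inE => /eqP-> lY pq uq.
  by exists q.
have Pself s : s \in a |: S -> s \in P s.
  by case/Pend=> x [p [-> _ <- _ _]]; apply: mem_last.
have Qself s : s \in b |: S -> s \in Q s.
  by case/Qend=> q [-> _ _ _]; apply: mem_head.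
have Ponly s w : s \in a |: S -> w \in a |: S -> w \in P s -> w = s.
  move=> sa wa wP; apply/eqP/negPn/negP => nws.
  by move/disjointP: (dP w s wa sa nws) => /(_ w); apply; rewrite ?Pself.
have Qonly s w : s \in b |: S -> w \in b |: S -> w \in Q s -> w = s.
  move=> sa wa wP; apply/eqP/negPn/negP => nws.
  by move/disjointP: (dQ w s wa sa nws) => /(_ w); apply; rewrite ?Qself.
have inS c s : s \in S -> s \in c |: S by move=> sS'; rewrite inE sS' orbT.
(* At a meeting point [z], the start of [P s] and the rest of [Q t] form a walk of [e'] from [X] to
   [Y]. It must hit [S], which both families meet only in their ends. *)
have PQ s t z : s \in a |: S -> t \in b |: S -> z \in P s -> z \in Q t ->
    [/\ z \in S, z = s & z = t].
  move=> sa tb zP zQ.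
  have [x [p [EP xX lps pp up]]] := Pend s sa; have [q [EQ lqY pq uq]] := Qend t tb.
  move: (zP); rewrite EP => zp.
  move: (zQ); rewrite EQ => zq.
  case/splitPl: zp EP lps pp up => p1 p2 lp1 EP lps pp up.
  case/splitPl: zq EQ lqY pq uq => q1 q2 lq1 EQ lqY pq uq.
  have [p1e q2e] : path e' x p1 /\ path e' z q2.
    by move: pp pq; rewrite !cat_path lq1 => /andP[-> _] /andP[_ ->].
  have /hasP[w wpq wS] : has [in S] (x :: p1 ++ q2).
    move/separatesP: sS; apply => //; first by rewrite cat_path p1e lp1.
    by move: lqY; rewrite !last_cat lp1 lq1.
  move: wpq; rewrite -cat_cons mem_cat => /orP[wp1|wq2].
    have ws : w = s by apply: Ponly => //; rewrite ?inS // EP -cat_cons mem_cat wp1.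
    have zs : z = s.
      case: p2 EP lps pp up => [|c p2] EP lps pp up; first by rewrite -lp1 -lps cats0.
      exfalso; move: up; rewrite -cat_cons cat_uniq => /and3P[_ /hasPn/(_ s)]; rewrite -ws wp1 ws.
      by rewrite -lps last_cat /= mem_last => /(_ isT).
    have zS : z \in S by rewrite zs -ws.
    by split=> //; exact: Qonly tb (inS b z zS) zQ.
  have wt : w = t by apply: Qonly => //; rewrite ?inS // EQ -cat_cons mem_cat wq2 orbT.
  by exfalso; move: uq; rewrite /= -wt mem_cat wq2 orbT.
have memG s z : s \in a |: S -> z \in (if s == a then P a ++ Q b else P s ++ behead (Q s)) ->
   z \in P s \/ exists t, [/\ t \in b |: S, z \in Q t & (s = a /\ t = b) \/ (s != a /\ t = s)].
  case: eqVneq => [->|sa] sS'; rewrite mem_cat => /orP[|zQ]; try by left.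
    by right; exists b; split=> //; [rewrite !inE eqxx|left].
  right; exists s; split; [|by apply: mem_behead|by right].
  by move: sS'; rewrite !inE (negbTE sa) => /= ->; rewrite orbT.
(* [P a] and [Q b] are joined by the deleted arc; for [s] in [S] the two paths share [s], hence
   [behead]. *)
exists (a |: S), (fun s => if s == a then P a ++ Q b else P s ++ behead (Q s)); split=> // [s|s t].
  rewrite !inE; case: eqVneq => [_ _|sa /= sS'].
    have [|x [p [EP xX lps pp up]]] := Pend a; first by rewrite !inE eqxx.
    have [|q [EQ lqY pq uq]] := Qend b; first by rewrite !inE eqxx.
    rewrite EP EQ cat_cons; apply/and4P; split=> //; rewrite ?last_cat //.
      by rewrite cat_path lps /= eab !(sub_path se).
    rewrite -cat_cons cat_uniq up uq andbT.
    apply/hasPn => z zq; apply/negP => zp.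
    have [||||zS za _] := PQ a b z; rewrite ?EP ?EQ // ?inE ?eqxx //.
    by rewrite za (negbTE aS) in zS.
  have [|x [p [EP xX lps pp up]]] := Pend s; first by rewrite inS.
  have [|q [EQ lqY pq uq]] := Qend s; first by rewrite inS.
  rewrite EP EQ cat_cons; apply/and4P; split=> //; rewrite ?last_cat ?lps //.
    by rewrite cat_path lps !(sub_path se).
  move: (uq) => /= /andP[sq uq']; rewrite -/(uniq (x :: p ++ q)) -cat_cons cat_uniq up uq' andbT.
  apply/hasPn => z zq; apply/negP => zp.
  have [||||zS zs _] := PQ s s z; rewrite ?EP ?EQ ?inS // ?inE ?zq ?orbT //.
  by rewrite -zs zq in sq.
move=> sS' tS' nst; apply/disjointP => z zs zt.
have mixed s1 t1 : s1 != t1 -> s1 \in a |: S -> t1 \in a |: S -> z \in P s1 ->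
    (exists t, [/\ t \in b |: S, z \in Q t & (t1 = a /\ t = b) \/ (t1 != a /\ t = t1)]) -> False.
  move=> n1 s1S t1S zP [t2 [tb zQ ht]].
  have [zS z1 z2] := PQ s1 t2 z s1S tb zP zQ.
  case: ht => [[_ tb']|[_ tt]]; first by move: zS; rewrite z2 tb' (negbTE bS).
  by move: n1; rewrite -z1 z2 tt eqxx.
case: (memG s z sS' zs) => [zP|zQ]; case: (memG t z tS' zt) => [zP'|zQ'].
- by move/disjointP: (dP s t sS' tS' nst) => /(_ z zP zP').
- exact: (mixed s t).
- by apply: (mixed t s) => //; rewrite eq_sym.
- case: zQ zQ' => t1 [t1b zQ1 h1] [t2 [t2b zQ2 h2]].
  have n12 : t1 != t2.
    apply: contra nst => /eqP E; subst t2.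
    have nb c : c \in a |: S -> c != a -> t1 = b -> t1 = c -> False.
      rewrite !inE => /orP[/eqP->|cS' _ -> E]; first by rewrite eqxx.
      by rewrite -E (negbTE bS) in cS'.
    case: h1 => [[sa tb1]|[sa ts]]; case: h2 => [[ta tb2]|[ta tt]].
    - by rewrite sa ta.
    - by case: (nb t).
    - by case: (nb s).
    - by rewrite -ts -tt.
  by move/disjointP: (dQ t1 t2 t1b t2b n12) => /(_ z zQ1 zQ2).
Qed.

End Menger.

(** * Rooted paths in graphs of large degree *)

Section Lobes.
Variables (T : finType) (e : rel T).
Hypotheses (es : symmetric e) (ei : irreflexive e).
Implicit Types (A B F J K M : {set T}) (u v w x y z : T) (p q : seq T).

Definition component A x := [set y in A | connect (ein e A) x y].

Lemma compS A x : component A x \subset A.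
Proof. by apply/subsetP => y; rewrite inE => /andP[]. Qed.

Lemma comp_refl A x : x \in A -> x \in component A x.
Proof. by move=> xA; rewrite inE xA connect0. Qed.

Lemma comp_closed A x y z : y \in component A x -> z \in A -> e y z -> z \in component A x.
Proof.
rewrite !inE => /andP[yA c] zA eyz; rewrite zA; apply: connect_trans c _.
by apply: connect1; rewrite /= yA zA eyz.
Qed.

Lemma comp_conn A x : x \in A -> conn e (component A x).
Proof.
move=> xA.
have h y : y \in component A x -> connect (ein e (component A x)) x y.
  rewrite inE => /andP[yA c]; have [p /and4P[pp _ pA /eqP<-]] := connect_upath xA c.
  apply: path_ein_connect => //; apply/allP => z zp.
  case/splitPl: zp pp pA => p1 p2 lz; rewrite cat_path -cat_cons all_cat => /andP[p1e _] /andP[p1A _].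
  rewrite inE -lz path_ein_connect // andbT.
  by apply: (allP p1A); rewrite mem_last.
apply/connP => y z yC zC; apply: connect_trans (h z zC).
by rewrite connect_ein_sym //; apply: h.
Qed.

Lemma conn1U J v w : conn e J -> w \in J -> e v w -> conn e (v |: J).
Proof.
move=> cJ wJ evw.
have h z : z \in v |: J -> connect (ein e (v |: J)) z w.
  rewrite !inE => /orP[/eqP->|zJ]; first by apply: connect1; rewrite /= !inE eqxx wJ evw orbT.
  by apply: (@connect_einW _ _ J); [apply: subsetUr | apply: (connP _ _ cJ)].
apply/connP => x y xV yV; apply: connect_trans (h x xV) _.
by rewrite connect_ein_sym //; apply: h.
Qed.

Lemma connU A B z : conn e A -> conn e B -> z \in A -> z \in B -> conn e (A :|: B).
Proof.
move=> cA cB zA zB.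
have h y : y \in A :|: B -> connect (ein e (A :|: B)) z y.
  rewrite inE => /orP[yA|yB].
    by apply: (@connect_einW _ _ A); [apply: subsetUl | apply: (connP _ _ cA)].
  by apply: (@connect_einW _ _ B); [apply: subsetUr | apply: (connP _ _ cB)].
apply/connP => x y xV yV; apply: connect_trans (h y yV).
by rewrite connect_ein_sym //; apply: h.
Qed.

Lemma lp2 A x y : conn e A -> x \in A -> y \in A -> x != y -> lp e A x y 2.
Proof.
move=> cA xA yA nxy; have [p up _] := lp_conn cA xA yA; exists p => //.
by case: p up => // /and4P[_ _ _ /=]; rewrite (negbTE nxy).
Qed.

(** A nonempty lobe is a component of the graph on [F] with [v] deleted. *)
Definition lobe F v J :=
  [&& J \subset F :\ v, conn e J & [forall a in J, forall b in F, e a b ==> (b \in v |: J)]].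

Lemma lobeP F v J : reflect [/\ J \subset F :\ v, conn e J &
    forall a b, a \in J -> b \in F -> e a b -> b \in v |: J] (lobe F v J).
Proof.
apply: (iffP and3P) => -[sJ cJ h]; split=> //.
  move=> a b aJ bF eab; by move: (forall_inP (forall_inP h a aJ) b bF) => /implyP; apply.
by apply/forall_inP => a aJ; apply/forall_inP => b bF; apply/implyP; apply: h.
Qed.

Lemma lobe_comp F v x : x \in F :\ v -> lobe F v (component (F :\ v) x).
Proof.
move=> xF; apply/lobeP; split; [exact: compS|exact: comp_conn|move=> a b aJ bF eab].
rewrite in_setU1; case: eqVneq => //= nbv.
by apply: comp_closed eab => //; rewrite !inE nbv.
Qed.

Lemma lobe_stay F v J z p : lobe F v J -> z \in J -> path e z p -> v \notin p ->
  all [in F] p -> all [in J] p.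
Proof.
move/lobeP=> [_ _ cl]; elim: p z => //= w p IH z zJ /andP[ezw pp].
rewrite inE negb_or => /andP[nvw vp] /andP[wF pF].
have wJ : w \in J by have := cl z w zJ wF ezw; rewrite !inE eq_sym (negbTE nvw).
by rewrite wJ (IH w).
Qed.

Lemma lobe_exit F v J z : conn e F -> v \in F -> lobe F v J -> z \in J ->
  exists2 w, w \in J & e v w.
Proof.
move=> /connP cF vF lJ zJ; have /lobeP[sJ _ _] := lJ.
have zF : z \in F :\ v by apply: (subsetP sJ).
have [||p /and4P[pp up pF /eqP lv]] := @connect_upath _ e F z v; rewrite ?cF //; try by case/setD1P: zF.
case/lastP: p pp up pF lv => [|p w] pp up pF lv.
  by move: zF; rewrite -lv /= !inE eqxx.
rewrite last_rcons in lv; subst w.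
move: pp; rewrite rcons_path => /andP[pp elv].
have vp : v \notin p by move: up; rewrite /= rcons_uniq => /and3P[].
have pF' : all [in F] p by move: pF; rewrite /= all_rcons => /and3P[].
have pJ := lobe_stay lJ zJ pp vp pF'.
exists (last z p); last by rewrite es.
by have := mem_last z p; rewrite inE => /orP[/eqP->//|/(allP pJ)].
Qed.

(** A simple path from [v] that enters [J] could leave it only through [v], which is already used;
    so no simple path from [v] to [y] enters [J]. *)
Lemma lobe_out F v J y : conn e F -> v \in F -> y \in F -> lobe F v J -> y \notin J ->
  lp e (F :\: J) v y 1.
Proof.
move=> /connP cF vF yF lJ yJ; have [p /and4P[pp up pF /eqP ly]] := connect_upath vF (cF v y vF yF).
exists p => //; rewrite /upath pp up ly eqxx andbT /=; apply/andP; split.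
  have /lobeP[/subsetP sJ _ _] := lJ.
  by rewrite inE vF andbT; apply/negP => /sJ; rewrite !inE eqxx.
apply/allP => z zp; rewrite inE; have -> /= : z \in F by apply: (allP pF); rewrite inE zp orbT.
rewrite andbT; apply/negP => zJ.
case/splitPr: zp pp up pF ly => p1 p2; rewrite cat_path /= last_cat /=.
move=> /and3P[_ _ p2e] /andP[vp _] /andP[_]; rewrite all_cat /= => /and3P[_ _ p2F] ly.
have p2J : all [in J] p2.
  by apply: (lobe_stay lJ zJ p2e _ p2F); apply: contra vp; rewrite mem_cat inE => ->; rewrite !orbT.
by move: yJ; rewrite -ly; have := mem_last z p2; rewrite inE => /orP[/eqP->|/(allP p2J)->]; rewrite ?zJ.
Qed.

(* The Erdos-Gallai argument: walk from a mark into a minimal lobe, delete the current vertex, and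
   continue towards the cut vertex of the lobe. Vertices outside K only serve as connectors. *)
Theorem rooted_path K d F M y : y \in F -> conn e F -> (exists2 k, k \in F :&: K & k != y) ->
  (forall v, v \in F :&: K -> v != y -> d <= #|[set w in y |: (F :&: K) | e v w]|) ->
  (forall v J, v \in F -> lobe F v J -> y \notin J -> J :&: K != set0 -> J :&: M != set0) ->
  exists2 m, m \in M & lp e F m y d.+1.
Proof.
have [n] := ubnP #|F|; elim: n F M y d => // n IH F M y d; rewrite ltnS => Fn yF cF [k0 k0K k0y] deg mark.
pose P (q : T * {set T}) := [&& q.1 \in F, lobe F q.1 q.2, y \notin q.2 & q.2 :&: K != set0].
have P0 : P (y, component (F :\ y) k0).
  have k0F : k0 \in F :\ y by move: k0K; rewrite !inE k0y => /andP[->].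
  rewrite /P /= yF lobe_comp //=; apply/andP; split.
    by apply/negP => /(subsetP (compS _ _)); rewrite !inE eqxx.
  by apply/set0Pn; exists k0; rewrite inE comp_refl //=; case/setIP: k0K.
case: (arg_minnP (fun r : T * {set T} => #|r.2|) P0) => -[v J] /= /and4P[/= vF lJ yJ JK] minJ.
have min u J' : u \in F -> lobe F u J' -> y \notin J' -> J' :&: K != set0 -> #|J| <= #|J'|.
  by move=> uF l1 y1 k1; apply: (minJ (u, J')); rewrite /P /= uF l1 y1.
have /set0Pn[m /setIP[mJ mM]] := mark v J vF lJ yJ JK.
have /lobeP[sJ cJ clJ] := lJ; have sJF : J \subset F := subset_trans sJ (subD1set _ _).
have vJ : v \notin J by apply/negP => /(subsetP sJ); rewrite !inE eqxx.
have mv : m != v by apply: contraNneq vJ => <-.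
have [j jJ evj] := lobe_exit cF vF lJ mJ.
have cF1 : conn e (v |: J) := conn1U cJ jJ evj.
exists m => //.
(* The continuation from [v] to [y] runs outside [J], so the part up to [v] has to supply the whole
   length. *)
suff: lp e (v |: J) m v d.+1.
  move=> h; have h2 := lobe_out cF vF yF lJ yJ.
  have hI : (v |: J) :&: (F :\: J) \subset [set v].
    by apply/subsetP => z; rewrite !inE; case: eqP => //= _ /and3P[zJ]; rewrite zJ.
  have h3 := lp_join h h2 hI isT; apply: lpW h3; last by rewrite addn1.
  by rewrite subUset subsetDl subUset sJF sub1set vF.
(* If [m] is the only vertex of [K] in [J], its counted neighbours reduce to [v], so [d <= 1] and
   any path from [m] to [v] is long enough. *)
have [k2 /andP[k2JK k2m]|none] := pickP [pred k | (k \in J :&: K) && (k != m)]; last first.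
  have mK : m \in K.
    case/set0Pn: JK => k kJK; have := none k; rewrite /= kJK /=.
    by case: eqP => // <- _; case/setIP: kJK.
  have d1 : d <= 1.
    have mF : m \in F :&: K by rewrite inE mK (subsetP sJF).
    have my : m != y by apply: contraNneq yJ => <-.
    apply: leq_trans (deg m mF my) _; rewrite -(cards1 v); apply: subset_leq_card.
    apply/subsetP => w; rewrite !inE => /andP[wyK emw].
    have wF : w \in F by case/orP: wyK => [/eqP->|/andP[]].
    have := clJ m w mJ wF emw; rewrite !inE => /orP[//|wJ].
    case/orP: wyK => [/eqP wy|/andP[_ wK]]; first by rewrite -wy wJ in yJ.
    have := none w; rewrite /= inE wJ wK /=; case: eqP => // wm _.
    by rewrite wm ei in emw.
  apply: (@lpW _ _ (v |: J) _ _ _ 2) => //.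
  by apply: lp2 => //; rewrite !inE ?eqxx ?mJ ?orbT.
have [k2J k2K] := setIP k2JK.
have k2v : k2 != v by apply: contraNneq vJ => <-.
(* The induction deletes [m] and keeps the component of the new root [v]. Neighbours of [m] become
   the marks, and every vertex loses at most the neighbour [m], hence [d.-1]. *)
pose A := (v |: J) :\ m; pose F2 := component A v.
have vA : v \in A by rewrite !inE eq_sym mv eqxx.
have sF2 : F2 \subset A := compS _ _.
have F2J u : u \in F2 -> u != v -> (u \in J) && (u != m).
  by move=> /(subsetP sF2); rewrite !inE => /andP[->] /orP[->|->].
have clF2 u w : u \in F2 -> u != v -> w \in F -> e u w -> w != m -> w \in F2.
  move=> uF2 uv wF euw wm; have /andP[uJ um] := F2J u uF2 uv.
  apply: (comp_closed uF2 _ euw); rewrite /A in_setD1 wm; exact: clJ uJ wF euw.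
have small u J' : J' \subset J :\ m -> u \in F -> lobe F u J' -> J' :&: K != set0 -> False.
  move=> sJ' uF lJ' J'K; have : #|J| <= #|J'|.
    apply: min lJ' _ J'K => //; apply: contra yJ => /(subsetP sJ'); by rewrite !inE => /andP[].
  by rewrite (cardsD1 m J) mJ add1n ltnNge (subset_leq_card sJ').
have k2A : k2 \in A by rewrite !inE k2m k2J orbT.
have k2F2 : k2 \in F2.
  apply/negPn/negP => nk2; have vC : v \notin component A k2.
    by apply: contra nk2; rewrite /F2 ![_ \in component _ _]inE k2A vA connect_ein_sym.
  apply: (small m (component A k2)).
  - apply/subsetP => z zC; have := subsetP (compS _ _) z zC; rewrite !inE => /andP[-> /orP[/eqP zv|//]].
    by rewrite zv (negbTE vC) in zC.
  - exact: subsetP mJ.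
  - have sC : component A k2 \subset J :\ m.
      apply/subsetP => z zC; have := subsetP (compS _ _) z zC; rewrite !inE => /andP[-> /orP[/eqP zv|//]].
      by rewrite zv (negbTE vC) in zC.
    apply/lobeP; split; first exact: subset_trans sC (setSD _ sJF).
      exact: comp_conn.
    move=> a b aC bF eab; rewrite in_setU1; case: eqVneq => //= bm.
    apply: (comp_closed aC _ eab); rewrite /A in_setD1 bm /=; apply: (clJ a) => //.
    by have := subsetP sC a aC; rewrite !inE => /andP[].
  - by apply/set0Pn; exists k2; rewrite in_setI k2K comp_refl.
have [||||||w wm lw] := IH F2 [set w | e m w] v d.-1.
- apply: leq_trans Fn; apply: proper_card; apply/properP; split; last first.
    by exists m; [apply: (subsetP sJF) | apply/negP => /(subsetP sF2); rewrite !inE eqxx].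
  by apply: subset_trans sF2 _; apply: subset_trans (subD1set _ _) _; rewrite subUset sub1set vF.
- exact: comp_refl.
- exact: comp_conn.
- by exists k2; rewrite // inE k2F2.
- move=> u /setIP[uF2 uK] uv; have /andP[uJ um] := F2J u uF2 uv.
  have uy : u != y by apply: contraNneq yJ => <-.
  have := deg u; rewrite inE (subsetP sJF) // uK => /(_ isT uy) => degu.
  suff: d <= #|m |: [set w in v |: (F2 :&: K) | e u w]| by rewrite cardsU1; case: (_ \notin _); clear; lia.
  apply: leq_trans degu _; apply: subset_leq_card; apply/subsetP => w; rewrite inE.
  rewrite in_setU1 in_setI => /andP[wyK euw]; rewrite in_setU1 inE in_setU1 in_setI euw andbT.
  have wF : w \in F by case/orP: wyK => [/eqP->|/andP[]].
  have := clJ u w uJ wF euw; rewrite in_setU1 => /orP[->|wJ]; first by rewrite orbT.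
  case: eqVneq => //= wm.
  have -> : w \in F2 by apply: clF2 uF2 uv wF euw wm.
  by case/orP: wyK => [/eqP wy|/andP[_ ->]]; [rewrite -wy wJ in yJ | rewrite orbT].
(* A lobe of [F2] without neighbours of [m] would be a lobe of [F] inside [J :\ m], against the
   minimality of [J]. *)
- move=> u J2 uF2 lJ2 vJ2 J2K; apply/negP => /eqP J2M.
  have /lobeP[sJ2 cJ2 clJ2] := lJ2.
  have sJ2J : J2 \subset J :\ m.
    apply/subsetP => z zJ2; have : z \in F2 by have := subsetP sJ2 z zJ2; rewrite inE => /andP[].
    by move/F2J; rewrite !inE andbC; apply; apply: contraNneq vJ2 => <-.
  have uF : u \in F.
    by have := subsetP sF2 u uF2; rewrite !inE => /andP[_ /orP[/eqP->//|/(subsetP sJF)]].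
  apply: (small u J2) => //; apply/lobeP; split=> //.
    apply/subsetP => z zJ2; have := subsetP sJ2 z zJ2; rewrite !inE => /andP[-> _].
    by apply: (subsetP sJF); have := subsetP sJ2J z zJ2; rewrite inE => /andP[].
  move=> a b aJ2 bF eab; apply: (clJ2 a) => //.
  have av : a != v by apply: contraNneq vJ2 => <-.
  have aF2 : a \in F2 by have := subsetP sJ2 a aJ2; rewrite inE => /andP[].
  apply: (clF2 a) => //; apply/eqP => bm.
  by move/setP/(_ a): J2M; rewrite !inE aJ2 -bm es eab.
rewrite inE in wm; apply: lpW (lp_cat (lp1 e (set11 m)) lw wm _).
- rewrite subUset sub1set !inE mJ orbT /=; apply: subset_trans sF2 _; exact: subD1set.
- by clear; lia.
- by rewrite disjoints1; apply/negP => /(subsetP sF2); rewrite !inE eqxx.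
Qed.

End Lobes.

(** * A double count for two families of sets *)

Section Fraction.
Import Order.TTheory GRing.Theory Num.Theory.
Local Open Scope ring_scope.
Variables (I U : finType) (J : {set I}) (Z : {set U}).

Lemma sum_inv_mult (A : I -> {set U}) (b : I -> nat) :
  (forall i, i \in J -> A i \subset Z) ->
  (forall i u, i \in J -> u \in A i -> (#|[set j in J | u \in A j]| <= b i)%N) ->
  \sum_(i in J) (#|A i|%:R / (b i)%:R : rat) <= #|Z|%:R.
Proof.
move=> sA hb; pose m u : rat := #|[set j in J | u \in A j]|%:R.
have m0 u i : i \in J -> u \in A i -> (0 < #|[set j in J | u \in A j]|)%N.
  by move=> iJ uA; apply/card_gt0P; exists i; rewrite inE iJ.
apply: (@le_trans _ _ (\sum_(i in J) \sum_(u in A i) (m u)^-1)).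
  apply: ler_sum => i iJ; rewrite mulr_natl -sumr_const.
  apply: ler_sum => u uA; have := m0 u i iJ uA; have := hb i u iJ uA => h1 h2.
  by rewrite lef_pV2 ?posrE ?ltr0n ?ler_nat //; apply: leq_trans h1.
rewrite (exchange_big_dep (mem Z)) /=; last by move=> i u iJ; apply: (subsetP (sA i iJ)).
rewrite -[X in _ <= X%:R](sum1_card (mem Z)) natr_sum; apply: ler_sum => u uZ.
rewrite sumr_const -[X in X <= _]mulr_natl.
have -> : #|[pred i | (i \in J) && (u \in A i)]| = #|[set j in J | u \in A j]|.
  by apply: eq_card => j; rewrite !inE.
rewrite -/(m u) /=; have [->|nz] := eqVneq (m u) 0; first by rewrite mul0r ler01.
by rewrite divff.
Qed.

(* Summing 1/m_u over all incidences counts each point of Z at most once per family, while each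
   index contributes at least a/b + b/a >= 2. *)
Lemma card_pairs_le (A B : I -> {set U}) :
  (forall i, i \in J -> [/\ A i \subset Z, B i \subset Z, A i != set0 & B i != set0]) ->
  (forall i u, i \in J -> u \in A i -> (#|[set j in J | u \in A j]| <= #|B i|)%N) ->
  (forall i u, i \in J -> u \in B i -> (#|[set j in J | u \in B j]| <= #|A i|)%N) ->
  (#|J| <= #|Z|)%N.
Proof.
move=> sAB hA hB.
have h1 := @sum_inv_mult A (fun i => #|B i|) (fun i iJ => let: And4 h _ _ _ := sAB i iJ in h) hA.
have h2 := @sum_inv_mult B (fun i => #|A i|) (fun i iJ => let: And4 _ h _ _ := sAB i iJ in h) hB.
have h3 := lerD h1 h2; rewrite -big_split /= in h3.
have h4 : \sum_(i in J) (2%:R : rat) <= #|Z|%:R + #|Z|%:R.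
  apply: le_trans h3; apply: ler_sum => i /sAB[_ _ A0 B0].
  have a0 : 0 < (#|A i|%:R : rat) by rewrite ltr0n card_gt0.
  have b0 : 0 < (#|B i|%:R : rat) by rewrite ltr0n card_gt0.
  set a := #|A i|%:R in a0 *; set b := #|B i|%:R in b0 *.
  have -> : a / b + b / a = 2%:R + (a - b) ^+ 2 / (a * b).
    have an : a != 0 by rewrite gt_eqF.
    have bn : b != 0 by rewrite gt_eqF.
    by field; rewrite an bn.
  by rewrite lerDl divr_ge0 ?sqr_ge0 // mulr_ge0 // ltW.
move: h4; rewrite sumr_const -natrD -mulrnA ler_nat; lia.
Qed.
End Fraction.

(** * Branches attached to a longest cycle *)

Section Cycles.
Variables (T : finType) (e : rel T).
Hypotheses (es : symmetric e) (ei : irreflexive e).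
Implicit Types (A B I X Y N : {set T}) (a b u v w x y z : T) (p q s : seq T).

(** The values and their successors are 2|N| distinct numbers between [lo] and [hi.+1]. *)
Lemma card_spread N (f : T -> nat) lo hi : {in N &, injective f} ->
  {in N &, forall n n', f n' != (f n).+1} -> {in N, forall n, lo <= f n <= hi} ->
  2 * #|N| <= hi.+2 - lo.
Proof.
move=> fi fc fb.
pose s := [seq f n | n <- enum N] ++ [seq (f n).+1 | n <- enum N].
have us : uniq s.
  have um : uniq [seq f n | n <- enum N].
    by rewrite map_inj_in_uniq ?enum_uniq // => n n'; rewrite !mem_enum; apply: fi.
  rewrite cat_uniq um /=; apply/andP; split.
    apply/hasPn => _ /mapP[n nN ->]; apply/negP => /mapP[n' n'N /esym/eqP E].
    by rewrite !mem_enum in nN n'N; rewrite (negbTE (fc n n' nN n'N)) in E.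
  rewrite map_inj_in_uniq ?enum_uniq // => n n'; rewrite !mem_enum => nN n'N [].
  exact: fi.
have <- : size s = 2 * #|N| by rewrite size_cat !size_map -cardE mul2n addnn.
rewrite -(size_iota lo (hi.+2 - lo)); apply: uniq_leq_size => // k.
have h m : lo <= m <= hi -> (m \in iota lo (hi.+2 - lo)) && (m.+1 \in iota lo (hi.+2 - lo)).
  by rewrite !mem_iota; clear; lia.
by rewrite mem_cat => /orP[] /mapP[n]; rewrite mem_enum => /fb/h/andP[h1 h2] ->.
Qed.

(** Replacing the arc [s] by [z :: q] yields another cycle. When [rest] is empty, [head a rest] is
    [a] itself and the detour returns to its starting point. *)
Lemma cycle_gap a s rest z q (C := (a :: s) ++ rest) : uniq C -> cycle e C ->
  (forall d, 1 < size d -> uniq d -> cycle e d -> size d <= size C) ->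
  path e z q -> uniq (z :: q) -> [disjoint z :: q & C] -> e a z -> e (last z q) (head a rest) ->
  size q < size s.
Proof.
move=> uC cC mx pq uq dq eaz elr.
have sub w : w \in a :: rest -> w \in C.
  by rewrite /C mem_cat !inE => /orP[->|->]; rewrite ?orbT.
have : size (a :: (z :: q) ++ rest) <= size C.
  apply: mx; first by [].
    rewrite cons_uniq cat_uniq uq mem_cat negb_or /= -!andbA; apply/and4P; split.
    - by apply/negP => az; move/disjointP: dq => /(_ a az); apply; rewrite sub ?mem_head.
    - by move: uC; rewrite /C cat_cons cons_uniq mem_cat negb_or => /andP[/andP[]].
    - apply/hasPn => w wr; apply/negP => wq; move/disjointP: dq => /(_ w wq); apply.
      by rewrite sub // inE wr orbT.
    - by move: uC; rewrite /C cat_uniq => /and3P[].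
  rewrite /= rcons_cat cat_path /= eaz pq /=.
  case: rest elr @C cC {uC dq sub} => [|b rest] /=; first by move=> ->.
  by move=> ->; rewrite rcons_cat cat_path /= => /and3P[].
by rewrite /C !size_cat /= !size_cat /= !addSn ltnS -addSn leq_add2r.
Qed.

(** Each attachment ends two of the arcs between consecutive attachments, so summing over the arcs
    counts every weight twice. [rest = [::]] covers a single attachment, whose arc returns to it. *)
Lemma cyclic_sum (att : pred T) (w : T -> nat) r (c : seq T) :
  (forall j a s rest, rot j c = (a :: s) ++ rest -> att a -> all (predC att) s ->
     rest = [::] \/ att (head a rest) -> w a + w (head a rest) <= r * (size s).+1) ->
  2 * \sum_(a <- c | att a) w a <= r * size c.
Proof.
move=> hyp.
have [hc|] := boolP (has att c); last first.
  by move=> nc; rewrite big_hasC.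
have [i ic [a0 [t [E a0t]]]] : exists2 i, i <= size c & exists a0 t, rot i c = a0 :: t /\ att a0.
  exists (find att c); first exact: find_size.
  have fs : find att c < size c by rewrite -has_find.
  case: c hc fs {hyp} => // b c hc fs; exists (nth b (b :: c) (find att (b :: c))).
  by rewrite /rot (drop_nth b) //=; eexists; split; last exact: nth_find.
(* The cycle is cut open at [a0]. The arcs starting in [a :: l] end the run at [a0], so [w a0] is
   counted once more and [w a] once less than in the doubled sum. *)
suff: forall n pre a l, size l <= n -> rot i c = pre ++ a :: l -> att a ->
    2 * (\sum_(b <- a :: l | att b) w b) + w a0 <= r * (size l).+1 + w a.
  move=> /(_ (size t) [::] a0 t (leqnn _) E a0t); rewrite leq_add2r -(size_rot i c).
  rewrite -(perm_big _ (perm_refl _)) => h.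
  rewrite (perm_big (rot i c)) /=; last by rewrite perm_sym perm_rot.
  by rewrite E.
have rr pre l : rot i c = pre ++ l -> exists k, rot k c = l ++ pre.
  by move=> Er; have := rot_size_cat pre l; rewrite -Er rot_rot_add => <-; eexists.
elim=> [|n IH] pre a l sl Er aa; have [k Ek] := rr _ _ Er.
all: have h0 : head a pre = a0 by move: E; rewrite Er; case: pre {Er Ek} => [|x pre] [].
all: have h1 : pre = [::] \/ att (head a pre) by rewrite h0; right.
  case: l sl Er Ek => // _ Er Ek; rewrite big_cons aa big_nil addn0.
  by have := hyp k a [::] pre Ek aa isT h1; rewrite h0; clear; lia.
have [hl|nl] := boolP (has att l); last first.
  rewrite big_cons aa big_hasC // addn0.
  have nl' : all (predC att) l by rewrite all_predC.
  by have := hyp k a l pre Ek aa nl' h1; rewrite h0; clear; lia.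
case: (split_find hl) Er Ek sl => b s1 s2 ab ns1; rewrite cat_rcons => Er Ek sl.
have ns1' : all (predC att) s1 by rewrite all_predC.
have := hyp k a s1 (b :: s2 ++ pre) _ aa ns1' (or_intror ab).
rewrite /= => /(_ _) h2; have {}h2 : w a + w b <= r * (size s1).+1.
  by apply: h2; rewrite Ek /= -catA.
have := IH (pre ++ a :: s1) b s2 _ _ ab.
rewrite -catA /= => /(_ _ Er) h3; have {}h3 : 2 * \sum_(b <- b :: s2 | att b) w b + w a0 <= r * (size s2).+1 + w b.
  by apply: h3; move: sl; rewrite size_cat /=; clear; lia.
rewrite big_cons aa big_cat /= [\sum_(_ <- s1 | _) _]big_hasC // size_cat /=.
by move: h2 h3; set S := \sum_(_ <- _ | _) _; clear; lia.
Qed.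

End Cycles.

(** * Long arcs between two subsets of a cycle *)

Section Arcs.
Variables (T : finType) (e : rel T).
Hypotheses (es : symmetric e) (ei : irreflexive e).
Implicit Types (A B I X Y N : {set T}) (a b u v w x y z : T) (p q s : seq T).

Lemma arc_lp H j x s y r : uniq H -> cycle e H -> rot j H = x :: s ++ y :: r ->
  lp e [set z in H] y x (size H - size s).
Proof.
move=> uH cH E.
have ur : uniq (x :: s ++ y :: r) by rewrite -E rot_uniq.
have cr : cycle e (x :: s ++ y :: r) by rewrite -E rot_cycle.
have sz : size H = (size s + (size r).+1).+1 by rewrite -(size_rot j) E /= size_cat.
exists (rcons r x); last by rewrite size_rcons sz; clear; lia.
apply/and4P; split; last by rewrite last_rcons.
- by move: cr; rewrite /= rcons_cat cat_path => /= /and3P[].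
- rewrite -rcons_cons rcons_uniq; move: ur; rewrite cons_uniq mem_cat negb_or cat_uniq.
  by case/andP=> /andP[_ ->] /and3P[].
- apply/allP => z; rewrite -rcons_cons mem_rcons => zr; rewrite inE -(mem_rot j) E.
  by move: zr; rewrite !inE mem_cat !inE => /or3P[] ->; rewrite ?orbT.
Qed.

(* The complement of a shortest arc between the two sets: it is at least as long as |X| + |Y| - 1,
   since a point of X :&: Y is followed by a point outside X :|: Y. *)
Lemma long_arc H X Y : uniq H -> cycle e H -> X \subset H -> Y \subset H ->
  (exists x y, [/\ x \in X, y \in Y & x != y]) ->
  exists x y, [/\ x \in X, y \in Y, x != y & lp e [set z in H] x y (minn (size H) (#|X| + #|Y| - 1))].
Proof.
move=> uH cH sX sY [x0 [y0 [x0X y0Y n0]]].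
pose gd x y := (x \in X) && (y \in Y) || (x \in Y) && (y \in X).
pose Gk k := [exists j : 'I_(size H), (k.+1 < size H) && gd (nth x0 (rot j H) 0) (nth x0 (rot j H) k.+1)].
have GkI j x s y r : rot j H = x :: s ++ y :: r -> gd x y -> Gk (size s).
  move=> E gxy; have sz : size H = (size s + (size r).+1).+1 by rewrite -(size_rot j) E /= size_cat.
  have [j' Ej] : exists j' : 'I_(size H), rot j' H = rot j H.
    have [jl|jl] := ltnP j (size H); first by exists (Ordinal jl).
    have s0 : 0 < size H by rewrite sz.
    by exists (Ordinal s0); rewrite rot0 rot_oversize.
  apply/existsP; exists j'; rewrite Ej E /= nth_cat ltnn subnn /= gxy andbT sz.
  by clear; lia.
have GkE k : Gk k -> exists j x s y r, [/\ rot j H = x :: s ++ y :: r, gd x y & size s = k].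
  case/existsP=> j /andP[ks]; case E: (rot j H) => [|x t] /=.
    by move: ks; rewrite -(size_rot j) E.
  have kt : k < size t by move: ks; rewrite -(size_rot j) E.
  move=> g; exists j, x, (take k t), (nth x0 t k), (drop k.+1 t); split=> //.
    by rewrite -drop_nth // cat_take_drop.
  by rewrite size_takel // ltnW.
have ex : exists k, Gk k.
  have x0H : x0 \in H by apply: (subsetP sX).
  have [i t E] := rot_to x0H.
  have y0t : y0 \in t.
    have : y0 \in rot i H by rewrite mem_rot; apply: (subsetP sY).
    by rewrite E inE eq_sym (negbTE n0).
  case/splitPr: y0t E => s r E; exists (size s); apply: GkI E _.
  by rewrite /gd x0X y0Y.
case: (ex_minnP ex) => k /GkE[j [x [s [y [r [E g sk]]]]]] mn.
have ur : uniq (x :: s ++ y :: r) by rewrite -E rot_uniq.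
have sz : size H = (size s + (size r).+1).+1 by rewrite -(size_rot j) E /= size_cat.
have rotE l1 l2 : x :: s ++ y :: r = l1 ++ l2 -> exists i, rot i H = l2 ++ l1.
  by move=> El; have := rot_size_cat l1 l2; rewrite -El -E rot_rot_add => <-; eexists.
have nxy : x != y.
  by apply: contraTneq ur => ->; rewrite /= mem_cat mem_head orbT.
(* A point of [X] or [Y] inside [s] would form, with one of the ends [x] and [y], a shorter arc
   between the two sets. *)
have sfree z : z \in s -> z \notin X :|: Y.
  move=> zs; apply/negP => zXY.
  case/splitPr: zs E sk ur sz rotE => s1 s2 E sk ur sz rotE.
  have k1 : Gk (size s1) -> False by move/mn; rewrite -sk size_cat /=; clear; lia.
  have k2 : Gk (size s2) -> False by move/mn; rewrite -sk size_cat /=; clear; lia.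
  have c1 : gd x z -> False.
    by move=> gz; apply/k1/(GkI j x s1 z (s2 ++ y :: r)) => //; rewrite E -catA.
  have c2 : gd z y -> False.
    move=> gz; have [|i Ei] := rotE (x :: s1) (z :: s2 ++ y :: r); first by rewrite /= -catA.
    by apply/k2/(GkI i z s2 y (r ++ x :: s1)) => //; rewrite Ei /= -catA.
  move: zXY g c1 c2; rewrite inE /gd => /orP[] ->; rewrite /= ?andbT.
    by case: (x \in X); case: (y \in Y); case: (x \in Y); case: (y \in X); rewrite ?orbT //=; auto.
  by case: (x \in X); case: (y \in Y); case: (x \in Y); case: (y \in X); rewrite ?orbT //=; auto.
have main : minn (size H) (#|X| + #|Y| - 1) <= size H - size s.
  have [s0|s0] := posnP (size s); first by rewrite s0 subn0 geq_minl.
  pose R := y :: r; pose R' := rcons r x.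
  have uR' : uniq R'.
    rewrite rcons_uniq; move: ur; rewrite cons_uniq mem_cat negb_or inE negb_or cat_uniq /=.
    by case/and3P=> /andP[_ /andP[_ ->]] _ /and3P[_ _ ->].
  pose sc z := nth x R' (index z R).
  (* [x] is left out because its successor lies on [s], outside the arc that is counted; this is
     where the - 1 in the bound comes from. *)
  pose D := (X :&: Y) :\ x.
  have DR z : z \in D -> z \in R.
    rewrite !inE => /and3P[zx zX zY]; have : z \in rot j H by rewrite mem_rot; apply: (subsetP sX).
    rewrite E in_cons (negbTE zx) /= mem_cat => /orP[zs|//].
    by have := sfree z zs; rewrite inE zX.
  have ixR z : z \in D -> index z R < size R' by move=> /DR; rewrite -index_mem size_rcons.
  have scI : {in D &, injective sc}.
    move=> z z' zD z'D /eqP; rewrite nth_uniq ?ixR // => /eqP Ei.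
    by rewrite -(nth_index x (DR z zD)) Ei nth_index ?DR.
  have scN z : z \in D -> sc z \notin X :|: Y.
    move=> zD; apply/negP => scX; have zR := DR z zD.
    have uR : uniq R by move: ur; rewrite cons_uniq cat_uniq => /and4P[].
    have [r1 [r2 ER]] : exists r1 r2, R = r1 ++ z :: r2 by case/splitPr: zR => r1 r2; exists r1, r2.
    have ix : index z R = size r1.
      move: uR; rewrite ER cat_uniq /= negb_or => /and3P[_ /andP[zr1 _] _].
      by rewrite index_cat (negbTE zr1) /= eqxx addn0.
    have scE : sc z = head x (rcons r2 x).
      rewrite /sc ix -[R']/(behead (rcons R x)) nth_behead ER rcons_cat nth_cat ltnNge leqnSn /=.
      by rewrite subSnn /= nth0.
    have zg v : v \in X :|: Y -> gd z v.
      by move: zD; rewrite !inE /gd => /and3P[_ -> ->] /orP[] ->; rewrite ?orbT.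
    have : Gk 0.
      have [|i Ei] := rotE (x :: s ++ r1) (z :: r2); first by rewrite -/R ER /= -catA.
      case: r2 ER scE Ei => [|v r2] ER scE Ei.
        by apply: (GkI i z [::] x (s ++ r1)) => //; apply: zg; move: scX; rewrite scE.
      by apply: (GkI i z [::] v (r2 ++ x :: s ++ r1)) => //; apply: zg; move: scX; rewrite scE.
    by move/mn; rewrite -sk; case: (size s) s0.
  have sub : (X :|: Y) :|: sc @: D \subset [set z in x :: R].
    have inR z : z \in rot j H -> z \in X :|: Y -> z \in x :: R.
      rewrite E in_cons mem_cat [z \in x :: R]in_cons => /or3P[->//|zs zXY|zr _].
        by have := sfree z zs; rewrite zXY.
      by apply/orP; right.
    apply/subsetP => z zU; rewrite inE; move: zU; rewrite in_setU => /orP[zXY|/imsetP[z' z'D ->]].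
      apply: inR => //; rewrite mem_rot; move: zXY.
      by rewrite inE => /orP[/(subsetP sX)|/(subsetP sY)].
    have : sc z' \in R' by apply: mem_nth; apply: ixR.
    by rewrite mem_rcons !in_cons => /orP[->|->]; rewrite ?orbT.
  have dis : (X :|: Y) :&: sc @: D = set0.
    apply/setP => z; rewrite !inE; apply/negP => /andP[zXY /imsetP[z' z'D Ez]].
    by have := scN z' z'D; rewrite -Ez inE zXY.
  have := subset_leq_card sub; rewrite cardsU dis cards0 subn0 card_in_imset //.
  have -> : #|[set z in x :: R]| = (size r).+2.
    rewrite cardsE; suff /card_uniqP-> : uniq (x :: R) by [].
    rewrite cons_uniq; move: ur; rewrite cons_uniq mem_cat negb_or cat_uniq.
    by case/andP=> /andP[_ ->] /and3P[_ _ ->].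
  have := cardsU X Y; have := subset_leq_card (subsetIl X Y); have := cardsD1 x (X :&: Y).
  rewrite -/D sz; move: (x \in _) #|D| #|X :|: Y| #|X :&: Y| #|X| #|Y| (size r) (size s).
  by clear; lia.
have L := arc_lp uH cH E.
have L' := lpW (subxx _) main L.
case/orP: g => /andP[h1 h2].
  by exists x, y; split=> //; apply: lp_sym.
by exists y, x; split; rewrite // eq_sym.
Qed.
End Arcs.

Section Branches.
Variables (T : finType) (e : rel T).
Hypotheses (es : symmetric e) (ei : irreflexive e).
Implicit Types (A B I X Y N : {set T}) (a b u v w x y z : T) (p q s C H : seq T).

Definition longest C :=
  [/\ uniq C, cycle e C & forall d, 1 < size d -> uniq d -> cycle e d -> size d <= size C].

Lemma longest_gap C j a s rest A z z' n : longest C -> rot j C = (a :: s) ++ rest ->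
  lp e A z z' n -> [disjoint A & C] -> e a z -> e z' (head a rest) -> n <= size s.
Proof.
move=> [uC cC mx] E [q /and4P[pq uq qA /eqP lq] nq] dAC eaz ez'.
apply: leq_trans nq _; apply: (@cycle_gap _ e a s rest z q); rewrite -?E ?rot_uniq ?rot_cycle ?lq //.
  by move=> d; rewrite size_rot; apply: mx.
apply/disjointP => w wq; rewrite mem_rot => wC.
by move/pred0P/(_ w): dAC; rewrite /= wC (allP qA).
Qed.

Definition att C (X : {set T}) := [set a in C | [exists z in X, e a z]].

Lemma attP C X a : reflect (a \in C /\ exists2 z, z \in X & e a z) (a \in att C X).
Proof. by rewrite inE; apply: (iffP andP) => -[aC /exists_inP]. Qed.

Lemma sum_att C I (br : T -> {set T}) : uniq C ->
  \sum_(a <- C) #|[set u in I | a \in att C (br u)]| = \sum_(u in I) #|att C (br u)|.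
Proof.
move=> uC; rewrite big_uniq //=.
under eq_bigr => a _ do rewrite -sum1dep_card big_mkcondr /=.
rewrite exchange_big /=; apply: eq_bigr => u uI; rewrite -big_mkcondr /= sum1dep_card.
by apply: eq_card => a; rewrite !inE andbA andbb.
Qed.

(** Between consecutive attachments [a] and [a'], a detour through two branches and a long arc of
    [H] cannot exceed the arc of [C] it bypasses. A one-vertex [H] is allowed: then no two branches
    exist. *)
Lemma branch_bound C H I (br : T -> {set T}) R : longest C -> uniq H ->
  (1 < size H -> cycle e H) -> I \subset H -> [disjoint H & C] ->
  (forall u, u \in I -> [/\ conn e (br u), u \in br u, br u :&: [set z in H] \subset [set u] &
      [disjoint br u & C]]) ->
  {in I &, forall u v, u != v -> [disjoint br u & br v]} ->
  2 * #|I| <= R -> size H < R ->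
  2 * (size H).+1 * \sum_(u in I) #|att C (br u)| <= R * size C.
Proof.
move=> lC uH cH sI dHC brP brD IR HR; have [uC cC mx] := lC.
pose X a := [set u in I | a \in att C (br u)].
pose w a := (size H).+1 * #|X a|.
have -> : 2 * (size H).+1 * \sum_(u in I) #|att C (br u)| = 2 * \sum_(a <- C | X a != set0) w a.
  rewrite -mulnA -big_distrr /=; congr (_ * (_ * _)).
  rewrite -(@sum_att C I br) // big_mkcond /= [RHS]big_mkcond /=; apply: eq_bigr => a _.
  by rewrite -/(X a); case: eqVneq => [->|//]; rewrite cards0.
apply: cyclic_sum => j a s rest E Xa _ hr.
set a' := head a rest; have Xa' : X a' != set0 by case: hr => [r0|//]; rewrite /a' r0.
have XI b : X b \subset I by apply/subsetP => u; rewrite inE => /andP[].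
have XH b : X b \subset H by apply/subsetP => u /(subsetP (XI b)) /(subsetP sI).
have Xbr b u : u \in X b -> exists z, [/\ z \in br u, e b z & u \in I].
  by rewrite inE => /andP[uI /attP[_ [z zb ebz]]]; exists z.
(* These are the two values of the minimum in [long_arc]. The first is settled by [size H < R]; in
   the second the two sets contribute at most [2 * #|I| <= R]. *)
suff [h1|h2] : (#|X a| + #|X a'| <= (size s).+1) \/ (size H < (size s).+1).
- rewrite /w -mulnDr; apply: leq_mul h1; exact: HR.
- rewrite /w -mulnDr mulnC; apply: leq_mul h2.
  apply: leq_trans IR; rewrite mul2n -addnn; apply: leq_add; exact: subset_leq_card.
have [/existsP[x /existsP[y /and3P[xX yX nxy]]]|none] := boolP [exists x, exists y, [&& x \in X a, y \in X a' & x != y]].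
  have H1 : 1 < size H.
    have xH := subsetP (XH a) x xX; have yH := subsetP (XH a') y yX.
    case: (H) xH yH => [|h [|h' H']] //=; rewrite !inE => /eqP xh /eqP yh.
    by rewrite xh yh eqxx in nxy.
  have [|x1 [y1 [x1X y1X n1 L]]] := long_arc es uH (cH H1) (XH a) (XH a'); first by exists x, y.
  have [z [zb eaz x1I]] := Xbr a x1 x1X; have [z' [z'b ea'z' y1I]] := Xbr a' y1 y1X.
  have [c1 x1b i1 d1] := brP x1 x1I; have [c2 y1b i2 d2] := brP y1 y1I.
  move: L; set n := minn _ _ => L.
  have n0 : 0 < n.
    have : 0 < #|X a| by rewrite card_gt0.
    have : 0 < #|X a'| by rewrite card_gt0.
    by rewrite /n; move: H1; move: #|X a| #|X a'| (size H); clear; lia.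
  have L1 := lp_join (lp_conn c1 zb x1b) L i1 isT.
  have i3 : (br x1 :|: [set z in H]) :&: br y1 \subset [set y1].
    rewrite setIUl subUset [[set z in H] :&: _]setIC i2 andbT.
    by have := brD x1 y1 x1I y1I n1; rewrite -setI_eq0 => /eqP->; apply: sub0set.
  have L2 := lp_join L1 (lp_conn c2 y1b z'b) i3 n0.
  have ns : n <= size s.
    apply: longest_gap lC E (lpW (subxx _) _ L2) _ eaz _; first by clear; lia.
      apply/pred0P => t /=; apply/negP => /andP[]; rewrite !inE -orbA => /or3P[tb|tH|tb] tC.
      - by move/pred0P/(_ t): d1; rewrite /= tb tC.
      - by move/pred0P/(_ t): dHC; rewrite /= tH tC.
      - by move/pred0P/(_ t): d2; rewrite /= tb tC.
    by rewrite es.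
  move: ns; rewrite /n geq_min => /orP[h|h]; [by right|left].
  by move: h; move: #|X a| #|X a'|; clear; lia.
(* Here [a] and [a'] see the same single branch; a detour inside it has at least one vertex, so the
   arc has length at least 2. *)
left; case/set0Pn: Xa => u uX; case/set0Pn: Xa' => v vX.
have eqX x y : x \in X a -> y \in X a' -> x = y.
  move=> xX yX; apply/eqP; apply: contraNT none => nxy.
  by apply/existsP; exists x; apply/existsP; exists y; rewrite xX yX.
have -> : X a = [set u].
  apply/setP => x; rewrite in_set1; apply/idP/eqP => [xX|-> //].
  by rewrite (eqX _ _ xX vX) (eqX _ _ uX vX).
have -> : X a' = [set u].
  apply/setP => x; rewrite in_set1; apply/idP/eqP => [xX|->].
    by rewrite (eqX _ _ uX xX).
  by rewrite (eqX _ _ uX vX).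
have [z [zb eaz uI]] := Xbr a u uX.
have [z' [z'b ea'z' _]] : exists z, [/\ z \in br u, e a' z & u \in I] by apply: Xbr; rewrite (eqX _ _ uX vX).
have [c1 u1b i1 d1] := brP u uI.
rewrite !cards1 /= ltnS; apply: longest_gap lC E (lp_conn c1 zb z'b) d1 eaz _.
by rewrite es.
Qed.
End Branches.

(** * Longest paths inside a set with small boundary *)

Section ShortPath.
Variables (T : finType) (e : rel T).
Hypotheses (es : symmetric e) (ei : irreflexive e).
Implicit Types (A B I X Y N W S : {set T}) (a b i j u v w x y z : T) (p q s : seq T).

Section Reroute.
Variables (W : {set T}) (x : T) (p : seq T).
Hypothesis up : upath e W x p (last x p).
Hypothesis mx : forall q, upath e W x q (last x p) -> size q <= size p.

(** The disjunction on [p2] keeps the last vertex fixed when the exchanged segment ends the path. *)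
Lemma longest_insert (p1 m m' p2 : seq T) : p = p1 ++ m ++ p2 ->
  size m < size m' -> uniq m' -> all [in W] m' -> (forall z, z \in m' -> z \notin m -> z \notin x :: p) ->
  path e (last x p1) m' -> last (last x p1) m' = last (last x p1) m \/ p2 != [::] ->
  path e (last (last x p1) m') p2 -> False.
Proof.
move=> Ep sz um' m'W out pm' ll pp2.
have /and4P[pp uxp pW _] := up.
have : size (p1 ++ m' ++ p2) <= size p.
  apply: mx; apply/and4P; split.
  - by move: pp; rewrite Ep !cat_path => /andP[-> /andP[_ _]]; rewrite pm'.
  - move: uxp; rewrite Ep -!cat_cons !cat_uniq => /and3P[-> h1 /and3P[_ h2 ->]]; rewrite um' andbT /=.
    have fr z : z \in m' -> z \in m \/ z \notin x :: p.
      by move=> zm'; case: (boolP (z \in m)) => zm; [left | right; apply: out].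
    apply/andP; split.
      apply/hasPn => z; rewrite mem_cat => /orP[zm'|zp2].
        case: (fr z zm') => [zm|]; first by apply: (hasPn h1); rewrite mem_cat zm.
        by rewrite Ep -cat_cons mem_cat negb_or => /andP[].
      by apply: (hasPn h1); rewrite mem_cat zp2 orbT.
    apply/hasPn => z zp2; apply/negP => zm'; case: (fr z zm') => [zm|].
      by have := hasPn h2 z zp2; rewrite zm.
    by rewrite Ep inE !mem_cat zp2 !orbT.
  - move: pW; rewrite Ep -!cat_cons !all_cat => /and3P[-> _ ->]; by rewrite m'W.
  - rewrite Ep !last_cat; case: ll => [->//|]; by case: (p2).
by rewrite Ep !size_cat leq_add2l leq_add2r leqNgt sz.
Qed.

Lemma longest_no_insert p1 p2 u a : p = p1 ++ a :: p2 -> u \in W -> u \notin x :: p ->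
  e (last x p1) u -> e u a -> False.
Proof.
move=> Ep uW ux e1 e2; apply: (@longest_insert p1 [::] [:: u] (a :: p2)) => //=.
- by rewrite uW.
- by move=> z; rewrite inE => /eqP->.
- by rewrite e1.
- by right.
- by have /and4P[+ _ _ _] := up; rewrite Ep cat_path /= => /and3P[_ _ ->]; rewrite e2.
Qed.

Lemma path_rev_in a m : path e a m -> path e (last a m) (rev (belast a m)).
Proof. by move=> pm; rewrite rev_path (eq_path (e' := e)) // => z z'; rewrite es. Qed.

(** The longer path leaves [p1] through [u], runs [b :: m] backwards and resumes at [c]. *)
Lemma longest_no_cross1 p1 b m c p2 u : p = p1 ++ (b :: m) ++ c :: p2 -> u \in W -> u \notin x :: p ->
  e (last x p1) u -> e u (last b m) -> e b c -> False.
Proof.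
move=> Ep uW ux e1 e2 e3.
have /and4P[pp uxp pW _] := up.
have E : rev (b :: m) = last b m :: rev (belast b m) by rewrite lastI rev_rcons.
apply: (@longest_insert p1 (b :: m) (u :: rev (b :: m)) (c :: p2)) => //.
- by rewrite /= size_rev.
- rewrite cons_uniq rev_uniq mem_rev; apply/andP; split.
    by apply: contra ux => h; rewrite Ep in_cons mem_cat [u \in _ ++ _]mem_cat h !orbT.
  by move: uxp; rewrite Ep -cat_cons !cat_uniq => /and3P[_ _ /and3P[]].
- rewrite /= all_rev; apply/andP; split=> //.
  by move: pW; rewrite Ep -cat_cons !all_cat => /and3P[].
- by move=> z; rewrite inE mem_rev => /orP[/eqP->//|->].
- rewrite /= e1 E /= e2 path_rev_in //.
  by move: pp; rewrite Ep !cat_path /= => /andP[_ /andP[/andP[]]].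
- by right.
- have -> : last (last x p1) (u :: rev (b :: m)) = b by rewrite rev_cons /= last_rcons.
  rewrite /= e3; by move: pp; rewrite Ep !cat_path /= => /and4P[].
Qed.

(** Mirror case: the segment is reversed first, and [u] is inserted between [b] and [c]. *)
Lemma longest_no_cross2 p1 b m c p2 u : p = p1 ++ (b :: m) ++ c :: p2 -> u \in W -> u \notin x :: p ->
  e (last x p1) (last b m) -> e b u -> e u c -> False.
Proof.
move=> Ep uW ux e1 e2 e3.
have /and4P[pp uxp pW _] := up.
have E : rev (b :: m) = last b m :: rev (belast b m) by rewrite lastI rev_rcons.
apply: (@longest_insert p1 (b :: m) (rcons (rev (b :: m)) u) (c :: p2)) => //.
- by rewrite size_rcons size_rev.
- rewrite rcons_uniq rev_uniq mem_rev; apply/andP; split.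
    by apply: contra ux => h; rewrite Ep in_cons mem_cat [u \in _ ++ _]mem_cat h !orbT.
  by move: uxp; rewrite Ep -cat_cons !cat_uniq => /and3P[_ _ /and3P[]].
- rewrite all_rcons all_rev; apply/andP; split=> //.
  by move: pW; rewrite Ep -cat_cons !all_cat => /and3P[].
- by move=> z; rewrite mem_rcons inE mem_rev => /orP[/eqP->//|->].
- rewrite rcons_path; apply/andP; split; last by rewrite rev_cons last_rcons.
  rewrite E /= e1 path_rev_in //.
  by move: pp; rewrite Ep !cat_path /= => /andP[_ /andP[/andP[]]].
- by right.
- by rewrite last_rcons /= e3; move: pp; rewrite Ep !cat_path /= => /and4P[].
Qed.

End Reroute.

Lemma last_take k x p : k < size p -> last x (take k p) = nth x (belast x p) k.
Proof. by elim: p k x => //= a p IH [|k] x //= kp; rewrite IH //; apply: set_nth_default; rewrite size_belast. Qed.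

(* Consecutive vertices of P outside S have disjoint neighbourhoods off P, and a common neighbour
   off P of two vertices forbids an edge between their successors: card_pairs_le then bounds
   the number of such consecutive pairs by the number of points of S off P. *)
Lemma no_short_path lam W S x p : upath e W x p (last x p) ->
  (forall q, upath e W x q (last x p) -> size q <= size p) ->
  W :\: [set z in x :: p] \subset S -> S \subset W ->
  (forall k, k \in W :\: S -> lam <= #|[set w in W | e k w]|) ->
  size p < lam -> 2 * #|S| <= lam -> #|S| <= size p -> False.
Proof.
move=> up mx offS sSW deg pl Sl Sp.
have /and4P[pp uxp pW _] := up.
pose P := [set z in x :: p]; pose Z := S :\: P; pose K := W :\: S.
have inP z : (z \in P) = (z \in x :: p) by rewrite inE.
have cP : #|P| = (size p).+1 by rewrite cardsE; apply/card_uniqP.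
have sPW : P \subset W by apply/subsetP => z; rewrite inP; apply: (allP pW).
have KP z : z \in K -> z \in P.
  rewrite inE => /andP[zS zW]; apply: contraNT zS => zP.
  by apply: (subsetP offS); rewrite inE zP.
have [b Eb] : exists b : seq T, b = belast x p by eexists.
have sb : size b = size p by rewrite Eb size_belast.
have ub : uniq b by move: uxp; rewrite lastI rcons_uniq -Eb => /andP[].
have up' : uniq p by case/andP: uxp.
pose nx z := nth x p (index z b).
have take_last k : k < size p -> last x (take k p) = nth x b k.
  by move=> kp; rewrite Eb; apply: last_take.
pose onP z := [set w in P | e z w]; pose off z := [set w in Z | e z w].
have degK z : z \in K -> lam <= #|onP z| + #|off z|.
  move=> zK; apply: leq_trans (deg z zK) _.
  rewrite -(cardsID P); apply: leq_add; apply: subset_leq_card; apply/subsetP => w.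
    by rewrite !inE => /andP[/andP[_ ->] ->].
  rewrite inE => /andP[wP]; rewrite inE => /andP[wW ezw].
  by rewrite inE ezw andbT inE wP; apply: (subsetP offS); rewrite inE wP.
have onPlt z : z \in P -> #|onP z| <= size p.
  move=> zP; rewrite -ltnS -cP; apply: proper_card; apply/properP; split.
    by apply/subsetP => w; rewrite inE => /andP[].
  by exists z => //; rewrite inE ei andbF.
have offge z : z \in K -> lam - size p <= #|off z|.
  move=> zK; have h1 := degK z zK; have h2 := onPlt z (KP z zK).
  by move: h1 h2; move: #|onP z| #|off z| (size p); clear; lia.
pose E := [set z in b].
have inE' z : (z \in E) = (z \in b) by rewrite inE.
have EP z : z \in E -> z \in P by rewrite inE' inP Eb; apply: mem_belast.
have ixE z : z \in E -> index z b < size p by rewrite inE' -sb index_mem.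
have cE : #|E| = size p by rewrite cardsE -sb; apply/card_uniqP.
have nxP z : z \in E -> nx z \in P by move=> /ixE h; rewrite inP in_cons mem_nth ?orbT.
have nxI : {in E &, injective nx}.
  move=> z z' zE z'E /eqP; rewrite /nx nth_uniq ?ixE // => /eqP Ei.
  by rewrite inE' in zE; rewrite inE' in z'E; rewrite -(nth_index x zE) Ei nth_index.
pose Pi := [set z in E | (z \in K) && (nx z \in K)].
have nK z : z \in P -> (z \in K) || (z \in S :&: P).
  by move=> zP; rewrite !in_setI zP andbT in_setD (subsetP sPW) // andbT orNb.
(* Each point of [S] on the path spoils at most two consecutive pairs. *)
have cPi : size p <= #|Pi| + 2 * #|S :&: P|.
  pose V := [set z in E | nx z \in S :&: P].
  have sub : E \subset Pi :|: (S :&: P) :|: V.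
    apply/subsetP => z zE; rewrite !in_setU [z \in Pi]inE [z \in V]inE zE /=.
    by have := nK z (EP z zE); have := nK _ (nxP z zE); do 4! case: (_ \in _).
  have h1 : #|V| <= #|S :&: P|.
    rewrite -(card_in_imset (f := nx)); last first.
      by move=> z z'; rewrite ![_ \in V]inE => /andP[zE _] /andP[z'E _]; apply: nxI.
    by apply: subset_leq_card; apply/subsetP => _ /imsetP[z zV ->]; move: zV; rewrite inE => /andP[].
  have h2 := subset_leq_card sub; have h3 := (leq_card_setU (Pi :|: (S :&: P)) V).1.
  have h4 := (leq_card_setU Pi (S :&: P)).1; rewrite cE in h2.
  move: h1 h2 h3 h4; move: #|V| #|S :&: P| #|Pi| #|Pi :|: _| #|_ :|: V| (size p); clear; lia.
have PiE z : z \in Pi -> [/\ z \in E, z \in K & nx z \in K].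
  by rewrite inE => /and3P[].
have split1 z : z \in E -> exists p1 p2, p = p1 ++ nx z :: p2 /\ last x p1 = z.
  move=> zE; have h := ixE z zE; exists (take (index z b) p), (drop (index z b).+1 p).
  by rewrite /nx -drop_nth // cat_take_drop take_last // nth_index // -inE'.
have split2 z z' : z \in E -> z' \in E -> index z b < index z' b ->
   exists p1 m p2, [/\ p = p1 ++ (nx z :: m) ++ nx z' :: p2, last x p1 = z & last (nx z) m = z'].
  move=> zE z'E lt; have h := ixE z zE; have h' := ixE z' z'E.
  pose k := index z b; pose k' := index z' b.
  have Em : drop k (take k' p) = nx z :: drop k.+1 (take k' p).
    by rewrite (drop_nth x) ?nth_take //; rewrite size_takel //; apply: ltnW.
  exists (take k p), (drop k.+1 (take k' p)), (drop k'.+1 p).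
  have Et : take k' p = take k p ++ nx z :: drop k.+1 (take k' p).
    by rewrite -Em -{1}(cat_take_drop k (take k' p)) take_takel // ltnW.
  split.
  - by rewrite catA -Et /nx -drop_nth // cat_take_drop.
  - by rewrite take_last // nth_index // -inE'.
  - have L : last x (take k' p) = z' by rewrite (take_last k' h') nth_index // -inE'.
    by rewrite -[RHS]L {2}Et last_cat.
have offW z u : u \in off z -> [/\ u \in W, u \notin x :: p & e z u].
  by rewrite inE => /andP[/setDP[uS uP] ezu]; split=> //; [apply: (subsetP sSW)|rewrite -inP].
have exA i j u : i \in E -> j \in E -> i != j -> u \in off i -> u \in off j -> ~~ e (nx i) (nx j).
  move=> iE jE nij; wlog lt : i j iE jE nij / index i b < index j b.
    move=> H; case: (ltngtP (index i b) (index j b)) => [lt|lt|eq].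
    - exact: H.
    - by move=> ui uj; rewrite es; apply: (H j i) => //; rewrite eq_sym.
    - rewrite inE' in iE; rewrite inE' in jE.
      by rewrite -(nth_index x iE) -(nth_index x jE) eq eqxx in nij.
  move=> /offW[uW ux eiu] /offW[_ _ eju]; apply/negP => enn.
  have [p1 [m [p2 [Ep l1 l2]]]] := split2 i j iE jE lt.
  by apply: (longest_no_cross1 up mx Ep uW ux); rewrite ?l1 ?l2 // es.
have exB i j u : i \in E -> j \in E -> i != j -> u \in off (nx i) -> u \in off (nx j) -> ~~ e i j.
  move=> iE jE nij; wlog lt : i j iE jE nij / index i b < index j b.
    move=> H; case: (ltngtP (index i b) (index j b)) => [lt|lt|eq].
    - exact: H.
    - by move=> ui uj; rewrite es; apply: (H j i) => //; rewrite eq_sym.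
    - rewrite inE' in iE; rewrite inE' in jE.
      by rewrite -(nth_index x iE) -(nth_index x jE) eq eqxx in nij.
  move=> /offW[uW ux eiu] /offW[_ _ eju]; apply/negP => enn.
  have [p1 [m [p2 [Ep l1 l2]]]] := split2 i j iE jE lt.
  by apply: (longest_no_cross2 up mx Ep uW ux); rewrite ?l1 ?l2 // es.
have disAB i : i \in E -> off i :&: off (nx i) = set0.
  move=> iE; apply/setP => u; rewrite in_set0 in_setI; apply/negP => /andP[/offW[uW ux eiu] /offW[_ _ enu]].
  have [p1 [p2 [Ep l1]]] := split1 i iE.
  by apply: (longest_no_insert up mx Ep uW ux); rewrite ?l1 // es.
have offZ z : off z \subset Z by apply/subsetP => u; rewrite inE => /andP[].
have off0 z : z \in K -> off z != set0.
  by move=> /offge h; rewrite -card_gt0; apply: leq_trans h; rewrite subn_gt0.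
have le1 : #|Pi| <= #|Z|.
  apply: (@card_pairs_le _ _ Pi Z off (off \o nx)) => [i iPi|i u iPi ui|i u iPi ui] /=.
  - by have [_ iK nK'] := PiE i iPi; split; rewrite ?offZ ?off0.
  (* The successors of [D] are not adjacent to [nx i]. As the path has at most [lam] vertices,
     [nx i] must make up for these lost neighbours in [Z]. *)
  - have [iE iK nK'] := PiE i iPi; pose D := [set j in Pi | u \in off j].
    have dis : onP (nx i) :&: nx @: D = set0.
      apply/setP => v; rewrite in_set0 in_setI; apply/negP => /andP[].
      rewrite inE => /andP[_ env] /imsetP[j]; rewrite inE => /andP[jPi uj] Ev.
      have [jE _ _] := PiE j jPi; have [ij|nij] := eqVneq i j; first by rewrite Ev ij ei in env.
      by have := exA i j u iE jE nij ui uj; rewrite -Ev env.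
    have cD : #|nx @: D| = #|D|.
      apply: card_in_imset => j k; rewrite ![_ \in D]inE => /andP[/PiE[jE _ _] _] /andP[/PiE[kE _ _] _].
      exact: nxI.
    have sub : onP (nx i) :|: nx @: D \subset P.
      rewrite subUset; apply/andP; split; first by apply/subsetP => v; rewrite inE => /andP[].
      by apply/subsetP => _ /imsetP[j + ->]; rewrite inE => /andP[/PiE[jE _ _] _]; apply: nxP.
    have := subset_leq_card sub; rewrite cardsU dis cards0 subn0 cD cP.
    have := degK _ nK'; move: pl; rewrite -/D.
    by move: #|onP _| #|off _| #|D| (size p); clear; lia.
  - have [iE iK nK'] := PiE i iPi; pose D := [set j in Pi | u \in off (nx j)].
    have dis : onP i :&: D = set0.
      apply/setP => v; rewrite in_set0 in_setI; apply/negP => /andP[].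
      rewrite inE => /andP[_ env]; rewrite inE => /andP[vPi uv].
      have [vE _ _] := PiE v vPi; have [ij|nij] := eqVneq i v; first by rewrite ij ei in env.
      by have := exB i v u iE vE nij ui uv; rewrite env.
    have sub : onP i :|: D \subset P.
      rewrite subUset; apply/andP; split; first by apply/subsetP => v; rewrite inE => /andP[].
      by apply/subsetP => j; rewrite inE => /andP[/PiE[jE _ _] _]; apply: EP.
    have := subset_leq_card sub; rewrite cardsU dis cards0 subn0 cP.
    have := degK _ iK; move: pl; rewrite -/D.
    by move: #|onP _| #|off _| #|D| (size p); clear; lia.
have cS : #|S| = #|S :&: P| + #|Z| by rewrite /Z -(cardsID P S).
have [k kK] : exists k, k \in K.
  have [k kP kS] : exists2 k, k \in P & k \notin S.
    apply/subsetPn; apply: contraL Sp => /subset_leq_card; rewrite cP -ltnNge; exact.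
  by exists k; rewrite inE kS (subsetP sPW).
have Z1 : lam - size p <= #|Z|.
  exact: leq_trans (offge k kK) (subset_leq_card (offZ k)).
(* One pair yields 2 (lam - size p) points of [Z]. Since size p <= |Pi| + 2 (|S| - |Z|) <= lam -
   |Z|, this gives lam <= size p. *)
have [i iPi] : exists i, i \in Pi.
  apply/set0Pn; rewrite -card_gt0; move: cPi cS Z1 pl Sl.
  by move: #|Pi| #|S :&: P| #|Z| #|S| (size p); clear; lia.
have [iE iK nK'] := PiE i iPi.
have Z2 : #|off i| + #|off (nx i)| <= #|Z|.
  have := subset_leq_card (_ : off i :|: off (nx i) \subset Z).
  by rewrite subUset !offZ cardsU disAB // cards0 subn0; apply.
have h1 := offge i iK; have h2 := offge _ nK'.
move: cPi cS Z1 Z2 h1 h2 le1 pl Sl.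
move: #|off i| #|off (nx i)| #|Pi| #|S :&: P| #|Z| #|S| (size p); clear; lia.
Qed.
End ShortPath.

(** * Vertices off a longest path with fixed ends *)

Section Core.
Variables (T : finType) (e : rel T).
Hypotheses (es : symmetric e) (ei : irreflexive e).
Implicit Types (A B I J N Q S W X : {set T}) (a b c f m n v w x y z : T) (p q : seq T).

(** A lexicographic minimum of (m W, |W|): the factor [#|T|.+1] exceeds every cardinality. *)
Lemma min_card_set (Q : pred {set T}) (m : {set T} -> nat) (W0 : {set T}) : Q W0 ->
  exists W, [/\ Q W, m W <= m W0 & forall W', Q W' -> #|W'| < #|W| -> m W < m W'].
Proof.
move=> QW0; pose g W := m W * #|T|.+1 + #|W|.
have cT W : #|W| < #|T|.+1 by rewrite ltnS max_card.
case: (arg_minnP g QW0) => W QW mW; exists W; split=> //.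
  have := mW W0 QW0; rewrite /g; have := cT W0.
  move: #|W| #|W0| #|T|.+1 (m W) (m W0); clear; nia.
move=> W' QW' lt; have := mW W' QW'; rewrite /g; have := cT W.
move: lt; move: #|W| #|W'| #|T|.+1 (m W) (m W'); clear; nia.
Qed.

Lemma lp_drop A x y k : lp e (y |: A) x y k.+1 -> x != y -> exists2 z, lp e (A :\ y) x z k & e z y.
Proof.
move=> [q /and4P[pq uq qA lq] sq] nxy.
case: (lastP q) pq uq qA lq sq => [|q' z]; first by move=> _ _ _ /= /eqP E; rewrite E eqxx in nxy.
rewrite last_rcons rcons_path -rcons_cons rcons_uniq all_rcons size_rcons => /andP[pq ez] /andP[nz uq] /andP[_ qA] /eqP Ez sq.
subst z; exists (last x q') => //; exists q' => //; apply/and4P; split=> //.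
apply/allP => z zq; rewrite in_setD1; have := allP qA z zq; rewrite in_setU1.
case: eqVneq => [zy|//]; by rewrite -zy zq in nz.
Qed.

Section BoundaryDef.
Variables (B hi : {set T}).

(** Vertices outside [hi] are put in the boundary, so that every other vertex of [W] has large
    degree inside [W] itself. *)
Definition bnd W := [set w in W | (w \notin hi) || [exists z in B :\: W, e w z]].

Lemma bndP W w : reflect (w \in W /\ (w \notin hi \/ exists2 z, z \in B :\: W & e w z)) (w \in bnd W).
Proof.
rewrite inE; apply: (iffP andP) => [[wW /orP h]|[wW h]]; split=> //.
  by case: h => [|/exists_inP]; [left|right].
by case: h => [->//|/exists_inP ->]; rewrite orbT.
Qed.

Lemma notin_bnd W w : w \in W :\: bnd W -> w \in hi /\ forall z, z \in B -> e w z -> z \in W.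
Proof.
case/setDP=> wW nb; split=> [|z zB ewz]; apply: contraNT nb => h; apply/bndP; split=> //; first by left.
by right; exists z; rewrite // inE h.
Qed.

Definition nbrW W I := [set w in W :\: I | [exists a in I, e a w]].

Lemma nbrWP W I w : reflect ([/\ w \in W, w \notin I & exists2 a, a \in I & e a w]) (w \in nbrW W I).
Proof.
rewrite inE in_setD; apply: (iffP andP) => [[/andP[h1 h2] /exists_inP h]|[h1 h2 h]]; first by split.
by rewrite h1 h2; split=> //; apply/exists_inP.
Qed.

Lemma bndD_sub W I : bnd (W :\: I) \subset (bnd W :\: I) :|: (nbrW W I :\: bnd W).
Proof.
apply/subsetP => w /bndP[/setDP[wW wI] h].
rewrite in_setU !in_setD wI /=; case: (boolP (w \in bnd W)) => //= nb.
apply/nbrWP; split=> //; case: h => [h|[z /setDP[zB]]].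
  by case/negP: nb; apply/bndP; split=> //; left.
rewrite in_setD negb_and negbK => /orP[zI|zW] ewz; first by exists z; rewrite // es.
by case/negP: nb; apply/bndP; split=> //; right; exists z; rewrite // inE zW.
Qed.

(* Minimality of bnd W is used only in this form: a set removed from W has many new neighbours. *)
Lemma bnd_star W I : #|bnd W| < #|bnd (W :\: I)| -> #|bnd W :&: I| < #|nbrW W I :\: bnd W|.
Proof.
move=> h; have h1 := subset_leq_card (bndD_sub W I).
have h2 := (leq_card_setU (bnd W :\: I) (nbrW W I :\: bnd W)).1.
have h3 := cardsID I (bnd W).
move: h h1 h2 h3; move: #|bnd W| #|bnd (W :\: I)| #|bnd W :&: I| #|bnd W :\: I| #|nbrW W I :\: _| #|_ :|: _|; clear; lia.
Qed.
End BoundaryDef.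

Variables (B hi W0 : {set T}) (lam : nat) (x : T) (p : seq T).
Let P := [set z in x :: p].
Definition olink n n' k := exists z z', [/\ e n z, lp e (W0 :\: P) z z' k & e z' n'].

Hypothesis sW0 : W0 \subset B.
Hypothesis hiP : forall v, v \in hi -> lam <= #|[set w in B | e v w]|.
Hypothesis up : upath e W0 x p (last x p).
Hypothesis mx : forall q, upath e W0 x q (last x p) -> size q <= size p.
Hypothesis pl : size p < lam.
Hypothesis bl : 2 * #|bnd B hi W0| <= lam.
Hypothesis bp : #|bnd B hi W0| <= size p.
(* NC: no set of vertices of hi off the path hangs from the rest of B at a single vertex b. *)
Hypothesis NC : forall I b, I != set0 -> conn e I -> I \subset W0 :\: P -> I \subset hi ->
  b \in W0 :\: I -> (exists2 a, a \in I & e b a) ->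
  (forall a w, a \in I -> w \in B -> e a w -> w \in b |: I) -> False.
(* PC: links off the path from N to f are too long to fit with the maximality of the path. *)
Hypothesis PC : forall f N, f \in P -> N \subset P :\ f -> N != set0 ->
  (forall n, n \in N -> olink n f (lam - 2 * #|N|)) ->
  (forall n n', n \in f |: N -> n' \in f |: N -> n != n' -> olink n n' 1) -> False.

Section Minimal.
Variable W : {set T}.
Hypotheses (sPW : P \subset W) (sWW0 : W \subset W0).
Let S := bnd B hi W.
Let K := W :\: S.
Hypothesis star : forall I, I \subset W :\: P -> I != set0 -> #|S :&: I| < #|nbrW W I :\: S|.

Lemma degW k : k \in K -> lam <= #|[set w in W | e k w]|.
Proof.
move=> /notin_bnd[kh kW]; apply: leq_trans (hiP kh) _; apply: subset_leq_card; apply/subsetP => w.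
by rewrite !inE => /andP[wB ekw]; rewrite ekw andbT; apply: kW.
Qed.

(* The pairs (b, I) among which a minimal one carries the paths that PC forbids. *)
Definition pouch b I := [/\ I \subset W :\: P, conn e I, I :&: K != set0, b \in W :\: I &
   [/\ exists2 a, a \in I & e b a, nbrW W I \subset b |: P &
   b \in P \/ exists f c, [/\ f \in P, c \in (W :\: P) :\: I, e c f & connect (ein e ((W :\: P) :\: I)) b c]]].

Lemma nbrW_closed I a w : I \subset K -> a \in I -> w \in B -> e a w -> w \in nbrW W I :|: I.
Proof.
move=> sI aI wB eaw; have [_ h] := notin_bnd (subsetP sI a aI).
rewrite in_setU; case: (boolP (w \in I)) => wI; rewrite ?orbT // orbF.
by apply/nbrWP; split; [apply: h|done|exists a].
Qed.

(** Vertices outside the boundary have all their neighbours in [B] within [W], so such an [I] hangs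
    from the rest of [B] at [b] alone, against [NC]. *)
Lemma no_closed_pouch I b : I != set0 -> conn e I -> I \subset W :\: P -> S :&: I = set0 ->
  b \in W :\: I -> (exists2 a, a \in I & e b a) -> nbrW W I \subset [set b] -> False.
Proof.
move=> I0 cI sI SI bI ab nb.
have sIK : I \subset K.
  apply/subsetP => z zI; have /setDP[zW _] := subsetP sI z zI; rewrite in_setD zW andbT.
  apply/negP => zS; have : z \in S :&: I by rewrite in_setI zS.
  by rewrite SI in_set0.
apply: (NC (I := I) (b := b)) => //.
- exact: subset_trans sI (setSD _ sWW0).
- by apply/subsetP => z /(subsetP sIK) /notin_bnd[].
- exact: (subsetP (setSD _ sWW0)).
- move=> a w aI wB eaw; have := nbrW_closed sIK aI wB eaw; rewrite in_setU in_setU1.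
  by case/orP => [/(subsetP nb)|->]; rewrite ?orbT // in_set1 => ->.
Qed.

(** [rooted_path] in [b |: I] with root [b] and the neighbours of [n] as marks. Of its [lam]
    neighbours in [W], a vertex of [I] outside [S] loses at most those in [S :&: I] and the feet of
    [I] on the path other than [b]. *)
Lemma min_pouch_link b I n : pouch b I -> (forall v J, pouch v J -> #|I| <= #|J|) ->
  n \in P -> n != b -> n \in nbrW W I ->
  exists m, [/\ m \in I, e n m &
     lp e (b |: I) m b (lam - #|(nbrW W I :&: P) :\ b| - #|S :&: I|).+1].
Proof.
move=> [sI cI IK /setDP[bW bI] [[a0 a0I eba0] nb ex]] mn nP nnb /nbrWP[nW nI [a aI ean]].
have cF : conn e (b |: I) by apply: conn1U cI a0I eba0.
pose M := [set w in I | e n w].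
have IF : I \subset b |: I by apply: subsetUr.
have [|||||m mM L] := @rooted_path _ e es ei K (lam - #|(nbrW W I :&: P) :\ b| - #|S :&: I|) (b |: I) M b.
- by rewrite setU11.
- exact: cF.
- case/set0Pn: IK => k; rewrite in_setI => /andP[kI kK]; exists k.
    by rewrite in_setI kK (subsetP IF).
  by apply: contraNneq bI => <-.
- move=> v; rewrite in_setI in_setU1 => /andP[vF vK] vb; rewrite (negPf vb) /= in vF.
  set Y := [set w in b |: _ | _].
  have sub : [set w in W | e v w] \subset Y :|: (S :&: I) :|: ((nbrW W I :&: P) :\ b).
    apply/subsetP => w; rewrite inE => /andP[wW evw]; rewrite !in_setU.
    have [wb|wb] := eqVneq w b; first by rewrite [w \in Y]inE evw wb setU11.
    case: (boolP (w \in I)) => wI.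
      case: (boolP (w \in S)) => wS; first by rewrite in_setI wS wI orbT.
      have wK : w \in K by rewrite in_setD wS.
      by have -> : w \in Y by rewrite inE evw andbT in_setU1 in_setI in_setU1 wI wK !orbT.
    have wN : w \in nbrW W I by apply/nbrWP; split=> //; exists v.
    have := subsetP nb w wN; rewrite in_setU1 (negPf wb) /= => wP.
    by rewrite [w \in _ :\ b]in_setD1 wb [w \in nbrW _ _ :&: _]in_setI wN wP !orbT.
  have := degW vK; have := subset_leq_card sub.
  have := (leq_card_setU (Y :|: (S :&: I)) ((nbrW W I :&: P) :\ b)).1.
  have := (leq_card_setU Y (S :&: I)).1.
  move: #|Y| #|S :&: I| #|_ :\ b| #|_ :|: _| #|Y :|: _ :|: _| #|[set w in W | _]|; clear; lia.
(* An unmarked lobe at [v] in [I] is a smaller pouch: [v] still reaches [n] through [a], outside the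
   lobe. At [b] the lobe would be all of [I] and hence contain [a]. *)
- move=> v J vF lJ bJ JK; apply/negP => /eqP JM.
  have [sJ cJ hJ] := lobeP _ _ _ _ lJ.
  have sJI : J \subset I.
    apply/subsetP => z zJ; have := subsetP sJ z zJ; rewrite in_setD1 in_setU1 => /andP[_ /orP[/eqP zb|//]].
    by rewrite -zb zJ in bJ.
  have aJ : a \notin J.
    apply/negP => aJ; have : a \in J :&: M by rewrite in_setI aJ inE aI es.
    by rewrite JM in_set0.
  have [z zJ] : exists z, z \in J by case/set0Pn: JK => z; rewrite in_setI => /andP[zJ _]; exists z.
  move: vF; rewrite in_setU1 => /orP[/eqP vb|vI].
    subst v; have zI := subsetP sJI z zJ; have [q /and4P[pq uq /andP[_ qI] lq]] := connect_upath zI (connP _ _ cI z a zI aI).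
    have qJ : all [in J] q.
      apply: (lobe_stay lJ zJ pq); first by apply: contra bI => /(allP qI).
      by apply/allP => w /(allP qI) /(subsetP IF).
    case/negP: aJ; rewrite -(eqP lq); have : last z q \in z :: q by apply: mem_last.
    by rewrite in_cons => /orP[/eqP->//|/(allP qJ)].
  have vJ : v \notin J by apply/negP => /(subsetP sJ); rewrite in_setD1 eqxx.
  have vW : v \in W :\: P by apply: (subsetP sI).
  have lt : #|J| < #|I|.
    by apply: proper_card; apply/properP; split=> //; exists v.
  have : #|I| <= #|J|; last by rewrite leqNgt lt.
  apply: (mn v J); split=> //.
  - exact: subset_trans sJI sI.
  - by rewrite in_setD vJ; case/setDP: vW.
  - split.
    + by apply: (lobe_exit es cF (subsetP IF v vI) lJ zJ).
    + apply/subsetP => w /nbrWP[wW wJ [a' a'J eaw]]; rewrite in_setU1.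
      case: (boolP (w \in b |: I)) => wF.
        by have := hJ a' w a'J wF eaw; rewrite in_setU1 (negPf wJ) orbF => ->.
      move: wF; rewrite in_setU1 negb_or => /andP[wb wI].
      have wN : w \in nbrW W I by apply/nbrWP; split=> //; exists a' => //; apply: (subsetP sJI).
      by have := subsetP nb w wN; rewrite in_setU1 (negPf wb) /= => ->; rewrite orbT.
    + right; exists n, a; split=> //.
        by rewrite in_setD aJ; apply: (subsetP sI).
      have lI : lobe e I v J.
        apply/lobeP; split=> //.
          by apply/subsetP => w wJ; rewrite in_setD1 (subsetP sJI) // andbT; apply: contraNneq vJ => <-.
        by move=> w w' wJ w'I; apply: hJ => //; apply: (subsetP IF).
      have [q uq _] := lobe_out cI vI aI lI aJ.
      by apply: connect_einW (upath_connect uq); apply: setSD.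
by exists m; move: mM; rewrite inE => /andP[].
Qed.

(** In a minimal pouch, [star] bounds |S :&: I| by the number of feet in [N'], which turns the
    length from [min_pouch_link] into the one [PC] forbids. What remains is to find the common end
    [f] of the links on the path. *)
Lemma no_pouch b I : ~ pouch b I.
Proof.
have [k] := ubnP #|I|; elim: k b I => // k IH b I le pbI.
have mn v J : pouch v J -> #|I| <= #|J|.
  by move=> pJ; rewrite leqNgt; apply/negP => lt; apply: (IH v J) pJ; apply: leq_trans lt _.
have [sI cI IK bWI [[a0 a0I eba0] nb ex]] := pbI.
have /setDP[bW bI] := bWI.
have I0 : I != set0 by apply/set0Pn; exists a0.
have lnkI n := @min_pouch_link b I n pbI mn.
pose N' := (nbrW W I :&: P) :\ b; move: lnkI; rewrite -/N' => lnkI.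
have N'P n : n \in N' -> [/\ n \in P, n != b & n \in nbrW W I].
  by rewrite in_setD1 in_setI => /and3P[].
have nbN : nbrW W I \subset b |: N'.
  apply/subsetP => w wN; rewrite in_setU1 in_setD1 in_setI wN; have := subsetP nb w wN; rewrite in_setU1.
  by case: eqVneq.
have SN : #|S :&: I| <= #|N'|.
  have h1 := star sI I0; have h2 := subset_leq_card (subset_trans (subsetDl _ S) nbN).
  by rewrite -ltnS; apply: leq_trans h1 _; apply: leq_trans h2 _; rewrite cardsU1; case: (_ \notin _).
have N'0 : N' != set0.
  apply/eqP => N0; apply: (no_closed_pouch I0 cI sI _ bWI).
  - by apply/eqP; rewrite -cards_eq0 -leqn0; rewrite N0 cards0 in SN.
  - by exists a0.
  - by rewrite N0 setU0 in nbN.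
have sI0 : I \subset W0 :\: P by apply: subset_trans sI (setSD _ sWW0).
have N'nb n : n \in N' -> exists2 z, z \in I & e n z.
  by case/N'P=> _ _ /nbrWP[_ _ [z zI ezn]]; exists z; rewrite // es.
case: (boolP (b \in P)) => bP.
  apply: (PC bP (N := N')) => //.
  - by apply/subsetP => n /N'P[nP nbn _]; rewrite in_setD1 nbn.
  - move=> n /N'P[nP nbn nN]; have [m [mI enm L]] := lnkI n nP nbn nN.
    have mb : m != b by apply: contraNneq bI => <-.
    have [z Lz ezb] := lp_drop L mb; exists m, z; split=> //; apply: lpW Lz.
      exact: subset_trans (subsetDl _ _) sI0.
    by move: SN; move: #|N'| #|_ :&: _|; clear; lia.
  - have h n : n \in b |: N' -> exists2 z, z \in I & e n z.
      by rewrite in_setU1 => /orP[/eqP->|/N'nb//]; exists a0.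
    move=> n n' /h[z zI enz] /h[z' z'I enz'] _; exists z, z'; split=> //; last by rewrite es.
    by apply: lpW (lp_conn cI zI z'I).
have bD : b \in (W :\: P) :\: I by rewrite !in_setD bI bP.
have [f0 [c0 [f0P c0D e0 b0]]] : exists f c, [/\ f \in P, c \in (W :\: P) :\: I, e c f & connect (ein e ((W :\: P) :\: I)) b c].
  by case: ex => [h|//]; rewrite h in bP.
(* When [b] is off the path, the links go on from [b] through [Q] to a foot of [Q]; [b] is then an
   inner vertex, which gains one. *)
pose Q := component e ((W :\: P) :\: I) b.
have bQ : b \in Q by apply: comp_refl.
have cQ : conn e Q by apply: comp_conn.
have QD z : z \in Q -> [/\ z \in W, z \notin P & z \notin I].
  by move=> /(subsetP (compS _ _ _)); rewrite !in_setD => /and3P[].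
have c0Q : c0 \in Q by rewrite inE c0D.
pose X := I :|: Q.
have XE : X = (b |: I) :|: Q.
  by apply/setP => z; rewrite !in_setU in_set1; case: eqVneq => [->|//]; rewrite bQ orbT.
have cX : conn e X.
  rewrite XE; apply: (connU es (conn1U es cI a0I eba0) cQ (setU11 _ _) bQ).
have sX : X \subset W :\: P.
  by rewrite subUset sI; apply/subsetP => z /QD[zW zP _]; rewrite in_setD zP.
have sX0 : X \subset W0 :\: P by apply: subset_trans sX (setSD _ sWW0).
have longl n f c : n \in N' -> c \in Q -> e c f -> olink n f (lam - #|N'| - #|S :&: I|).+1.
  case/N'P=> nP nbn nN cQ' ecf; have [m [mI enm L]] := lnkI n nP nbn nN.
  have L2 := lp_join L (lp_conn cQ bQ cQ') _ isT.
  exists m, c; split=> //; apply: lpW (L2 _).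
  - by rewrite -XE.
  - by rewrite addn1.
  - apply/subsetP => z; rewrite in_setI in_set1 in_setU1 => /andP[/orP[//|zI] /QD[_ _]].
    by rewrite zI.
have pairX N f c : N \subset N' -> c \in Q -> e c f ->
    forall n n', n \in f |: N -> n' \in f |: N -> n != n' -> olink n n' 1.
  move=> sN cQ' ecf.
  have h n : n \in f |: N -> exists2 z, z \in X & e n z.
    rewrite in_setU1 => /orP[/eqP->|/(subsetP sN)/N'nb[z zI enz]].
      by exists c; rewrite 1?es // in_setU cQ' orbT.
    by exists z; rewrite // in_setU zI.
  move=> n n' /h[z zI enz] /h[z' z'I enz'] _; exists z, z'; split=> //; last by rewrite es.
  by apply: lpW (lp_conn cX zI z'I).
have [/existsP[f /existsP[c /and4P[fP fN cQ' ecf]]]|none] :=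
    boolP [exists f, exists c, [&& f \in P, f \notin N', c \in Q & e c f]].
  apply: (PC fP (N := N')) => //.
  - by apply/subsetP => n nN; have [nP _ _] := N'P n nN; rewrite in_setD1 nP andbT; apply: contraNneq fN => <-.
  - move=> n nN; have [z [z' [h1 h2 h3]]] := longl n f c nN cQ' ecf; exists z, z'; split=> //.
    by apply: lpW h2 => //; move: SN; move: #|N'| #|_ :&: _|; clear; lia.
  - exact: pairX (subxx _) cQ' ecf.
have feet f c : f \in P -> c \in Q -> e c f -> f \in N'.
  move=> fP cQ' ecf; apply: contraNT none => fN; apply/existsP; exists f; apply/existsP; exists c.
  by rewrite fP fN cQ' ecf.
have nX : nbrW W X \subset N'.
  apply/subsetP => w /nbrWP[wW]; rewrite in_setU negb_or => /andP[wI wQ] [a].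
  rewrite in_setU => /orP[aI|aQ] eaw.
    have := subsetP nbN w; rewrite in_setU1 => /(_ _)/orP[|/eqP wb|//].
      by apply/nbrWP; split=> //; exists a.
    by rewrite wb bQ in wQ.
  case: (boolP (w \in P)) => wP; first exact: feet wP aQ eaw.
  by case/negP: wQ; apply: (comp_closed aQ _ eaw); rewrite !in_setD wI wP.
have X0 : X != set0 by apply/set0Pn; exists b; rewrite in_setU bQ orbT.
(* All feet of [Q] now lie in [N'], so one of them, [f0], must serve as [f] and leave [N']. The loss
   is balanced by this strict inequality, [X] having no neighbour beyond [N'], and by the vertex [b]
   on the links. *)
have starX : #|S :&: X| < #|N'|.
  exact: leq_trans (star sX X0) (subset_leq_card (subset_trans (subsetDl _ _) nX)).
have f0N := feet f0 c0 f0P c0Q e0.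
have cN : #|N'| = #|N' :\ f0|.+1 by rewrite [LHS](cardsD1 f0) f0N.
have SI : #|S :&: I| <= #|S :&: X| by apply: subset_leq_card; apply: setIS; apply: subsetUl.
have [N0|N0] := eqVneq (N' :\ f0) set0.
  apply: (no_closed_pouch X0 cX sX (b := f0)).
  - by apply/eqP; rewrite -cards_eq0 -leqn0; move: starX; rewrite cN N0 cards0.
  - rewrite in_setD (subsetP sPW) // andbT; apply/negP => /(subsetP sX); rewrite in_setD f0P //.
  - by exists c0; rewrite 1?es // in_setU c0Q orbT.
  - apply: (subset_trans nX); apply/subsetP => z zN; rewrite in_set1; apply/negPn/negP => zf.
    have : z \in N' :\ f0 by rewrite in_setD1 zf.
    by rewrite N0 in_set0.
apply: (PC f0P (N := N' :\ f0)) => //.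
- by apply: setSD; apply/subsetP => n /N'P[].
- move=> n /setD1P[_ nN]; have [z [z' [h1 h2 h3]]] := longl n f0 c0 nN c0Q e0; exists z, z'; split=> //.
  by apply: lpW h2 => //; move: SI starX cN; move: #|N'| #|_ :&: I| #|_ :&: X| #|_ :\ _|; clear; lia.
- exact: pairX (subsetDl _ _) c0Q e0.
Qed.

(** A component of [W :\: P] has all its neighbours in [W] on the path, and by [star] it has one;
    with a vertex outside [S] it would be a pouch. *)
Lemma all_high_on_path : W :\: P \subset S.
Proof.
apply/subsetP => v vD; apply: contraT => vS; exfalso.
have /setDP[vW vP] := vD.
pose Q := component e (W :\: P) v.
have vQ : v \in Q by apply: comp_refl.
have sQ : Q \subset W :\: P by apply: compS.
have Q0 : Q != set0 by apply/set0Pn; exists v.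
have nP : nbrW W Q \subset P.
  apply/subsetP => w /nbrWP[wW wQ [a aQ eaw]]; apply: contraNT wQ => wP.
  by apply: comp_closed aQ _ eaw; rewrite in_setD wP.
have /card_gt0P[b /setDP[bN _]] : 0 < #|nbrW W Q :\: S| by apply: leq_ltn_trans (star sQ Q0).
have /nbrWP[bW bQ [a aQ eab]] := bN.
apply: (@no_pouch b Q); split=> //.
- exact: comp_conn.
- by apply/set0Pn; exists v; rewrite in_setI vQ in_setD vS.
- by rewrite in_setD bQ.
- split.
  + by exists a; rewrite // es.
  + exact: subset_trans nP (subsetUr _ _).
  + by left; apply: (subsetP nP).
Qed.
End Minimal.

Theorem no_longest_path : False.
Proof.
have /and4P[pp uxp pW lx] := up.
have sP0 : P \subset W0 by apply/subsetP => z; rewrite inE; apply: (allP pW).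
have [W [/andP[sPW sW] bW mW]] := @min_card_set (fun W => (P \subset W) && (W \subset W0))
  (fun W => #|bnd B hi W|) W0 (introT andP (conj sP0 (subxx _))).
have star I : I \subset W :\: P -> I != set0 -> #|bnd B hi W :&: I| < #|nbrW W I :\: bnd B hi W|.
  move=> sI /set0Pn[i iI]; apply: bnd_star; apply: mW.
    rewrite (subset_trans (subsetDl _ _) sW) andbT; apply/subsetP => z zP.
    rewrite in_setD (subsetP sPW) // andbT; apply/negP => /(subsetP sI); by rewrite in_setD zP.
  apply: proper_card; apply/properP; split; first exact: subsetDl.
  have /setDP[iW _] := subsetP sI i iI; by exists i; rewrite // in_setD iI.
apply: (@no_short_path _ e es ei lam W (bnd B hi W) x p) => //.
- apply/and4P; split=> //; apply/allP => z zp; apply: (subsetP sPW); by rewrite inE.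
- move=> q /and4P[h1 h2 h3 h4]; apply: mx; apply/and4P; split=> //.
  by apply/allP => z /(allP h3) /(subsetP sW).
- exact: all_high_on_path.
- by apply/subsetP => z /bndP[].
- move=> k kK; exact: degW.
- by apply: leq_trans bl; rewrite leq_mul2l.
- exact: leq_trans bW bp.
Qed.
End Core.

(** * Spacing of links along a longest path or cycle, and branches from linkages *)

Section Positions.
Variables (T : finType) (e : rel T).
Hypotheses (es : symmetric e) (ei : irreflexive e).
Implicit Types (A B I J N Q S W X : {set T}) (a b c f m n v w x y z : T) (p q : seq T).

Lemma olink_sym W x p n n' k : olink e W x p n n' k -> olink e W x p n' n k.
Proof. by move=> [z [z' [h1 h2 h3]]]; exists z', z; split; [rewrite es|apply: lp_sym|rewrite es]. Qed.

Lemma lp_max A x y k : lp e A x y k -> lp e A x y (maxn k 1).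
Proof. by case=> q uq hq; exists q => //; rewrite geq_max hq. Qed.

Section Linear.
Variables (W : {set T}) (x : T) (p : seq T) (lam : nat).
Hypothesis up : upath e W x p (last x p).
Hypothesis mx : forall q, upath e W x q (last x p) -> size q <= size p.
Let P := [set z in x :: p].
Let pos z := index z (x :: p).

(** Otherwise the link could replace the stretch between [n] and [n']. The maximum with 1 records
    that a link always has an inner vertex. *)
Lemma olink_gap n n' k : n \in P -> n' \in P -> pos n < pos n' -> olink e W x p n n' k ->
  pos n + maxn k 1 < pos n'.
Proof.
rewrite ![_ \in P]inE => nP n'P lt [z [z' [enz /lp_max[q /and4P[pq uq qW /eqP lq] sq] ez]]].
have n'1 : 0 < pos n' by apply: leq_ltn_trans lt.
have n's : pos n' <= size p by have : pos n' < size (x :: p) by rewrite index_mem.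
set i := pos n in lt *; set j := pos n' in lt n'1 n's *.
have Ei : nth x (x :: p) i = n by apply: nth_index.
have Ej : nth x (x :: p) j = n' by apply: nth_index.
rewrite ltnNge; apply/negP => le.
have le' : i <= j.-1 by move: lt n'1; clear; lia.
have E : p = take i p ++ drop i (take j.-1 p) ++ drop j.-1 p.
  by rewrite catA -[take i p](take_takel p le') !cat_take_drop.
have l1 : last x (take i p) = n.
  rewrite -Ei (last_nth x) size_takel; last by apply: leq_trans n's; apply: ltnW.
  by rewrite -[x :: take i p]/(take i.+1 (x :: p)) nth_take.
have d1 : drop j.-1 p = n' :: drop j p.
  by rewrite -Ej -{2 3}(prednK n'1) [nth x (x :: p) _]/= -drop_nth // -ltnS prednK.
apply: (longest_insert up mx E (m' := z :: q)) => //.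
- rewrite size_drop size_takel; last by move: n's; clear; lia.
  by move: sq le lt; move: (maxn k 1); clear; rewrite /=; lia.
- by apply/allP => w /(allP qW)/setDP[].
- move=> w /(allP qW)/setDP[_ wP] _; by rewrite inE in wP.
- by rewrite l1 /= enz.
- by right; rewrite d1.
- rewrite l1 /= lq d1 /= ez /=.
  have /and4P[pp _ _ _] := up; by rewrite E d1 !cat_path /= in pp; case/and4P: pp.
Qed.

(** This supplies [PC] for a path. Points of [f |: N] are pairwise non-consecutive and [f] is at
    distance at least [D] from [N]. If [N] lies on one side of [f], 2|N| <= size p + 2 - D gives lam
    <= size p + 1; on both sides [D] is lost twice, and 2 (|N| + 1) <= size p + 2 leads to the same
    bound. *)
Lemma linear_spread f N : (size p).+1 < lam -> f \in P -> N \subset P :\ f -> N != set0 ->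
  (forall n, n \in N -> olink e W x p n f (lam - 2 * #|N|)) ->
  (forall n n', n \in f |: N -> n' \in f |: N -> n != n' -> olink e W x p n n' 1) -> False.
Proof.
move=> pl fP sN N0 lf ln.
have NP n : n \in f |: N -> n \in P by rewrite in_setU1 => /orP[/eqP->//|/(subsetP sN)/setD1P[]].
have posI : {in f |: N &, injective pos}.
  move=> n n' /NP; rewrite inE => nP /NP; rewrite inE => n'P E.
  by rewrite -(nth_index x nP) -(nth_index x n'P); congr nth.
have posle n : n \in f |: N -> pos n <= size p.
  by move=> /NP; rewrite inE -index_mem ltnS.
have nc : {in f |: N &, forall n n', pos n' != (pos n).+1}.
  move=> n n' nN n'N; apply/eqP => E.
  have := @olink_gap n n' 1 (NP n nN) (NP n' n'N); rewrite E ltnSn => /(_ isT) h.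
  have nn : n != n' by apply/eqP => nn'; move: E; rewrite nn'; move: (pos n'); clear; lia.
  by move: (h (ln n n' nN n'N nn)); clear; rewrite maxnn; lia.
have sub : N \subset f |: N by apply: subsetUr.
pose D := (maxn (lam - 2 * #|N|) 1).+1.
pose Nr := [set n in N | pos f < pos n]; pose Nl := [set n in N | pos n < pos f].
have fN : f \in f |: N by apply: setU11.
have sr : Nr \subset f |: N by apply/subsetP => n; rewrite inE => /andP[/(subsetP sub)].
have sl : Nl \subset f |: N by apply/subsetP => n; rewrite inE => /andP[/(subsetP sub)].
have hall : 2 * #|f |: N| <= (size p).+2 - 0.
  by apply: (@card_spread _ _ pos) => // n /posle.
have rP n : n \in Nr -> pos f + D <= pos n <= size p.
  rewrite inE => /andP[nN lt]; rewrite posle ?(subsetP sub) // andbT /D addnS.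
  exact: olink_gap (NP f fN) (NP n (subsetP sub n nN)) lt (olink_sym (lf n nN)).
have lP n : n \in Nl -> pos n + D <= pos f.
  rewrite inE => /andP[nN lt]; rewrite /D addnS.
  exact: olink_gap (NP n (subsetP sub n nN)) (NP f fN) lt (lf n nN).
have hr : 2 * #|Nr| <= (size p).+2 - (pos f + D).
  apply: (@card_spread _ _ pos) => [n n'|n n'|n] h; try move=> h'.
  - by apply: posI; apply: (subsetP sr).
  - by apply: nc; apply: (subsetP sr).
  - exact: rP.
have hl : 2 * #|Nl| <= (pos f - D).+2 - 0.
  apply: (@card_spread _ _ pos) => [n n'|n n'|n] h; try move=> h'.
  - by apply: posI; apply: (subsetP sl).
  - by apply: nc; apply: (subsetP sl).
  - by have := lP n h; move: (pos n) (pos f); clear; lia.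
have cN : #|N| <= #|Nl| + #|Nr|.
  apply: leq_trans (leq_card_setU _ _).1; apply: subset_leq_card; apply/subsetP => n nN.
  rewrite in_setU !inE nN /=; case: (ltngtP (pos n) (pos f)) => // E.
  have := posI n f (subsetP sub n nN) fN E => nf; by have := subsetP sN n nN; rewrite nf in_setD1 eqxx.
have cf : #|f |: N| = #|N|.+1.
  by rewrite cardsU1; case: (boolP (f \in N)) => // /(subsetP sN); rewrite in_setD1 eqxx.
have nr : 0 < #|Nr| -> pos f + D <= size p.
  by move=> /card_gt0P[n /rP]; move: (pos f + D) (pos n) (size p); clear; lia.
have nl : 0 < #|Nl| -> D <= pos f.
  by move=> /card_gt0P[n /lP]; move: (pos n) (pos f); clear; lia.
have N1 : 0 < #|N| by rewrite card_gt0.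
have pf := posle f fN.
rewrite cf in hall.
move: hr hl cN nr nl N1 pf hall pl; rewrite /D.
move: #|Nr| #|Nl| #|N| (pos f) (size p); clear; lia.
Qed.
End Linear.

Lemma lp_ein A B x y k : A \subset B -> lp e A x y k -> lp (ein e B) A x y k.
Proof.
move=> sAB [q /and4P[pq uq qA lq] sq]; exists q => //; apply/and4P; split=> //.
by apply: path_ein pq _; apply/allP => z /(allP qA) /(subsetP sAB).
Qed.

Section Cyclic.
Variables (B W : {set T}) (x : T) (p : seq T).
Hypothesis sWB : W \subset B.
Hypothesis sPB : [set z in x :: p] \subset B.
Let P := [set z in x :: p].
Variable H : seq T.
Hypothesis lH : longest (ein e B) H.
Hypothesis eH : H =i x :: p.

(** A link bypasses either of the two arcs between its ends, so both are long. *)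
Lemma cyclic_gap n n' k i j : i < j < size H -> nth x H i = n -> nth x H j = n' ->
  olink e W x p n n' k -> maxn k 1 + i < j /\ maxn k 1 + j < size H + i.
Proof.
move=> /andP[lt js] En En' ol.
have gap a b s rest r : rot r H = (a :: s) ++ b :: rest -> olink e W x p a b k -> maxn k 1 <= size s.
  move=> E [z [z' [eaz /lp_max L ezb]]].
  have [zD z'D] := lp_in L.
  have HB w : w \in rot r H -> w \in B by rewrite mem_rot eH => wP; apply: (subsetP sPB); rewrite inE.
  apply: (longest_gap (A := W :\: P) (z := z) (z' := z') lH E).
  - by apply: lp_ein L; apply: subset_trans (subsetDl _ _) sWB.
  - apply/pred0P => w /=; apply/negP => /andP[/setDP[_ wP]]; rewrite eH => wp.
    by rewrite inE wp in wP.
  - have /setDP[zW _] := zD; rewrite /= eaz (subsetP sWB _ zW) HB // E; exact: mem_head.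
  - have /setDP[zW _] := z'D; rewrite /= ezb (subsetP sWB _ zW) HB // E mem_cat mem_head orbT //.
have is_ : i < size H by apply: ltn_trans lt js.
split.
  have E : rot i H = (n :: drop i.+1 (take j H)) ++ n' :: (drop j.+1 H ++ take i H).
    have -> : n :: drop i.+1 (take j H) = drop i (take j H).
      by rewrite [RHS](drop_nth x) ?nth_take ?En //; rewrite size_takel //; apply: ltnW.
    have E2 : n' :: (drop j.+1 H ++ take i H) = drop j H ++ take i H by rewrite (drop_nth x js) En'.
    rewrite E2 /rot catA; congr cat; rewrite -{1}(cat_take_drop j H) drop_cat size_takel; last exact: ltnW.
    by rewrite lt.
  have := gap _ _ _ _ _ E ol; rewrite size_drop size_takel; last exact: ltnW.
  by move: (maxn k 1) lt; clear; lia.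
have E : rot j H = (n' :: (drop j.+1 H ++ take i H)) ++ n :: drop i.+1 (take j H).
  have -> : n :: drop i.+1 (take j H) = drop i (take j H).
    by rewrite [RHS](drop_nth x) ?nth_take ?En //; rewrite size_takel //; apply: ltnW.
  have -> : n' :: (drop j.+1 H ++ take i H) = drop j H ++ take i H by rewrite (drop_nth x js) En'.
  rewrite /rot -catA; congr cat; by rewrite -{1}(cat_take_drop i (take j H)) take_takel // ltnW.
have := gap _ _ _ _ _ E (olink_sym ol); rewrite size_cat size_drop size_takel; last exact: ltnW.
by move: (maxn k 1) js lt; move: (size H); clear; lia.
Qed.
End Cyclic.

(** This supplies [PC] for a cycle, whose order replaces [lam]. With [f] rotated to position 0, the
    gap [D] behind the last point of [N] leaves too little room for |N| + 1 non-consecutive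
    points. *)
Lemma cyclic_spread B W x p f N (P := [set z in x :: p]) : W \subset B -> P \subset B ->
  longest (ein e B) (x :: p) ->
  f \in P -> N \subset P :\ f -> N != set0 ->
  (forall n, n \in N -> olink e W x p n f ((size p).+1 - 2 * #|N|)) ->
  (forall n n', n \in f |: N -> n' \in f |: N -> n != n' -> olink e W x p n n' 1) -> False.
Proof.
move=> sWB sPB lP fP sN N0 lf ln.
have fp : f \in x :: p by rewrite inE in fP.
have [r H' EH] := rot_to fp.
have lH : longest (ein e B) (f :: H').
  by case: lP => u c m; rewrite -EH; split; rewrite ?rot_uniq ?rot_cycle ?size_rot.
have eH : f :: H' =i x :: p by move=> z; rewrite -EH mem_rot.
have sH : size (f :: H') = (size p).+1 by rewrite -EH size_rot.
pose pos z := index z (f :: H').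
have NP n : n \in f |: N -> n \in f :: H'.
  by rewrite eH in_setU1 => /orP[/eqP->//|/(subsetP sN)/setD1P[_]]; rewrite inE.
have posI : {in f |: N &, injective pos}.
  by move=> n n' /NP nP /NP n'P E; rewrite -(nth_index x nP) -(nth_index x n'P); congr nth.
have poslt n : n \in f |: N -> pos n < (size p).+1.
  by move=> /NP; rewrite -index_mem sH.
have gap n n' k : n \in f |: N -> n' \in f |: N -> pos n < pos n' -> olink e W x p n n' k ->
   maxn k 1 + pos n < pos n' /\ maxn k 1 + pos n' < (size p).+1 + pos n.
  move=> nN n'N lt; rewrite -sH; apply: (cyclic_gap sWB sPB lH eH); rewrite ?lt ?sH ?poslt //.
    by apply: nth_index; apply: NP.
  by apply: nth_index; apply: NP.
have nc : {in f |: N &, forall n n', pos n' != (pos n).+1}.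
  move=> n n' nN n'N; apply/eqP => E.
  have nn : n != n' by apply/eqP => nn'; move: E; rewrite nn'; move: (pos n'); clear; lia.
  have := gap n n' 1 nN n'N; rewrite E => /(_ (ltnSn _) (ln n n' nN n'N nn)).
  by rewrite maxnn; move: (pos n) (size p); clear; lia.
have sub : N \subset f |: N by apply: subsetUr.
have fN : f \in f |: N by apply: setU11.
have pf : pos f = 0 by rewrite /pos /= eqxx.
have fnN : f \notin N by apply/negP => /(subsetP sN); rewrite in_setD1 eqxx.
have Npos n : n \in N -> 0 < pos n.
  move=> nN; rewrite lt0n -pf; apply: contraNneq fnN => E.
  by rewrite -(posI n f (subsetP sub n nN) fN E).
pose D := (maxn ((size p).+1 - 2 * #|N|) 1).+1.
have rng n : n \in N -> D <= pos n <= (size p).+1 - D.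
  move=> nN; have := gap f n _ fN (subsetP sub n nN); rewrite pf => /(_ _ (Npos n nN) (olink_sym (lf n nN))).
  by rewrite /D; move: (size p) (pos n) #|N|; clear; lia.
have h1 : 2 * #|N| <= ((size p).+1 - D).+2 - D.
  apply: (@card_spread _ _ pos) => [n n'|n n'|n] h; try move=> h'.
  - by apply: posI; apply: (subsetP sub).
  - by apply: nc; apply: (subsetP sub).
  - exact: rng.
have h2 : 2 * #|f |: N| <= ((size p).+1 - D).+2 - 0.
  apply: (@card_spread _ _ pos) => // n; rewrite in_setU1 => /orP[/eqP->|/rng/andP[_ ->//]].
  by rewrite pf.
have cf : #|f |: N| = #|N|.+1 by rewrite cardsU1 fnN.
have [D2 N1] : D + D <= (size p).+1 /\ 0 < #|N|.
  rewrite card_gt0 N0; split=> //; case/set0Pn: N0 => n /rng.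
  by rewrite /D; move: (size p) (pos n) #|N|; clear; lia.
rewrite cf in h2.
move: h1 h2 D2 N1; rewrite /D; move: #|N| (size p); clear; lia.
Qed.

Lemma path_conn u q : path e u q -> conn e [set z in u :: q].
Proof.
move=> pq; have h z : z \in [set z in u :: q] -> connect (ein e [set z in u :: q]) u z.
  rewrite inE in_cons => /orP[/eqP->|zq]; first exact: connect0.
  case/splitPr: zq pq => q1 q2; rewrite -!cat_rcons cat_path => /andP[pq1 _].
  rewrite -{2}(last_rcons u q1 z); apply: path_ein_connect => //; apply/allP => w wq.
  by rewrite inE -cat_cons mem_cat wq.
apply/connP => z z' /h h1 /h h2; rewrite connect_ein_sym // in h1; exact: connect_trans h1 h2.
Qed.

Fixpoint trim X p := if p is a :: q then if has [in X] q then trim X q else p else [::].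

Lemma trimP X Y p : lnk e X Y p -> exists u q, trim X p = u :: q /\
  [/\ u \in X, last u q \in Y, path e u q, uniq (u :: q) &
   {subset u :: q <= p} /\ forall z, z \in q -> z \notin X].
Proof.
case: p => // a p /and4P[aX lY pp up].
have hX : has [in X] (a :: p) by rewrite /= aX.
elim: p a hX lY pp up {aX} => [|b p IH] a hX lY pp up.
  by exists a, [::]; rewrite /= orbF in hX; split=> //; split=> //; split=> // z.
have E : trim X (a :: b :: p) = if has [in X] (b :: p) then trim X (b :: p) else a :: b :: p by [].
rewrite E; case: ifP => hb; last first.
  exists a, (b :: p); split=> //; split=> //; first by move: hX; rewrite /= -[_ || has _ _]/(has _ (b :: p)) hb orbF.
  by split=> // z zp; apply: contraFN hb => zX; apply/hasP; exists z.
have [|||u [q [Eq [h1 h2 h3 h4 [h5 h6]]]]] := IH b hb => //; try by [case/andP: pp|case/andP: up].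
by exists u, q; split=> //; split=> //; split=> // z zq; rewrite in_cons h5 ?orbT.
Qed.

(** Starting each path at its last vertex in [X] makes it meet [X] only there, as a branch rooted in
    [X] must; the roots then serve as indices. *)
Lemma linkage_branches X Y k : linkage e X Y k -> exists (U : {set T}) (g : T -> seq T),
  [/\ #|U| = k, U \subset X,
      {in U, forall u, [/\ path e u (g u), uniq (u :: g u), last u (g u) \in Y & forall z, z \in g u -> z \notin X]} &
      {in U &, forall u v, u != v -> [disjoint u :: g u & v :: g v]}].
Proof.
case=> I [g [cI lI dI]].
pose t i := trim X (g i); pose r i := head i (t i).
have tP i : i \in I -> t i = r i :: behead (t i) /\ [/\ r i \in X, last (r i) (behead (t i)) \in Y, path e (r i) (behead (t i)),
    uniq (r i :: behead (t i)) & {subset r i :: behead (t i) <= g i} /\ forall z, z \in behead (t i) -> z \notin X].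
  move=> iI; have [u [q [Eq h]]] := trimP (lI i iI).
  by rewrite /r /t Eq /=; split.
have rI : {in I &, injective r}.
  move=> i j iI jI E; apply/eqP; apply/negPn/negP => nij.
  have /disjointP/(_ (r i)) := dI i j iI jI nij; apply.
    by have [_ [_ _ _ _ [h _]]] := tP i iI; apply: h; apply: mem_head.
  by have [_ [_ _ _ _ [h _]]] := tP j jI; rewrite E; apply: h; apply: mem_head.
pose inv u := odflt u [pick i in I | r i == u].
have invP i : i \in I -> inv (r i) = i.
  move=> iI; rewrite /inv; case: pickP => [j /andP[jI /eqP E]|/(_ i)]; last by rewrite iI eqxx.
  by apply: rI.
exists (r @: I), (fun u => behead (t (inv u))); split.
- by rewrite card_in_imset.
- by apply/subsetP => _ /imsetP[i iI ->]; have [_ []] := tP i iI.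
- by move=> _ /imsetP[i iI ->]; rewrite invP //; have [_ [h1 h2 h3 h4 [h5 h6]]] := tP i iI; split.
- move=> _ _ /imsetP[i iI ->] /imsetP[j jI ->] nij; rewrite !invP //.
  have nij' : i != j by apply: contraNneq nij => ->.
  have [_ [_ _ _ _ [h _]]] := tP i iI; have [_ [_ _ _ _ [h' _]]] := tP j jI.
  apply/disjointP => z zi zj; have /disjointP/(_ z) := dI i j iI jI nij'; apply; [exact: h|exact: h'].
Qed.

(* A lobe avoiding the neighbours of b would be a smaller set I of the same kind, attached at its
   cut vertex; otherwise the neighbours of b are the marks of rooted_path. *)
Lemma pendant_long_cycle B d I b : 0 < d -> I != set0 -> conn e I -> b \notin I ->
  (forall v, v \in I -> d <= #|[set w in B | e v w]|) -> (exists2 a, a \in I & e b a) ->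
  (forall a w, a \in I -> w \in B -> e a w -> w \in b |: I) ->
  exists q, [/\ uniq q, cycle e q, {subset q <= b |: I} & d < size q].
Proof.
move=> d0; have [k] := ubnP #|I|; elim: k I b => // k IH I b le I0 cI bI deg [a0 a0I eba0] cl.
have cF : conn e (b |: I) by apply: conn1U cI a0I eba0.
have [/existsP[v /existsP[J /and5P[vF lJ bJ J0 /eqP JM]]]|none] :=
  boolP [exists v, exists J : {set T}, [&& v \in b |: I, lobe e (b |: I) v J, b \notin J, J :&: I != set0 &
    J :&: [set w in I | e b w] == set0]].
  have [sJ cJ hJ] := lobeP _ _ _ _ lJ.
  have sJI : J \subset I.
    apply/subsetP => z zJ; have := subsetP sJ z zJ; rewrite in_setD1 in_setU1 => /andP[_ /orP[/eqP zb|//]].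
    by rewrite -zb zJ in bJ.
  have [z zJ] : exists z, z \in J by case/set0Pn: J0 => z; rewrite in_setI => /andP[zJ _]; exists z.
  have [a aJ eva] := lobe_exit es cF vF lJ zJ.
  have vI : v \in I.
    move: vF; rewrite in_setU1 => /orP[/eqP vb|//]; exfalso.
    have : a \in J :&: [set w in I | e b w] by rewrite in_setI aJ inE (subsetP sJI) // -vb.
    by rewrite JM in_set0.
  have vJ : v \notin J by apply/negP => /(subsetP sJ); rewrite in_setD1 eqxx.
  have lt : #|J| < #|I| by apply: proper_card; apply/properP; split=> //; exists v.
  have [|||||||q [h1 h2 h3 h4]] := IH J v => //.
  - by apply: leq_trans lt _.
  - by apply/set0Pn; exists z.
  - by move=> w /(subsetP sJI); apply: deg.
  - by exists a.
  - move=> a' w a'J wB eaw; apply: (hJ a' w) => //; apply: cl (subsetP sJI a' a'J) wB eaw.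
  - exists q; split=> // w /h3; rewrite in_setU1 => /orP[/eqP->|/(subsetP sJI) wI]; by rewrite in_setU1 ?vI ?wI orbT.
have FI : (b |: I) :&: I = I by apply/setIidPr; apply: subsetUr.
have [|||||m] := @rooted_path _ e es ei I d (b |: I) [set w in I | e b w] b.
- exact: setU11.
- exact: cF.
- by exists a0; rewrite ?FI //; apply: contraNneq bI => <-.
- move=> v; rewrite FI => vI _; apply: leq_trans (deg v vI) _; apply: subset_leq_card; apply/subsetP => w.
  by rewrite inE => /andP[wB evw]; rewrite inE evw andbT; apply: cl evw.
- move=> v J vF lJ bJ J0; apply: contraNneq none => /eqP JM; apply/existsP; exists v; apply/existsP; exists J.
  by rewrite vF lJ bJ J0 JM.
rewrite inE => /andP[mI ebm] [q /and4P[pq uq qF /eqP lq] sq].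
exists (m :: q); split=> //.
- by rewrite /= rcons_path pq lq.
- exact: allP qF.
Qed.
End Positions.

(** * The order of G when the circumference of G - C is small, or large *)

Section Setting.
Variables (T : finType) (e : rel T).
Hypotheses (es : symmetric e) (ei : irreflexive e).
Implicit Types (A D I J N Q S W X Y hi : {set T}) (a b f m n v w y z : T) (q d : seq T).

Lemma cycle_ein A q : cycle e q -> {subset q <= A} -> cycle (ein e A) q.
Proof.
case: q => // a q cq sq; apply: path_ein => //; apply/allP => z.
by rewrite in_cons mem_rcons in_cons orbA orbb => zq; apply: sq.
Qed.

Lemma ein_cycle A q : cycle (ein e A) q -> cycle e q /\ {subset q <= A}.
Proof.
case: q => [|a q] // cq.
have aA : a \in A by move: cq; case: q => [|b q] /= /andP[/and3P[]].
have [pe /allP pA] := ein_path aA cq; split=> // z; rewrite in_cons => zq; apply: pA.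
by rewrite in_cons mem_rcons in_cons orbA orbb.
Qed.

(** No arc leaves [Y], so paths end at their first vertex in [Y]; the relation is directed, which
    [menger] permits. *)
Definition stop (e0 : rel T) Y : rel T := fun a b => (a \notin Y) && e0 a b.

Lemma menger_stop (e0 : rel T) X Y k :
  (forall S, separates e0 X Y S -> k <= #|S|) -> linkage (stop e0 Y) X Y k.
Proof.
move=> sepk; apply: menger => S /separatesP sep; apply: sepk; apply/separatesP => a q aX pq lq.
have [q' [pq' lq' sq']] : exists q', [/\ path (stop e0 Y) a q', last a q' \in Y & {subset a :: q' <= a :: q}].
  elim: q a pq lq {aX} => [|b q IH] a; first by move=> _ aY; exists [::]; split.
  case: (boolP (a \in Y)) => aY /=.
    by move=> _ _; exists [::]; split=> // z; rewrite !inE => ->.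
  move=> /andP[eab pq] lq; have [q' [h1 h2 h3]] := IH b pq lq; exists (b :: q'); split=> //.
    by rewrite /= /stop aY eab.
  by move=> z; rewrite !in_cons => /orP[->//|zq]; rewrite -in_cons h3 ?orbT // in_cons.
have /hasP[z zq zS] := sep a q' aX pq' lq'; apply/hasP; exists z => //; exact: sq'.
Qed.

Lemma stop_path (e0 : rel T) Y a q : path (stop e0 Y) a q -> path e0 a q /\ forall z, z \in belast a q -> z \notin Y.
Proof.
elim: q a => //= b q IH a /andP[/andP[aY eab] /IH[h1 h2]]; rewrite eab; split=> // z.
by rewrite in_cons => /orP[/eqP->|/h2].
Qed.

Lemma att_subset C X Y : X \subset Y -> att e C X \subset att e C Y.
Proof. by move=> sXY; apply/subsetP => a /attP[aC [z /(subsetP sXY) zY eaz]]; apply/attP; split=> //; exists z. Qed.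

Lemma card_nbr_split (C : seq T) v :
  #|[set w | e v w]| <= #|[set w in ~: [set z in C] | e v w]| + #|att e C [set v]|.
Proof.
apply: leq_trans (leq_card_setU _ _).1; apply: subset_leq_card; apply/subsetP => w; rewrite inE => evw.
rewrite in_setU; case: (boolP (w \in C)) => wC; last by rewrite !inE wC evw.
by apply/orP; right; apply/attP; split=> //; exists v; rewrite ?inE // es.
Qed.

(* W is everything reachable from X before crossing S. *)
Lemma separator_boundary A hi D X S : D \subset A -> X \subset D ->
  separates (ein e D) X (bnd e A hi D) S ->
  exists W, [/\ X \subset W, W \subset D & bnd e A hi W \subset S].
Proof.
move=> sDA sXD sep.
pose Z := [set w in D :\: S | [exists a in X :\: S, connect (ein e (D :\: S)) a w]].
have Zcl w z : w \in Z -> z \in D -> e w z -> z \notin S -> z \in Z.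
  rewrite inE => /andP[wD /exists_inP[a aH caw]] zB ewz zS.
  have zD : z \in D :\: S by rewrite in_setD zS.
  rewrite inE zD; apply/exists_inP; exists a => //; apply: connect_trans caw (connect1 _).
  by rewrite /= wD zD ewz.
exists (X :|: Z :|: (S :&: D)); set W := _ :|: _.
have WZ w : w \in W -> w \notin S -> w \in Z.
  rewrite !in_setU in_setI => /orP[/orP[wH|//]|/andP[-> //]] wS.
  have wD : w \in D :\: S by rewrite in_setD wS (subsetP sXD).
  by rewrite inE wD; apply/exists_inP; exists w; rewrite ?in_setD ?wS.
split.
- by rewrite /W -setUA subsetUl.
- rewrite !subUset sXD subsetIr andbT /=; apply/subsetP => z; by rewrite inE => /andP[/setDP[]].
apply/subsetP => w /bndP[wW hw]; apply/negPn/negP => wS; have wZ := WZ w wW wS.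
have wnb : w \notin bnd e A hi D.
  apply/negP => wb; move: wZ; rewrite inE => /andP[/setDP[wB _] /exists_inP[a /setDP[aH aS] caw]].
  have /forall_inP/(_ a aH)/forall_inP/(_ w wb)/negP := sep; apply.
  rewrite aS wS /=; move: caw; apply: connect_sub => s t /and3P[/setDP[sB sS] /setDP[tB tS] est].
  by apply: connect1; rewrite /= sB tB est !in_setC sS tS.
have wD : w \in D by move: wZ; rewrite inE => /andP[/setDP[]].
case: hw => [nhi|[z /setDP[zA zW] ewz]].
  by case/negP: wnb; apply/bndP; split=> //; left.
case: (boolP (z \in D)) => zD; last by case/negP: wnb; apply/bndP; split=> //; right; exists z; rewrite // in_setD zD.
case/negP: zW; case: (boolP (z \in S)) => zS; first by rewrite !in_setU in_setI zS zD orbT.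
by rewrite !in_setU (Zcl w z) ?orbT.
Qed.

Variables (C : seq T) (lam mu : nat) (x : T) (p : seq T).
Let B := ~: [set z in C].
Let H := x :: p.
Let h := (size p).+1.
Hypothesis lC : longest e C.
Hypothesis uH : uniq H.
Hypothesis cH : 1 < size H -> cycle e H.
Hypothesis HB : [set z in H] \subset B.
Hypothesis mH : forall q, 1 < size q -> uniq q -> cycle e q -> {subset q <= B} -> size q <= h.
Hypothesis deg : forall v, lam + mu <= #|[set w | e v w]|.+1.
Hypotheses (lam1 : 0 < lam) (mu1 : 0 < mu) (muH : mu <= h).

Lemma notinC z : (z \in B) = (z \notin C). Proof. by rewrite !inE. Qed.

Lemma disjointBC X : X \subset B -> [disjoint X & C].
Proof.
move=> sX; apply/pred0P => z /=; apply/negP => /andP[/(subsetP sX)].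
by rewrite notinC => /negPf->.
Qed.

Lemma disjointHC : [disjoint H & C].
Proof.
apply/disjointP => z zH; apply/negP; rewrite -notinC; apply: (subsetP HB); by rewrite inE.
Qed.

Lemma card_vertices X : X \subset B -> size C + #|X| <= #|T|.
Proof.
move=> sX; have [uC _ _] := lC.
have <- : #|[set z in C]| = size C by rewrite cardsE; apply/card_uniqP.
by rewrite -(cardsC [set z in C]) leq_add2l subset_leq_card.
Qed.

Lemma cardH : #|[set z in H]| = h.
Proof. by rewrite cardsE; apply/card_uniqP. Qed.

Lemma longestH : 1 < size H -> longest (ein e B) H.
Proof.
move=> h1; split=> //.
- apply: cycle_ein; first exact: cH.
  by move=> z zH; apply: (subsetP HB); rewrite inE.
- by move=> d d1 ud /ein_cycle[cd sd]; apply: mH.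
Qed.

Lemma path_branch A u q : u \in A -> path (ein e A) u q ->
  conn e [set z in u :: q] /\ [set z in u :: q] \subset A.
Proof.
move=> uB /(ein_path uB)[pq qB]; split; first exact: path_conn.
by apply/subsetP => z; rewrite inE => /(allP qB).
Qed.

Lemma H_path W : [set z in H] \subset W -> upath e W x p (last x p).
Proof.
move=> sW; apply/and4P; split=> //; last by apply/allP => z zH; apply: (subsetP sW); rewrite inE.
case: (posnP (size p)) => [/size0nil->//|p1].
have := cH; rewrite /= ltnS p1 => /(_ isT); by rewrite rcons_path => /andP[].
Qed.

(** The edge of [H] between [last x p] and [x] closes such a path to a cycle in [B]. *)
Lemma H_path_longest W q : W \subset B -> upath e W x q (last x p) -> size q <= size p.
Proof.
move=> sW /and4P[pq uq qW /eqP lq].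
case: (posnP (size q)) => [->//|q1]; rewrite -ltnS; apply: (mH (q := x :: q)) => //.
- have p1 : 0 < size p.
    rewrite lt0n; apply: contraTneq q1 => /size0nil p0.
    move: lq uq; rewrite p0 /=; case: (q) => // z q' /= l /andP[]; rewrite -l mem_last //.
  have := cH; rewrite /= ltnS p1 => /(_ isT); by rewrite !rcons_path pq lq => /andP[].
- by move=> z /(allP qW) /(subsetP sW).
Qed.

Lemma small_rest : h <= lam -> mu.+1 * lam.+1 <= #|T|.+1.
Proof.
move=> hl; pose hi := [set v | h <= #|[set w in B | e v w]|].
(* With [k] branches, R = 2k exceeds h; a separator with fewer than [k] vertices has at most half of
   h. *)
pose Y := B :\: hi; pose k := h./2.+1.
have [/forallP sepk|] := boolP [forall S : {set T}, separates (ein e B) [set z in H] Y S ==> (k <= #|S|)].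
  have := menger (fun S => implyP (sepk S)).
  move=> /linkage_branches[U [g [cU sU gP gD]]].
  pose br u := [set z in u :: g u].
  have UH u : u \in U -> u \in H by move/(subsetP sU); rewrite inE.
  have UB u : u \in U -> u \in B by move/(subsetP sU)/(subsetP HB).
  have bound := @branch_bound _ e es C H U br (2 * k) lC uH cH.
  have {}bound : 2 * h.+1 * \sum_(u in U) #|att e C (br u)| <= 2 * k * size C.
    apply: bound.
    - by apply/subsetP => u /UH.
    - exact: disjointHC.
    - move=> u uU; have [pg ug lY gX] := gP u uU; have [cb sb] := path_branch (UB u uU) pg; split=> //.
      + by rewrite inE mem_head.
      + apply/subsetP => z /setIP[zb zH]; move: zb; rewrite in_set in_cons in_set1 => /orP[//|zg].
        by have := gX z zg; rewrite zH.
      + exact: disjointBC.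
    - move=> u v uU vU nuv; have /disjointP dj := gD u v uU vU nuv.
      apply/pred0P => z /=; apply/negP => /andP[]; rewrite ![_ \in br _]inE; exact: dj.
    - by rewrite cU.
    - by rewrite -[size H]/h /k; move: h; clear; lia.
  (* The end of the path has degree at least lam + mu - 1 and at most h - 1 neighbours in [B]. *)
  have big u : u \in U -> lam + mu - h <= #|att e C (br u)|.
    move=> uU; have [pg ug lY gX] := gP u uU.
    have := deg (last u (g u)); have := card_nbr_split C (last u (g u)); rewrite -/B.
    have : #|att e C [set last u (g u)]| <= #|att e C (br u)|.
      apply: subset_leq_card; apply: att_subset; apply/subsetP => z; rewrite in_set1 => /eqP->.
      by rewrite inE mem_last.
    move: lY; rewrite in_setD inE -ltnNge => /andP[lt _]; move: lt.
    move: h #|att e C (br u)| #|att e C [set _]| #|[set w | _]| #|[set w in B | _]|; clear; lia.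
  have sum : k * (lam + mu - h) <= \sum_(u in U) #|att e C (br u)|.
    by rewrite -cU -sum_nat_const; apply: leq_sum => u /big.
  have cn := card_vertices HB; rewrite cardH in cn.
  have hc : h.+1 * (lam + mu - h) <= size C.
    have : 2 * k * (h.+1 * (lam + mu - h)) <= 2 * k * size C.
      apply: leq_trans bound; rewrite -!mulnA leq_mul2l /= mulnCA leq_mul2l /=; exact: sum.
    by rewrite leq_pmul2l.
  move: hc cn hl muH; move: h (size C) #|T|; clear => h c n.
  (* Writing h = mu + i and lam = h + j, the bound (h + 1)(mu + j + 1) exceeds (mu + 1)(lam + 1) by
     ij. *)
  move=> hc cn hl muh; have [i hi] : exists i, h = mu + i by exists (h - mu); rewrite subnKC.
  have [j hj] : exists j, lam = mu + i + j by exists (lam - h); rewrite -hi subnKC.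
  subst h lam; have E : mu + i + j + mu - (mu + i) = mu + j by clear; lia.
  by rewrite E in hc; move: hc cn; clear; nia.
rewrite negb_forall => /existsP[S]; rewrite negb_imply -ltnNge ltnS => /andP[sep cS]; exfalso.
have EY : bnd e B hi B = Y.
  apply/setP => z; rewrite in_setD; apply/bndP/andP => [[zB [zh|[w]]]|[zh zB]]; rewrite ?setDv ?in_set0 //.
  by split=> //; left.
have [W [sHW sWB bS]] := @separator_boundary B hi B [set z in H] S (subxx _) HB (eq_ind_r (fun Z => separates _ _ Z S) sep EY).
have cb : #|bnd e B hi W| <= h./2 by apply: leq_trans (subset_leq_card bS) cS.
(* The degree parameter is h rather than [lam]: a set of [hi] vertices hanging from one vertex then
   contains, with that vertex, a cycle longer than [H]. *)
apply: (@no_longest_path _ e es ei B hi W h x p) => //.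
- by move=> v; rewrite inE.
- exact: H_path.
- by move=> q; apply: H_path_longest.
- by move: cb; move: #|_| h; clear; lia.
- by move: cb; rewrite /h; move: #|_| (size p); clear; lia.
- move=> I b I0 cI sI Ihi /setDP[bW bI] ab cl.
  have [||q [uq cq sq lq]] := pendant_long_cycle es ei (d := h) (B := B) _ I0 cI bI _ ab cl => //.
    by move=> v /(subsetP Ihi); rewrite inE.
  suff : size q <= h by rewrite leqNgt lq.
  apply: mH => //; first by apply: leq_ltn_trans lq.
  move=> z /sq; rewrite in_setU1 => /orP[/eqP->|/(subsetP sI)/setDP[zW _]]; exact: (subsetP sWB).
- move=> f N fP sN N0; apply: (cyclic_spread es sWB HB _ fP sN N0); apply: longestH.
  case/set0Pn: N0 => n /(subsetP sN)/setD1P[nf nP]; rewrite -[size H]/h -cardH (cardsD1 f) fP ltnS card_gt0.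
  by apply/set0Pn; exists n; rewrite in_setD1 nf.
Qed.

(** * The case where the longest cycle off C has more than lambda vertices *)

Section LargeRest.
Hypothesis hl : lam < h.
Hypothesis kc : forall S a b, #|S| < mu -> a \notin S -> b \notin S -> connect (ein e (~: S)) a b.

Lemma connect_closed A I a t : (forall b w, b \in I -> w \in A -> e b w -> w \in I) -> a \in I ->
  connect (ein e A) a t -> t \in I.
Proof.
move=> cl aI /connectP[q pq ->]; elim: q a aI pq => //= b q IH a aI /andP[/and3P[_ bA eab] pq].
by apply: IH pq; apply: cl eab.
Qed.

Lemma size_H : 1 < size H.
Proof. by rewrite -[size H]/h; apply: leq_ltn_trans hl. Qed.

Lemma size_C : h <= size C.
Proof. by have [_ _ m] := lC; exact: (m H size_H uH (cH size_H)). Qed.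

Lemma H_del_ex w : exists z, z \in [set z in H] :\ w.
Proof.
apply/set0Pn; rewrite -card_gt0; have := cardsD1 w [set z in H]; rewrite cardH.
by have := size_H; rewrite -[size H]/h; case: (_ \in _); move: #|_ :\ _| h; clear; lia.
Qed.

Lemma H_del_conn w : conn e ([set z in H] :\ w).
Proof.
have cy := cH size_H.
case: (boolP (w \in H)) => wH; last first.
  have -> : [set z in H] :\ w = [set z in H].
    by apply/setP => z; rewrite in_setD1; case: eqVneq => //= ->; rewrite inE (negPf wH).
  by apply: path_conn => //; move: cy; rewrite /= rcons_path => /andP[].
have [r t E] := rot_to wH.
have uE : uniq (w :: t) by rewrite -E rot_uniq.
have cE : cycle e (w :: t) by rewrite -E rot_cycle.
have -> : [set z in H] :\ w = [set z in t].
  apply/setP => z; rewrite in_setD1 !in_set -(mem_rot r) E in_cons; case: eqVneq => //= ->.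
  by case/andP: uE => /negPf->.
have st : 0 < size t by have := size_H; rewrite -(size_rot r) E.
case: t st cE {E uE} => // a t _ /=; rewrite rcons_path => /and3P[_ pt _]; exact: path_conn.
Qed.

(** [H] stays connected without [w], so one component of [A :\ w] contains the rest of [H]; that
    component, with [w] if it is in [A], is [A']. *)
Lemma nonconn_shrink A w : [set z in H] \subset A -> ~~ conn e (A :\ w) ->
  exists A', [/\ [set z in H] \subset A', A' \subset A, #|A'| < #|A|, w \notin A :\: A' &
    forall r k, r \in A :\: A' -> k \in A' -> e r k -> k = w].
Proof.
move=> sHA nc; have [x0 x0H] := H_del_ex w.
have sub : [set z in H] :\ w \subset A :\ w by apply: setSD.
pose K := component e (A :\ w) x0; pose A' := K :|: (A :&: [set w]).
have sK : K \subset A :\ w by apply: compS.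
have sA' : A' \subset A by rewrite subUset subsetIl andbT; apply: subset_trans sK (subsetDl _ _).
exists A'; split=> //.
- apply/subsetP => z zH; rewrite in_setU in_setI in_set1 (subsetP sHA) //=; have [->|zw] := eqVneq z w; rewrite ?orbT // orbF.
  have zD : z \in [set z in H] :\ w by rewrite in_setD1 zw.
  rewrite inE (subsetP sub _ zD); apply: connect_einW sub _; exact: (connP _ _ (H_del_conn w)).
- rewrite ltnNge; apply: contra nc => le.
  have EA : A' = A by apply/eqP; rewrite eqEcard sA' le.
  suff -> : A :\ w = K by apply: comp_conn => //; apply: (subsetP sub).
  apply/eqP; rewrite eqEsubset sK andbT; apply/subsetP => z /setD1P[zw]; rewrite -{1}EA in_setU in_setI in_set1 (negPf zw).
  by rewrite andbF orbF.
- by apply/negP => /setDP[wA]; rewrite in_setU in_setI wA set11 orbT.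
- move=> r k /setDP[rA rA'] kA' erk; apply/eqP; apply/negPn/negP => kw.
  have kK : k \in K by move: kA'; rewrite in_setU in_setI in_set1 (negPf kw) andbF orbF.
  case/negP: rA'; rewrite in_setU in_setI in_set1 rA /=; have [->|rw] := eqVneq r w; rewrite ?orbT // orbF.
  by apply: (comp_closed kK); rewrite ?in_setD1 ?rw // es.
Qed.

Lemma connect_first A A' z t : A \subset A' -> z \in A -> connect (ein e A') z t ->
  (t \in A /\ connect (ein e A) z t) \/ exists y r, [/\ y \in A, connect (ein e A) z y, r \in A' :\: A & e y r].
Proof.
move=> sA zA /connectP[q pq ->]; elim: q z zA pq => [|b q IH] z zA /=; first by left; rewrite connect0.
move=> /andP[/and3P[_ bA' ezb] pq]; case: (boolP (b \in A)) => bA; last first.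
  by right; exists z, b; rewrite connect0 in_setD bA.
have c1 : connect (ein e A) z b by apply: connect1; rewrite /= zA bA.
case: (IH b bA pq) => [[h1 h2]|[y [r [h1 h2 h3 h4]]]]; [left|right].
  by split=> //; apply: connect_trans c1 h2.
by exists y, r; split=> //; apply: connect_trans c1 h2.
Qed.

(** [D] is a smallest set containing [H] such that each component of [B :\: D] attaches to [D] in at
    most one vertex; a cut vertex of [D] would allow a smaller one. *)
Lemma block_exists : exists D, [/\ [set z in H] \subset D, D \subset B,
  (forall z z' w w', z \in B :\: D -> connect (ein e (B :\: D)) z z' -> w \in D -> w' \in D ->
     e z w -> e z' w' -> w = w') &
  forall w, conn e (D :\ w)].
Proof.
pose good D := [&& [set z in H] \subset D, D \subset B & [forall z in B :\: D, forall z', forall w in D, forall w' in D,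
   [&& connect (ein e (B :\: D)) z z', e z w & e z' w'] ==> (w == w')]].
have goodP D : reflect [/\ [set z in H] \subset D, D \subset B &
    forall z z' w w', z \in B :\: D -> connect (ein e (B :\: D)) z z' -> w \in D -> w' \in D ->
     e z w -> e z' w' -> w = w'] (good D).
  apply: (iffP and3P) => -[h1 h2 h3]; split=> //.
    move=> z z' w w' zD c wD w'D e1 e2; apply/eqP.
    have /forall_inP/(_ z zD)/forallP/(_ z')/forall_inP/(_ w wD)/forall_inP/(_ w' w'D) := h3.
    by rewrite c e1 e2.
  apply/forall_inP => z zD; apply/forallP => z'; apply/forall_inP => w wD; apply/forall_inP => w' w'D.
  by apply/implyP => /and3P[c e1 e2]; apply/eqP; apply: h3 e1 e2.
have gB : good B by apply/goodP; split=> // z z' w w'; rewrite setDv in_set0.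
(* With a constant measure the strict inequality given for smaller good sets is 0 < 0, so there are
   none. *)
have [D [/goodP[sHD sDB gD] _ mD]] := min_card_set (fun _ => 0) gB.
exists D; split=> // w; apply: contraT => nc.
have [D' [sHD' sD' lt wD' cut]] := nonconn_shrink sHD nc.
have sBD : B :\: D \subset B :\: D' by apply: setDS.
suff gD' : good D' by have := mD D' gD' lt.
apply/goodP; split=> //; first exact: subset_trans sD' sDB.
(* A walk that left [B :\: D] would enter [D :\: D'], giving its component a second attachment
   besides [v]. *)
have key z z' v : z \in B :\: D -> connect (ein e (B :\: D')) z z' -> v \in D' -> e z v ->
    z' \in B :\: D /\ connect (ein e (B :\: D)) z z'.
  move=> zD c vD' ezv; case: (connect_first sBD zD c) => // -[y [r [yD cy rD eyr]]].
  have rD' : r \in D :\: D'.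
    by move: rD; rewrite !in_setD negb_and negbK => /andP[/orP[->|/negPf->] /andP[-> //]]; rewrite andbF.
  have vD := subsetP sD' v vD'; have /setDP[rD0 rnD'] := rD'.
  by have E := gD z y v r zD cy vD rD0 ezv eyr; rewrite -E vD' in rnD'.
have wof z v : z \in B :\: D' -> z \notin B :\: D -> v \in D' -> e z v -> v = w.
  move=> /setDP[zB zD']; rewrite in_setD zB andbT negbK => zD vD' ezv.
  by apply: (cut z v) => //; rewrite in_setD zD'.
move=> z z' v v' zD' c vD' v'D' ezv ez'v'.
case: (boolP (z \in B :\: D)) => zD.
  have [z'D c'] := key z z' v zD c vD' ezv.
  by apply: (gD z z') => //; apply: (subsetP sD').
case: (boolP (z' \in B :\: D)) => z'D.
  have c' : connect (ein e (B :\: D')) z' z by rewrite connect_ein_sym.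
  by have [zD0 _] := key z' z v' z'D c' v'D' ez'v'; rewrite zD0 in zD.
rewrite (wof z v) // (wof z' v') //; exact: connect_einB c zD'.
Qed.

(* Cutting W at w would trade a boundary vertex behind w for w itself. *)
Lemma tight_conn hi D W w : [set z in H] \subset W -> W \subset D -> D \subset B ->
  (forall v, conn e (D :\ v)) ->
  (forall W', ([set z in H] \subset W') && (W' \subset D) -> #|W'| < #|W| -> #|bnd e B hi W| < #|bnd e B hi W'|) ->
  conn e (W :\ w).
Proof.
move=> sHW sWD sDB cD mW; apply: contraT => nc.
have [W' [sHW' sW' lt wW' cut]] := nonconn_shrink sHW nc.
have := mW W'; rewrite sHW' (subset_trans sW' sWD) => /(_ isT lt); rewrite ltnNge => /negP[].
have [r rR] : exists r, r \in W :\: W'.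
  by apply/set0Pn; rewrite -card_gt0 -(ltn_add2l #|W :&: W'|) cardsID addn0 (setIidPr sW').
have [t tH] := H_del_ex w.
(* [D :\ w] is connected, and [W :\: W'] touches [W'] only at [w]; so a walk in [D :\ w] from there
   to [H] must leave [W], at a boundary vertex. *)
have [s /setDP[sW sW''] sb] : exists2 s, s \in W :\: W' & s \in bnd e B hi W.
  have rw : r != w by apply: contraNneq wW' => <-.
  have rD : r \in D :\ w by rewrite in_setD1 rw (subsetP sWD) //; case/setDP: rR.
  have tD : t \in D :\ w by move: tH => /setD1P[tw tH]; rewrite in_setD1 tw (subsetP sWD) // (subsetP sHW).
  have [/exists_inP[s h1 h2]|none] := boolP [exists s in W :\: W', s \in bnd e B hi W]; first by exists s.
  exfalso; have : t \in W :\: W'.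
    apply: connect_closed rR (connP _ _ (cD w) r t rD tD) => a b aR /setD1P[bw bD] eab.
    have /setDP[aW aW'] := aR.
    case: (boolP (b \in W)) => bW.
      rewrite in_setD bW andbT; apply/negP => bW'; by rewrite (cut a b aR bW' eab) eqxx in bw.
    case/negP: none; apply/exists_inP; exists a => //; apply/bndP; split=> //; right; exists b => //.
    by rewrite in_setD bW (subsetP sDB).
  by rewrite in_setD (subsetP sHW') //; case/setD1P: tH.
have sub : bnd e B hi W' \subset w |: (bnd e B hi W :\ s).
  apply/subsetP => v /bndP[vW' hv]; rewrite in_setU1; have [//|vw] := eqVneq v w.
  have vs : v != s by apply: contraNneq sW'' => <-.
  rewrite in_setD1 vs /=; apply/bndP; split; first exact: (subsetP sW').
  case: hv => [h0|[z /setDP[zB zW'] evz]]; [by left|right; exists z => //].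
  rewrite in_setD zB andbT; apply/negP => zW; have ezv : e z v by rewrite es.
  by rewrite (cut z v _ vW' ezv) ?eqxx // in_setD zW' in vw.
apply: leq_trans (subset_leq_card sub) _; rewrite cardsU1 [X in _ <= X](cardsD1 s) sb.
by case: (_ \notin _).
Qed.

(* N_C(Q) together with a separates Q from the rest, so connectivity bounds N_C(Q) from below. *)
Lemma pod_bounds D z a (Q := component e (B :\: D) z) : [set z in H] \subset D -> D \subset B ->
  (forall z z' w w', z \in B :\: D -> connect (ein e (B :\: D)) z z' -> w \in D -> w' \in D ->
     e z w -> e z' w' -> w = w') ->
  z \in B :\: D -> a \in D -> e z a -> mu <= #|att e C Q|.+1 /\ lam + mu <= #|att e C Q| + #|Q| + 1.
Proof.
move=> sHD sDB gD zD aD eza.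
have zQ : z \in Q by apply: comp_refl.
have Qcl b w : b \in Q -> e b w -> [|| w \in att e C Q, w == a | w \in Q].
  move=> bQ ebw; case: (boolP (w \in C)) => wC.
    by apply/orP; left; apply/attP; split=> //; exists b; rewrite // es.
  rewrite -notinC in wC; apply/orP; right; case: (boolP (w \in D)) => wD.
    have cb : connect (ein e (B :\: D)) z b by move: bQ; rewrite inE => /andP[].
    by rewrite (gD z b a w) ?eqxx.
  by rewrite (comp_closed bQ _ ebw) ?orbT // in_setD wD.
have [zB znD] := setDP zD.
have anC : a \notin C by rewrite -notinC (subsetP sDB).
split.
  have cS : #|a |: att e C Q| <= #|att e C Q|.+1 by rewrite cardsU1; case: (_ \notin _).
  apply: leq_trans cS; rewrite leqNgt; apply/negP => lt.
  have [t /setD1P[ta tH]] := H_del_ex a; have tD := subsetP sHD t tH.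
  have notS v : v \in B -> v != a -> v \notin a |: att e C Q.
    by move=> vB va; rewrite in_setU1 (negPf va); apply/negP => /attP[vC _]; rewrite notinC vC in vB.
  have za : z != a by apply: contraNneq znD => ->.
  have := kc lt (notS z zB za) (notS t (subsetP sDB t tD) ta) => ct.
  have : t \in Q.
    apply: connect_closed zQ ct => b w bQ; rewrite in_setC in_setU1 negb_or => /andP[wa wA] ebw.
    by have := Qcl b w bQ ebw; rewrite (negPf wa) (negPf wA).
  by move=> /(subsetP (compS _ _ _)); rewrite in_setD tD.
have sub : [set w | e z w] \subset a |: (att e C Q :|: (Q :\ z)).
  apply/subsetP => w; rewrite inE => ezw; have := Qcl z w zQ ezw; rewrite in_setU1 in_setU in_setD1.
  have -> : w != z by apply: contraTneq ezw => ->; rewrite ei.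
  by case/or3P=> ->; rewrite ?orbT.
have := subset_leq_card sub; rewrite cardsU1; have := (leq_card_setU (att e C Q) (Q :\ z)).1.
have := cardsD1 z Q; rewrite zQ; have := deg z; case: (_ \notin _).
  by move: #|_ :|: _| #|att e C Q| #|Q| #|Q :\ z| #|[set w | _]|; clear; lia.
by move: #|_ :|: _| #|att e C Q| #|Q| #|Q :\ z| #|[set w | _]|; clear; lia.
Qed.

(* Each terminal a gives a branch: the path linking H to a, together with a component of B \ D
   attached at a when a has large degree in B. *)
Lemma linked_terminals D hi : hi = [set v | lam <= #|[set w in B | e v w]|] ->
  [set z in H] \subset D -> D \subset B ->
  (forall z z' w w', z \in B :\: D -> connect (ein e (B :\: D)) z z' -> w \in D -> w' \in D ->
     e z w -> e z' w' -> w = w') ->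
  linkage (ein e D) [set z in H] (bnd e B hi D) lam./2.+1 -> mu.+1 * lam.+1 <= #|T|.+1.
Proof.
move=> Ehi sHD sDB gD /linkage_branches[U [g [cU sU gP gD']]].
pose l u := last u (g u); pose pa u := [set z in u :: g u].
(* A terminal in [hi] is on the boundary of [D] only through a neighbour in [B :\: D], whose
   component is the pod. Pods are empty off [U], so they can be united over all [u]. *)
pose pod u := if u \in U then if l u \in hi then
   if [pick z in B :\: D | e z (l u)] is Some z then component e (B :\: D) z else set0 else set0 else set0.
have UH u : u \in U -> u \in H by move/(subsetP sU); rewrite inE.
have UD u : u \in U -> u \in D by move/(subsetP sU)/(subsetP sHD).
have paP u : u \in U -> conn e (pa u) /\ pa u \subset D.
  by move=> uU; have [pg _ _ _] := gP u uU; apply: path_branch (UD u uU) pg.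
have lpa u : l u \in pa u by rewrite inE mem_last.
have lD u : u \in U -> l u \in D by move=> uU; apply: (subsetP (paP u uU).2).
have podP u : u \in U -> (pod u = set0 /\ mu <= #|att e C [set l u]|) \/
    exists z, [/\ z \in B :\: D, e z (l u) & pod u = component e (B :\: D) z].
  move=> uU; rewrite /pod uU; case: ifP => lh; last first.
    left; split=> //; have := deg (l u); have := card_nbr_split C (l u); rewrite -/B.
    move: lh; rewrite Ehi inE => /negbT; rewrite -ltnNge.
    by move: #|att e C _| #|[set w | _]| #|[set w in B | _]|; clear; lia.
  right; case: pickP => [z /andP[zD ez]|none]; first by exists z.
  have [_ _ /bndP[_ hb] _] := gP u uU; case: hb => [|[z zD ez]]; first by rewrite -/(l u) lh.
  by have := none z; rewrite zD es ez.
have podB u : pod u \subset B :\: D.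
  rewrite /pod; case: ifP => // _; last exact: sub0set.
  case: ifP => // _; last exact: sub0set.
  by case: pickP => [z _|_]; [apply: compS|apply: sub0set].
pose br u := pa u :|: pod u.
have pod_pa u v : v \in U -> [disjoint pa v & pod u].
  move=> vU; apply/pred0P => z /=; apply/negP => /andP[/(subsetP (paP v vU).2) zD /(subsetP (podB u))].
  by rewrite in_setD zD.
have paD u v : u \in U -> v \in U -> u != v -> [disjoint pa u & pa v].
  move=> uU vU nuv; have /disjointP dj := gD' u v uU vU nuv.
  apply/pred0P => z /=; apply/negP => /andP[]; rewrite ![_ \in pa _]inE; exact: dj.
have podD u v : u != v -> [disjoint pod u & pod v].
  move=> nuv; case: (boolP (u \in U)) => uU; last first.
    by rewrite {1}/pod (negPf uU); apply/pred0P => z /=; rewrite in_set0.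
  case: (boolP (v \in U)) => vU; last first.
    by rewrite {2}/pod (negPf vU); apply/pred0P => z /=; rewrite in_set0 andbF.
  case: (podP u uU) => [[-> _]|[z [zD ez ->]]]; first by apply/pred0P => z /=; rewrite in_set0.
  case: (podP v vU) => [[-> _]|[z' [z'D ez' ->]]]; first by apply/pred0P => t /=; rewrite in_set0 andbF.
  apply/pred0P => t /=; apply/negP; rewrite ![_ \in component _ _ _]inE => /andP[/andP[_ c1] /andP[_ c2]].
  have c3 : connect (ein e (B :\: D)) z z'.
    by apply: connect_trans c1 _; rewrite connect_ein_sym.
  have E := gD z z' _ _ zD c3 (lD u uU) (lD v vU) ez ez'.
  by have /pred0P/(_ (l u)) := paD u v uU vU nuv; rewrite /= lpa E lpa.
have brB u : u \in U -> br u \subset B.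
  move=> uU; rewrite subUset (subset_trans (paP u uU).2 sDB).
  exact: subset_trans (podB u) (subsetDl _ _).
have bound : 2 * h.+1 * \sum_(u in U) #|att e C (br u)| <= h.+1 * size C.
  apply: (@branch_bound _ e es C H U br h.+1 lC uH cH) => //.
  - by apply/subsetP => u /UH.
  - exact: disjointHC.
  - move=> u uU; split.
    + case: (podP u uU) => [[E _]|[z [zD ez E]]]; first by rewrite /br E setU0; apply: (paP u uU).1.
      have -> : br u = pa u :|: (l u |: pod u).
        by apply/setP => t; rewrite !in_setU in_set1; case: eqVneq => [->|//]; rewrite lpa.
      have cQ : conn e (pod u) by rewrite E; apply: comp_conn.
      have zQ : z \in pod u by rewrite E; apply: comp_refl.
      apply: (connU es (paP u uU).1 (conn1U es cQ zQ _) (lpa u) (setU11 _ _)); by rewrite es.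
    + by rewrite in_setU inE mem_head.
    + apply/subsetP => z /setIP[]; rewrite in_setU => /orP[zb|/(subsetP (podB u))] zH; last first.
        by move: zH; rewrite in_setD => /andP[/negP nD _] /(subsetP sHD).
      move: zb; rewrite in_set in_cons in_set1 => /orP[//|zg].
      by have [_ _ _ /(_ z zg)] := gP u uU; rewrite zH.
    + by apply: disjointBC; apply: brB.
  - move=> u v uU vU nuv; rewrite -setI_eq0 setIUl !setIUr.
    have E1 := paD u v uU vU nuv; have E2 := podD u v nuv.
    have E3 := pod_pa v u uU; have E4 := pod_pa u v vU.
    rewrite -setI_eq0 in E1; rewrite -setI_eq0 in E2; rewrite -setI_eq0 in E3; rewrite -setI_eq0 setIC in E4.
    by rewrite (eqP E1) (eqP E2) (eqP E3) (eqP E4) !setU0.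
  - by rewrite cU; move: hl; move: h; clear; lia.
(* Without a pod the end alone has [mu] attachments. With one, the two bounds of [pod_bounds] add up
   to 2 mu + lam - 2, which falls one short of 2 mu only for lam = 1. *)
have weight u : u \in U -> 2 * mu - (lam < 2) <= 2 * #|att e C (br u)| + #|pod u|.
  move=> uU; case: (podP u uU) => [[E le]|[z [zD ez E]]].
    have : #|att e C [set l u]| <= #|att e C (br u)|.
      by apply: subset_leq_card; apply: att_subset; rewrite sub1set in_setU lpa.
    by move: le; move: #|pod u| #|att e C (br u)| #|att e C [set _]|; clear; lia.
  have [b1 b2] := pod_bounds sHD sDB gD zD (lD u uU) ez; rewrite -E in b1 b2.
  have : #|att e C (pod u)| <= #|att e C (br u)|.
    by apply: subset_leq_card; apply: att_subset; apply: subsetUr.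
  move: b1 b2 lam1; move: #|pod u| #|att e C (br u)| #|att e C (pod u)|; clear; lia.
have sumw : lam./2.+1 * (2 * mu - (lam < 2)) <= 2 * \sum_(u in U) #|att e C (br u)| + \sum_(u in U) #|pod u|.
  rewrite -cU -sum_nat_const big_distrr /= -big_split /=; apply: leq_sum => u; exact: weight.
have cpod : #|\bigcup_u pod u| = \sum_(u in U) #|pod u|.
  rewrite -sum1_card partition_disjoint_bigcup // [RHS]big_mkcond; apply: eq_bigr => u _.
  by rewrite sum1_card; case: ifP => // /negbT nU; rewrite /pod (negPf nU) cards0.
have spod : \bigcup_u pod u \subset B :\: D by apply/bigcupsP => u _; apply: podB.
have cn : size C + #|[set z in H] :|: \bigcup_u pod u| <= #|T|.
  by apply: card_vertices; rewrite subUset HB; apply: subset_trans spod (subsetDl _ _).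
have E0 : [set z in H] :&: \bigcup_u pod u = set0.
  apply/eqP; rewrite -subset0; apply/subsetP => z /setIP[/(subsetP sHD) zD /(subsetP spod)].
  by rewrite in_setD zD.
rewrite cardsU E0 cards0 subn0 cpod cardH in cn.
have c2 : 2 * \sum_(u in U) #|att e C (br u)| <= size C.
  by rewrite -(leq_pmul2l (ltn0Sn h)) mulnCA mulnA.
move: c2 cn sumw lam1 mu1 hl; move: (\sum_(u in U) _) (\sum_(u in U) #|att _ _ _|) (size C) #|T| h => s1 s2 c n h0.
clear => c2 cn sumw l1 m1 hl0.
have : lam./2.+1 * (2 * mu - (lam < 2)) + h0 <= n by move: c2 cn sumw; clear; lia.
case: (ltnP lam 2) => l2.
  have -> : lam = 1 by move: l1 l2; clear; lia.
  by move: hl0 l1 l2 m1; clear; rewrite /=; lia.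
have [k [Ek|Ek]] : exists k, lam = k.*2 \/ lam = k.*2.+1.
  exists lam./2; rewrite -{1 3}(odd_double_half lam); case: (odd lam); [by right|by left].
- by rewrite Ek doubleK; move: hl0; rewrite Ek; clear; nia.
- have -> : lam./2 = k by rewrite Ek /= uphalf_double.
  by move: hl0; rewrite Ek; clear; nia.
Qed.

(** Consecutive starts on [C] of [mu] disjoint paths from [C] to [W] are linked off [C] by at least
    [lam] vertices, so every arc has length at least [lam.+1]. With 1 < mu, no arc returns to its
    own start. *)
Lemma fan_to_cycle W : [set z in H] \subset W -> W \subset B -> 1 < mu ->
  (forall a b, a \in W -> b \in W -> a != b -> lp e W a b lam) -> mu * lam.+1 <= size C.
Proof.
move=> sHW sWB mu2 jW; have [uC cC _] := lC.
have cardC : #|[set z in C]| = size C by rewrite cardsE; apply/card_uniqP.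
have : linkage (stop e W) [set z in C] W mu.
  apply: menger_stop => S sep; rewrite leqNgt; apply/negP => lt.
  have ex X : mu <= #|X| -> exists2 z, z \in X & z \notin S.
    by move=> muX; apply/subsetPn; apply: contraL lt => /subset_leq_card le; rewrite -leqNgt (leq_trans muX).
  have [a aC aS] : exists2 z, z \in [set z in C] & z \notin S.
    by apply: ex; rewrite cardC; apply: leq_trans muH size_C.
  have [b bW bS] : exists2 z, z \in W & z \notin S.
    by apply: ex; apply: leq_trans muH _; rewrite -cardH; apply: subset_leq_card.
  have /forall_inP/(_ a aC)/forall_inP/(_ b bW)/negP := sep; apply.
  by rewrite aS bS; apply: kc.
move=> /linkage_branches[U [g [cU sU gP gD]]].
have UC u : u \in U -> u \in C by move/(subsetP sU); rewrite inE.
have gE u : u \in U -> exists z q, [/\ g u = z :: q, e u z, path e z q, last z q \in W &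
    [/\ forall t, t \in belast z q -> t \notin W, forall t, t \in z :: q -> t \notin C & uniq (z :: q)]].
  move=> uU; have [pg ug lW gC] := gP u uU.
  case: (g u) pg ug lW gC => [|z q] /= pg ug lW gC.
    by have := subsetP sWB u lW; rewrite notinC UC.
  have [/= /andP[euz pq] hb] := @stop_path e W u (z :: q) pg; exists z, q; split=> //; split.
  - by move=> t tb; apply: hb; rewrite in_cons tb orbT.
  - by move=> t /gC; rewrite inE.
  - by case/andP: ug.
pose hd u := head u (g u); pose rt u := last (hd u) (behead (g u)); pose br u := [set z in g u].
have brP u : u \in U -> [/\ conn e (br u), hd u \in br u, rt u \in br u, e u (hd u) & rt u \in W] /\
   br u :&: W \subset [set rt u] /\ br u \subset B.
  move=> uU; have [z [q [E h1 h2 h3 [h4 h5 h6]]]] := gE u uU.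
  rewrite /br /rt /hd E /=; split; first split=> //.
  - exact: path_conn.
  - by rewrite inE mem_head.
  - by rewrite inE mem_last.
  split; last by apply/subsetP => t; rewrite in_set => /h5; rewrite notinC.
  apply/subsetP => t /setIP[]; rewrite in_set lastI mem_rcons in_cons in_set1 => /orP[//|/h4/negPf->//].
have brD u v : u \in U -> v \in U -> u != v -> [disjoint br u & br v].
  move=> uU vU nuv; have /disjointP dj := gD u v uU vU nuv; apply/pred0P => z /=; apply/negP => /andP[].
  by rewrite ![_ \in br _]in_set => zu zv; apply: (dj z); rewrite in_cons ?zu ?zv orbT.
have sumU : \sum_(a <- C | a \in U) lam.+1 = mu * lam.+1.
  rewrite big_const_seq iter_addn_0 mulnC; congr (_ * _).
  rewrite -size_filter -cU -(card_uniqP (filter_uniq _ uC)); apply: eq_card => a; rewrite mem_filter /=.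
  by case: (boolP (a \in U)) => [/UC->|].
suff : 2 * \sum_(a <- C | a \in U) lam.+1 <= 2 * size C by rewrite sumU leq_pmul2l.
apply: cyclic_sum => j a s rest E aU sU' hr; rewrite addnn -mul2n leq_pmul2l // ltnS.
have [r0|a'U] : rest = [::] \/ head a rest \in U by [].
  have sub : U \subset [set a].
    apply/subsetP => u uU; rewrite in_set1; have := UC u uU; rewrite -(mem_rot j) E r0 cats0 in_cons => /orP[//|us].
    by have := allP sU' u us; rewrite /= uU.
  by have := subset_leq_card sub; rewrite cU cards1 leqNgt mu2.
case: rest E hr a'U => [|a' rest] E hr /= a'U.
  have sub : U \subset [set a].
    apply/subsetP => u uU; rewrite in_set1; have := UC u uU; rewrite -(mem_rot j) E cats0 in_cons => /orP[//|us].
    by have := allP sU' u us; rewrite /= uU.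
  by have := subset_leq_card sub; rewrite cU cards1 leqNgt mu2.
have naa' : a != a'.
  have : uniq (rot j C) by rewrite rot_uniq.
  by rewrite E /= mem_cat in_cons; case: eqVneq => //; rewrite orbT.
have [[c1 hd1 rt1 ea r1W] [i1 b1]] := brP a aU; have [[c2 hd2 rt2 ea' r2W] [i2 b2]] := brP a' a'U.
have nrr : rt a != rt a'.
  by apply/eqP => Er; have /pred0P/(_ (rt a)) := brD a a' aU a'U naa'; rewrite /= rt1 Er rt2.
have L1 := lp_join (lp_conn c1 hd1 rt1) (jW _ _ r1W r2W nrr) i1 isT.
have i3 : (br a :|: W) :&: br a' \subset [set rt a'].
  rewrite setIUl subUset [W :&: _]setIC i2 andbT.
  by have := brD a a' aU a'U naa'; rewrite -setI_eq0 => /eqP->; apply: sub0set.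
have L2 := lp_join L1 (lp_conn c2 rt2 hd2) i3 lam1.
apply: (longest_gap lC E (lpW (subxx _) _ L2)); last first.
- by rewrite es.
- exact: ea.
- by apply: disjointBC; rewrite !subUset b1 b2 sWB.
- by clear; lia.
Qed.

Lemma long_arc_half u v : u \in H -> v \in H -> u != v -> lp e [set z in H] u v h./2.+1.
Proof.
move=> uH' vH nuv; have cy := cH size_H.
have [j t E] := rot_to uH'.
have vt : v \in t by move: vH; rewrite -(mem_rot j) E in_cons eq_sym (negPf nuv).
case/splitPr: vt E => s r E.
have sz : h = (size s + (size r).+1).+1 by rewrite -[h]/(size H) -(size_rot j) E /= size_cat.
have L1 := lp_sym es (arc_lp uH cy E).
have uR : uniq (rot j H) by rewrite rot_uniq.
have cR : cycle e (rot j H) by rewrite rot_cycle.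
have E2 : rot (size s).+1 (rot j H) = v :: r ++ u :: s.
  by rewrite E -cat_cons -[(size s).+1]/(size (u :: s)) rot_size_cat.
have L2 := arc_lp uR cR E2; rewrite size_rot in L2.
have ES : [set z in rot j H] = [set z in H] by apply/setP => z; rewrite !in_set mem_rot.
rewrite ES in L2; rewrite -[size H]/h in L1 L2.
case: (leqP (size s) (size r)) => le; [apply: lpW L1|apply: lpW L2] => //.
  by move: le sz; move: h (size s) (size r); clear; lia.
by move: le sz; move: h (size s) (size r); clear; lia.
Qed.

(** Two disjoint paths from [a] and [b] to [H], joined by the longer arc of [H] between their
    ends. *)
Lemma half_cycle_path W a b : [set z in H] \subset W -> (forall w, conn e (W :\ w)) ->
  a \in W -> b \in W -> a != b -> lp e W a b h./2.+1.
Proof.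
move=> sHW cW aW bW nab.
have c2 : #|[set a; b]| = 2 by rewrite cards2 nab.
have : linkage (stop (ein e W) [set z in H]) [set a; b] [set z in H] 2.
  apply: menger_stop => S sep; rewrite leqNgt; apply/negP => lt.
  have [w Sw] : exists w, S \subset [set w].
    have [->|/set0Pn[w wS]] := eqVneq S set0; first by exists a; apply: sub0set.
    exists w; apply/subsetP => z zS; rewrite in_set1; apply: contraLR lt => zw; rewrite -leqNgt.
    have <- : #|[set z; w]| = 2 by rewrite cards2 zw.
    by apply: subset_leq_card; rewrite subUset !sub1set zS wS.
  have [t /setD1P[tw tH]] := H_del_ex w.
  have [c cab cw] : exists2 c, c \in [set a; b] & c != w.
    have [aw|aw] := eqVneq a w; [exists b; rewrite ?set22 // -aw eq_sym //|by exists a; rewrite ?set21].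
  have cS : c \notin S by apply: contra cw => /(subsetP Sw); rewrite in_set1.
  have tS : t \notin S by apply: contra tw => /(subsetP Sw); rewrite in_set1.
  have cW' : c \in W by move: cab; rewrite !inE => /orP[]/eqP->.
  have /forall_inP/(_ c cab)/forall_inP/(_ t tH)/negP := sep; apply; rewrite cS tS /=.
  have := connP _ _ (cW w) c t; rewrite !in_setD1 cw tw cW' (subsetP sHW) // => /(_ isT isT).
  apply: connect_sub => s s' /and3P[/setD1P[sw sW] /setD1P[s'w s'W] ess'].
  have nS r : r != w -> r \in ~: S by move=> rw; rewrite in_setC; apply: contra rw => /(subsetP Sw); rewrite in_set1.
  by apply: connect1; rewrite /= sW s'W ess' !nS.
move=> /(linkage_starts c2)[g [gP gD]].
have gE c : c \in [set a; b] -> exists q, [/\ g c = c :: q, conn e [set z in g c], last c q \in H,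
    [set z in g c] :&: [set z in H] \subset [set last c q] & [set z in g c] \subset W].
  move=> cab; have := gP c cab; have cW' : c \in W by move: cab; rewrite !inE => /orP[]/eqP->.
  case: (g c) => // c' q /and4P[/set1P-> lH pq uq].
  have [pq' hb] := stop_path pq; have [cq sq] := path_branch cW' pq'.
  exists q; split=> //; first by rewrite in_set in lH.
  apply/subsetP => t /setIP[]; rewrite in_set lastI mem_rcons in_cons in_set1 => /orP[//|/hb/negPf->//].
have [qa [Ea ca la ia sa]] := gE a (set21 _ _); have [qb [Eb cb lb ib sb]] := gE b (set22 _ _).
have dj := gD a b (set21 _ _) (set22 _ _) nab.
pose u := last a qa; pose v := last b qb.
have ua : u \in [set z in g a] by rewrite inE Ea mem_last.
have vb : v \in [set z in g b] by rewrite inE Eb mem_last.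
have aa : a \in [set z in g a] by rewrite inE Ea mem_head.
have bb : b \in [set z in g b] by rewrite inE Eb mem_head.
have gab z : z \in [set z in g a] -> z \in [set z in g b] -> False.
  by rewrite !in_set; move/disjointP: dj; apply.
have nuv : u != v by apply/eqP => E; apply: (gab u) => //; rewrite E.
have L1 := lp_join (lp_conn ca aa ua) (long_arc_half la lb nuv) ia isT.
have i3 : ([set z in g a] :|: [set z in H]) :&: [set z in g b] \subset [set v].
  rewrite setIUl subUset [[set z in H] :&: _]setIC ib andbT.
  by apply/subsetP => z /setIP[z1 z2]; case: (gab z z1 z2).
have L2 := lp_join L1 (lp_conn cb vb bb) i3 isT.
apply: lpW L2; first by rewrite !subUset sa sb sHW.
by clear; lia.
Qed.

Lemma large_rest : mu.+1 * lam.+1 <= #|T|.+1.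
Proof.
pose hi := [set v | lam <= #|[set w in B | e v w]|].
have [D [sHD sDB gD cD]] := block_exists.
have [/forallP sepk|] := boolP [forall S : {set T},
    separates (ein e D) [set z in H] (bnd e B hi D) S ==> (lam./2.+1 <= #|S|)].
  by apply: linked_terminals sHD sDB gD (menger (fun S => implyP (sepk S))).
rewrite negb_forall => /existsP[S]; rewrite negb_imply -ltnNge ltnS => /andP[sep cS].
have [W1 [sHW1 sW1D bS]] := separator_boundary sDB sHD sep.
have [W [/andP[sHW sWD] bW mW]] := @min_card_set T (fun W => ([set z in H] \subset W) && (W \subset D))
  (fun W => #|bnd e B hi W|) W1 (introT andP (conj sHW1 sW1D)).
have cW w : conn e (W :\ w) by apply: tight_conn sHW sWD sDB cD mW.
have {bW} cb : #|bnd e B hi W| <= lam./2.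
  by apply: leq_trans bW _; apply: leq_trans (subset_leq_card bS) cS.
have sWB := subset_trans sWD sDB.
have cn := card_vertices HB; rewrite cardH in cn.
(* A boolean form of [lp]: a simple path has at most |T| vertices, so tuples of bounded length
   suffice for the case split. *)
have [/forall_inP jW|] := boolP [forall a in W, forall b in W, (a != b) ==>
    [exists n : 'I_#|T|, [exists q : n.-tuple T, upath e W a q b && (lam <= n.+1)]]].
  have {}jW a b : a \in W -> b \in W -> a != b -> lp e W a b lam.
    move=> aW bW nab; have /implyP/(_ nab)/existsP[n /existsP[q /andP[uq le]]] := forall_inP (jW a aW) b bW.
    by exists q => //; rewrite size_tuple.
  case: (ltnP 1 mu) => mu2.
    have := fan_to_cycle sHW sWB mu2 jW; move: cn hl; move: (size C) #|T| h; clear; nia.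
  have -> : mu = 1 by move: mu1 mu2; clear; lia.
  by move: cn hl size_C; move: (size C) #|T| h; clear; lia.
rewrite negb_forall_in => /exists_inP[a aW]; rewrite negb_forall_in => /exists_inP[b bW].
rewrite negb_imply => /andP[nab nj]; exfalso.
have short q : upath e W a q b -> (size q).+1 < lam.
  move=> uq; rewrite ltnNge; apply: contra nj => le.
  have lt : size q < #|T|.
    have /and4P[_ uq' _ _] := uq; by have := max_card [in a :: q]; rewrite (card_uniqP uq').
  by apply/existsP; exists (Ordinal lt); apply/existsP; exists (in_tuple q); rewrite uq.
have [q0 uq0 lq0] := half_cycle_path sHW cW aW bW nab.
have [q uq mq] : exists2 q, upath e W a q b & forall q', upath e W a q' b -> size q' <= size q.
  have ex : exists k, [exists t : k.-tuple T, upath e W a t b].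
    by exists (size q0); apply/existsP; exists (in_tuple q0).
  have bd k : [exists t : k.-tuple T, upath e W a t b] -> k <= lam.
    by move=> /existsP[t /short]; rewrite size_tuple; clear; lia.
  case: (ex_maxnP ex bd) => n /existsP[t ut] mx; exists t => // q' uq'; rewrite size_tuple; apply: mx.
  by apply/existsP; exists (in_tuple q').
have /and4P[_ _ qW /eqP lq] := uq.
rewrite -lq in uq mq.
have sq := short q; rewrite -lq in sq; have {}sq := sq uq.
apply: (@no_longest_path _ e es ei B hi W lam a q) => //.
- by move=> v; rewrite inE.
- exact: ltnW.
- by move: cb; move: #|_|; clear; lia.
(* The half-cycle path makes the longest path at least as long as the boundary is large: |bnd W| <=
   lam./2 <= h./2 <= size q. *)
- have := mq q0; rewrite lq => /(_ uq0); move: cb lq0 hl; move: #|_| (size q0) (size q) h; clear; lia.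
(* [W :\ c] is connected and contains an end of the path, so no set off the path can hang at [c]. *)
- move=> I c /set0Pn[i iI] cI sI _ /setDP[cW' cI'] _ cl.
  have [t tq tc] : exists2 t, t \in [set z in a :: q] & t != c.
    have [ac|ac] := eqVneq a c; last by exists a; rewrite // inE mem_head.
    by exists b; [rewrite inE -lq mem_last|rewrite -ac eq_sym].
  have tW : t \in W by apply: (allP qW); rewrite inE in tq.
  have /setDP[iW iP] := subsetP sI i iI.
  have ic : i != c by apply: contraNneq cI' => <-.
  have : t \in I.
    have := connP _ _ (cW c) i t; rewrite !in_setD1 ic tc iW tW => /(_ isT isT).
    apply: connect_closed iI => d w dI /setD1P[wc wW] edw.
    by have := cl d w dI (subsetP sWB w wW) edw; rewrite in_setU1 (negPf wc).
  by move/(subsetP sI); rewrite in_setD tq.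
- move=> f N fP sN N0; exact: (linear_spread es uq mq sq fP sN N0).
Qed.

End LargeRest.
End Setting.

(** * From induced subgraphs to vertex sets *)

Lemma bigmin_le (I : eqType) (r : seq I) (F : I -> nat) k i : i \in r -> \big[minn/k]_(j <- r) F j <= F i.
Proof.
elim: r => // j r IH; rewrite in_cons big_cons => /orP[/eqP->|/IH h]; first exact: geq_minl.
exact: leq_trans (geq_minr _ _) h.
Qed.

Lemma min_degree_le (G : sgraph) (v : G) : min_degree G <= degree v.
Proof. by apply: bigmin_le; rewrite mem_index_enum. Qed.

Lemma is_cycle_val (G : sgraph) (S : {set G}) (d : seq (del_vertices S)) :
  is_cycle d -> is_cycle (map val d) /\ {subset map val d <= ~: S}.
Proof.
case/and3P=> d0 ud cd; split; last by move=> _ /mapP[z _ ->]; apply: valP.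
apply/and3P; rewrite size_map; split=> //; first by rewrite map_inj_uniq //; apply: val_inj.
by case/orP: cd => [->//|cd]; rewrite cycle_map orbC; apply/orP; left; apply: cd.
Qed.

Lemma k_connected_ein (G : sgraph) k (S : {set G}) a b : k_connected k G -> #|S| < k ->
  a \notin S -> b \notin S -> connect (ein (@adj G) (~: S)) a b.
Proof.
move=> [_ kc] Sk aS bS; have aC : a \in ~: S by rewrite inE. have bC : b \in ~: S by rewrite inE.
have /connectP[q pq E] := kc S Sk (Sub a aC) (Sub b bC).
apply/connectP; exists (map val q); last by rewrite (last_map val q (Sub a aC)) -E.
rewrite -[a]/(val (Sub a aC : del_vertices S)) path_map; apply: sub_path pq => z z' ezz'.
by apply/and3P; split; [apply: valP|apply: valP|apply: ezz'].
Qed.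

(** Positive minimum degree provides an edge, a cycle of order 2, so [C] is not a single vertex and
    is a genuine [cycle]. *)
Lemma longest_cycle_longest (G : sgraph) (C : seq G) : 0 < #|G| -> 0 < min_degree G ->
  longest_cycle C -> longest (@adj G) C.
Proof.
move=> /card_gt0P[v _] d1 [/and3P[C0 uC cC] mC].
have [w evw] : exists w, adj v w.
  have : 0 < degree v by apply: leq_trans d1 (min_degree_le v).
  by move=> /card_gt0P[w]; rewrite inE; exists w.
have C2 : 1 < size C.
  apply: (mC [:: v; w]); apply/and3P; split=> //=.
    by rewrite inE andbT; apply: contraTneq evw => ->; rewrite adj_irrefl.
  by rewrite evw adj_sym evw.
have cC' : cycle (@adj G) C by case/orP: cC => // /eqP E; rewrite E in C2.
split=> // d d2 ud cd; apply: mC; apply/and3P; split=> //; first exact: ltnW.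
by rewrite cd orbT.
Qed.

Lemma cycle_off_C (G : sgraph) (C : seq G) m : m < c_bar C ->
  exists x p, [/\ is_cycle (x :: p), [set z in x :: p] \subset ~: [set z in C], m <= size p &
    forall d, is_cycle d -> {subset d <= ~: [set z in C]} -> size d <= (size p).+1].
Proof.
move=> mc; pose B := ~: [set z in C].
pose good k := [exists t : k.-tuple G, is_cycle t && all [in B] t].
have goodP k : reflect (exists2 d : seq G, size d = k & is_cycle d /\ {subset d <= B}) (good k).
  apply: (iffP existsP) => [[t /andP[ct /allP tB]]|[d Ed [cd sd]]].
    by exists t; rewrite ?size_tuple.
  by subst k; exists (in_tuple d); rewrite cd; apply/allP.
have [k lk gk] : exists2 k, m < k & good k.
  have [|none] := boolP [exists k : 'I_#|del_vertices [set z in C]|.+1, (m < k) && [exists t : k.-tuple (del_vertices [set z in C]), is_cycle t]].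
    move=> /existsP[k /andP[mk /existsP[t ct]]]; exists k => //; apply/goodP.
    by have [cd sd] := is_cycle_val ct; exists (map val t); rewrite ?size_map ?size_tuple.
  suff : c_bar C <= m by rewrite leqNgt mc.
  apply/bigmax_leqP => k ck; rewrite leqNgt; apply: contra none => mk.
  by apply/existsP; exists k; rewrite mk.
have bd j : good j -> j <= #|G|.
  move=> /goodP[d <- [/and3P[_ ud _] _]]; by rewrite -(card_uniqP ud) max_card.
case: (ex_maxnP (ex_intro _ k gk) bd) => j /goodP[d Ed [cd sd]] mj.
have kj := mj k gk; case: d Ed cd sd => [|x p] Ed cd sd; first by case/and3P: cd.
exists x, p; split=> //.
- by apply/subsetP => z; rewrite in_set => /sd.
- by rewrite -ltnS -[(size p).+1]/(size (x :: p)) Ed; apply: leq_trans lk kj.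
- by move=> d' cd' sd'; rewrite -[(size p).+1]/(size (x :: p)) Ed; apply: mj; apply/goodP; exists d'.
Qed.

Import Order.TTheory GRing.Theory Num.Theory.

Theorem theorem3 (G : sgraph) (lambda : nat) (C : seq G)
  (hlambda : 1 <= lambda <= min_degree G)
  (hconn : k_connected (min_degree G - lambda + 1) G)
  (hC : longest_cycle C)
  (hdelta : ((#|G| + 2)%:R / (lambda + 1)%:R + lambda%:R - 2%:R
               <= (min_degree G)%:R :> rat)%R) :
  c_bar C <= min_degree G - lambda.
Proof.
have [l1 ld] := andP hlambda.
pose mu := min_degree G - lambda + 1.
have Ed : min_degree G = lambda + mu - 1 by rewrite /mu; lia.
(* The hypothesis on the minimum degree with the denominator cleared, as delta - lambda + 2 = mu +
   1; it misses the lower bound on the order by exactly one. *)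
have nat_bound : #|G| + 2 <= mu.+1 * lambda.+1.
  have : ((#|G| + 2)%:R / (lambda + 1)%:R <= (mu + 1)%:R :> rat)%R.
    have E : (mu + 1 + lambda = min_degree G + 2)%N by rewrite /mu; lia.
    by rewrite -(lerD2r lambda%:R) -natrD E [X in (_ <= X)%R]natrD -lerBlDr.
  rewrite ler_pdivrMr ?ltr0n ?addn1 // mulrC -natrM ler_nat mulnC; lia.
rewrite leqNgt; apply/negP => lt.
have [x [p [/and3P[_ uH cH] HB mH mx]]] := cycle_off_C lt.
have lC : longest (@adj G) C.
  by apply: longest_cycle_longest hC; [case: hconn => h _; apply: leq_ltn_trans h|apply: leq_trans ld].
have cH' : 1 < size (x :: p) -> cycle (@adj G) (x :: p) by move=> h2; case/orP: cH => // /eqP E; rewrite E in h2.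
have mH' q : 1 < size q -> uniq q -> cycle (@adj G) q -> {subset q <= ~: [set z in C]} -> size q <= (size p).+1.
  move=> q2 uq cq sq; apply: mx sq; apply/and3P; split=> //; first exact: ltnW.
  by rewrite cq orbT.
have deg (v : G) : lambda + mu <= #|[set w | adj v w]|.+1.
  have := @min_degree_le G v; move: Ed; rewrite /degree.
  by move: (mu) (min_degree G) #|[set w | _]|; clear; lia.
have mu1 : 0 < mu by rewrite /mu addn1.
have muH : mu <= (size p).+1 by rewrite /mu addn1 ltnS.
suff : mu.+1 * lambda.+1 <= #|G|.+1 by move: nat_bound; move: (mu.+1 * _) #|G|; clear; lia.
have es := @adj_sym G; have ei := @adj_irrefl G.
case: (leqP (size p).+1 lambda) => hl.
  exact: (small_rest es ei lC uH cH' HB mH' deg muH hl).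
apply: (large_rest es ei lC uH cH' HB deg l1 mu1 muH hl) => S a b.
exact: k_connected_ein.
Qed.
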